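(* Consider a second order ordinary differential equation $$y''=P(x,y)+3Q(x,y)\,y'+3R(x,y)\,y'^2+S(x,y)\,y'^3,$$ and let $A,B,F,N,\Omega,\Theta,L,L_1,W,V$ be the functions of $(x,y)$ built from $P,Q,R,S$ as in the context. This equation is equivalent, under point transformations $\tilde x=\tilde x(x,y)$, $\tilde y=\tilde y(x,y)$, to the Painlevé I equation $$\tilde y''=6\tilde y^2+\tilde x$$ if and only if all of the following conditions hold: 1) $F=0$, but $A\neq 0$ or $B\neq 0$; 2) $\Omega=0$; 3) $N=0$; 4) $W=0$; 5) $V=0$; 6) $\Theta\neq 0$; 7) $L_1\neq 0$. In this case an explicit change of variables transforming the equation into Painlevé I is given by $$\tilde x=\frac{1}{\sqrt[5]{12\,I_1}},\qquad \tilde y=\pm\frac{\sqrt{I_2}}{\sqrt[5]{12^3}\,\sqrt[10]{I_1}},\qquad\text{where } I_1=\frac{L_1^4}{L^5},\quad I_2=\frac{\Theta^2}{L}$$ (with suitable branches of the roots and a suitable choice of sign).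
   Context: Setting: $P,Q,R,S$ are analytic functions of two complex variables $(x,y)$; everything is local, near a generic point. A point transformation is a local invertible analytic change of variables $\tilde x=\tilde x(x,y)$, $\tilde y=\tilde y(x,y)$ (nonzero Jacobian); the class of equations $y''=P+3Qy'+3Ry'^2+Sy'^3$ is preserved by such transformations, and two equations are equivalent if some point transformation maps one to the other. ''$X=0$'' means that $X$ vanishes identically, ''$X\ne0$'' that it does not. Subscripts $x,y$ denote partial derivatives. Definitions: $$A=P_{yy}-2Q_{xy}+R_{xx}+2PS_x+SP_x-3PR_y-3RP_y-3QR_x+6QQ_y,$$ $$B=S_{xx}-2R_{xy}+Q_{yy}-2SP_y-PS_y+3SQ_x+3QS_x+3RQ_y-6RR_x,$$ $$G=-BB_x-3AB_y+4BA_y+3SA^2-6RAB+3QB^2,$$ $$H=-AA_y-3BA_x+4AB_x-3PB^2+6QAB-3RA^2,$$ and $F$ is defined by $3F^5=AG+BH$. The remaining quantities are considered when $F=0$ and $(A,B)\ne(0,0)$; they are given by one formula when $A\neq0$ and another when $B\ne0$. $N=-\dfrac{H}{3A}$ if $A\ne 0$; $N=\dfrac{G}{3B}$ if $B\neq 0$. If $A\ne0$: $$\varphi_1=-\frac{3(BP+A_x)}{5A}+\frac35Q,\qquad \varphi_2=\frac{3B(BP+A_x)}{5A^2}-\frac{3(B_x+A_y+3BQ)}{5A}+\frac65R;$$ if $B\ne0$: $$\varphi_1=-\frac{3A(AS-B_y)}{5B^2}-\frac{3(A_y+B_x-3AR)}{5B}-\frac65Q,\qquad \varphi_2=\frac{3(AS-B_y)}{5B}-\frac35R.$$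 $\Omega=\frac53\big((\varphi_1)_y-(\varphi_2)_x\big)$. If $A\ne0$, $\Theta=\omega_1/A$ with $$\omega_1=\frac{12PR}{5A}-\frac{54Q^2}{25A}-\frac{P_y}{A}+\frac{6Q_x}{5A}-\frac{PA_y+BP_x+A_{xx}}{5A^2}-\frac{2B_xP}{5A^2}+\frac{3QA_x-12PBQ}{25A^2}+\frac{6B^2P^2+12BPA_x+6A_x^2}{25A^3};$$ if $B\ne 0$, $\Theta=\omega_2/B$ with $$\omega_2=\frac{12SQ}{5B}-\frac{54R^2}{25B}+\frac{S_x}{B}-\frac{6R_y}{5B}+\frac{SB_x+AS_y-B_{yy}}{5B^2}+\frac{2A_yS}{5B^2}-\frac{3RB_y+12SAR}{25B^2}+\frac{6A^2S^2-12B_yAS+6B_y^2}{25B^3}.$$ $\theta^1=\Theta_y-2\varphi_2\Theta$, $\quad\theta^2=-\Theta_x+2\varphi_1\Theta$. $$L=-\theta^1\theta^2(\theta^1_x-\theta^2_y)-(\theta^2)^2\theta^1_y+(\theta^1)^2\theta^2_x-P(\theta^1)^3-3Q(\theta^1)^2\theta^2-3R\theta^1(\theta^2)^2-S(\theta^2)^3-\tfrac12\Theta^2,$$ $$L_1=L_x\theta^1+L_y\theta^2-4L(\varphi_1\theta^1+\varphi_2\theta^2),$$ $$W=(L_1)_x\theta^1+(L_1)_y\theta^2-5L_1(\varphi_1\theta^1+\varphi_2\theta^2),$$ $$V=(L_1)_xB-(L_1)_yA-5L_1(B\varphi_1-A\varphi_2).$$ *)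

(* Defs.v *)
From HB Require Import structures.
From mathcomp Require Import all_boot all_order all_algebra.
From mathcomp Require Import all_classical all_reals all_analysis.
From mathcomp Require Import complex.

Set Implicit Arguments.
Unset Strict Implicit.
Unset Printing Implicit Defensive.

Import Order.TTheory GRing.Theory Num.Theory.
Import numFieldNormedType.Exports.

Local Open Scope classical_set_scope.
Local Open Scope ring_scope.
Local Open Scope complex_scope.

(* The complex numbers K[i] over a realType K get the topology and the normed
   structure that the library has on the alias K[i]^o only. *)
HB.instance Definition _ (K : realType) := PseudoPointedMetric.copy K[i] K[i]^o.
HB.instance Definition _ (K : realType) := GRing.ComAlgebra.copy K[i] K[i]^o.
HB.instance Definition _ (K : realType) := Vector.copy K[i] K[i]^o.
HB.instance Definition _ (K : realType) := NormedModule.copy K[i] K[i]^o.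

Section Analytic.
Context {K : realType}.
Local Notation C := K[i].
Implicit Types (f : C * C -> C) (U D : set (C * C)).

(* The double series converges absolutely and its square partial sums tend to
   f.  In K[i], 0 < r says that r is a positive real number. *)
Definition analytic_at f (z : C * C) : Prop :=
  exists (a : nat -> nat -> C) (r : C), 0 < r /\
    forall h k : C, `|h| < r -> `|k| < r ->
      (exists M : C, forall n : nat,
         \sum_(i < n) \sum_(j < n) `|a i j * h ^+ i * k ^+ j| <= M) /\
      (fun n : nat => \sum_(i < n) \sum_(j < n) a i j * h ^+ i * k ^+ j)
        @ \oo --> f (z.1 + h, z.2 + k).

Definition analytic_on U f : Prop := forall z, U z -> analytic_at f z.

Definition vanishes_on U f : Prop := forall z, U z -> f z = 0.

Definition Dx f : C * C -> C := fun z => 'D_((1, 0) : C * C) f z.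
Definition Dy f : C * C -> C := fun z => 'D_((0, 1) : C * C) f z.

(* The property holds at all points of a dense open subset of D. *)
Definition generically D (prop : C * C -> Prop) : Prop :=
  exists O : set (C * C),
    [/\ open O, O `<=` D, D `<=` closure O & forall z, O z -> prop z].

End Analytic.

(* y'' = P + 3 Q y' + 3 R y'^2 + S y'^3 *)
Record cubic_ode (K : realType) := CubicODE {
  coefP : K[i] * K[i] -> K[i];
  coefQ : K[i] * K[i] -> K[i];
  coefR : K[i] * K[i] -> K[i];
  coefS : K[i] * K[i] -> K[i] }.

Section PointTransformations.
Context {K : realType}.
Local Notation C := K[i].
Implicit Types (E : cubic_ode K) (f u v : C * C -> C) (U D : set (C * C)).

Definition ode_rhs E (z : C * C) (p : C) : C :=
  coefP E z + 3 * coefQ E z * p + 3 * coefR E z * p ^+ 2 + coefS E z * p ^+ 3.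

Definition painleve1 : cubic_ode K :=
  CubicODE (fun z => 6 * z.2 ^+ 2 + z.1) (fun=> 0) (fun=> 0) (fun=> 0).

Definition jacobian u v (z : C * C) : C := Dx u z * Dy v z - Dy u z * Dx v z.

Definition point_transformation U u v : Prop :=
  [/\ open U, analytic_on U u, analytic_on U v,
      forall z, U z -> jacobian u v z != 0 &
      forall z w, U z -> U w -> u z = u w -> v z = v w -> z = w].

(* First and second derivatives with respect to x of f(x, y(x)) at a point z
   of the graph of y, where y' = p and y'' = q. *)
Definition total_D1 f z (p : C) : C := Dx f z + Dy f z * p.
Definition total_D2 f z (p q : C) : C :=
  Dx (Dx f) z + 2 * Dy (Dx f) z * p + Dy (Dy f) z * p ^+ 2 + Dy f z * q.

(* The derivatives d v / d u and d^2 v / d u^2 along that graph. *)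
Definition new_D1 u v z (p : C) : C := total_D1 v z p / total_D1 u z p.
Definition new_D2 u v z (p q : C) : C :=
  (total_D2 v z p q * total_D1 u z p - total_D1 v z p * total_D2 u z p q)
    / total_D1 u z p ^+ 3.

(* Substituting the new variables (u, v) and their derivatives in the equation
   E' gives the equation E; the 2-jets (z, p, q) for which u is not a local
   parameter on the curve have no image and are left out. *)
Definition maps_ode U u v E E' : Prop :=
  forall z, U z -> forall p q : C, total_D1 u z p != 0 ->
    (q = ode_rhs E z p <->
     new_D2 u v z p q = ode_rhs E' (u z, v z) (new_D1 u v z p)).

Definition equivalent_at D E E' (z : C * C) : Prop :=
  exists (U : set (C * C)) (u v : C * C -> C),
    [/\ U z, U `<=` D, point_transformation U u v & maps_ode U u v E E'].

Definition equivalent_odes D E E' : Prop :=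
  generically D (equivalent_at D E E').

End PointTransformations.

(* N, phi1, phi2 and Theta have one formula with powers of A in the denominators
   and one with powers of B; where A, B <> 0 and F = 0 they agree on the equations
   under study, but the chart is kept as a parameter instead of choosing one. *)
Inductive chart := chartA | chartB.

Section Invariants.
Context {K : realType}.
Local Notation C := K[i].
Variable E : cubic_ode K.
Local Notation P := (coefP E).
Local Notation Q := (coefQ E).
Local Notation R := (coefR E).
Local Notation S := (coefS E).

Definition invA : C * C -> C := fun z =>
  Dy (Dy P) z - 2 * Dy (Dx Q) z + Dx (Dx R) z + 2 * P z * Dx S z
  + S z * Dx P z - 3 * P z * Dy R z - 3 * R z * Dy P z - 3 * Q z * Dx R z
  + 6 * Q z * Dy Q z.

Definition invB : C * C -> C := fun z =>
  Dx (Dx S) z - 2 * Dy (Dx R) z + Dy (Dy Q) z - 2 * S z * Dy P z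
  - P z * Dy S z + 3 * S z * Dx Q z + 3 * Q z * Dx S z + 3 * R z * Dy Q z
  - 6 * R z * Dx R z.

Local Notation A := invA.
Local Notation B := invB.

Definition invG : C * C -> C := fun z =>
  - B z * Dx B z - 3 * A z * Dy B z + 4 * B z * Dy A z + 3 * S z * A z ^+ 2
  - 6 * R z * A z * B z + 3 * Q z * B z ^+ 2.

Definition invH : C * C -> C := fun z =>
  - A z * Dy A z - 3 * B z * Dx A z + 4 * A z * Dx B z - 3 * P z * B z ^+ 2
  + 6 * Q z * A z * B z - 3 * R z * A z ^+ 2.

Variable c : chart.

Definition chart_den : C * C -> C :=
  match c with chartA => A | chartB => B end.

(* The quantities below are meant on this set only: outside it the formulas
   divide by 0. *)
Definition chart_dom (D : set (C * C)) : set (C * C) :=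
  [set z | D z /\ chart_den z != 0].

Definition invN : C * C -> C := fun z =>
  match c with
  | chartA => - invH z / (3 * A z)
  | chartB => invG z / (3 * B z)
  end.

Definition phi1 : C * C -> C := fun z =>
  match c with
  | chartA => - (3 * (B z * P z + Dx A z)) / (5 * A z) + 3 / 5 * Q z
  | chartB => - (3 * A z * (A z * S z - Dy B z)) / (5 * B z ^+ 2)
              - (3 * (Dy A z + Dx B z - 3 * A z * R z)) / (5 * B z)
              - 6 / 5 * Q z
  end.

Definition phi2 : C * C -> C := fun z =>
  match c with
  | chartA => (3 * B z * (B z * P z + Dx A z)) / (5 * A z ^+ 2)
              - (3 * (Dx B z + Dy A z + 3 * B z * Q z)) / (5 * A z)
              + 6 / 5 * R z
  | chartB => (3 * (A z * S z - Dy B z)) / (5 * B z) - 3 / 5 * R z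
  end.

Definition invOmega : C * C -> C := fun z =>
  5 / 3 * (Dy phi1 z - Dx phi2 z).

Definition omega1 : C * C -> C := fun z =>
  (12 * P z * R z) / (5 * A z) - (54 * Q z ^+ 2) / (25 * A z)
  - Dy P z / A z + (6 * Dx Q z) / (5 * A z)
  - (P z * Dy A z + B z * Dx P z + Dx (Dx A) z) / (5 * A z ^+ 2)
  - (2 * Dx B z * P z) / (5 * A z ^+ 2)
  + (3 * Q z * Dx A z - 12 * P z * B z * Q z) / (25 * A z ^+ 2)
  + (6 * B z ^+ 2 * P z ^+ 2 + 12 * B z * P z * Dx A z + 6 * Dx A z ^+ 2)
      / (25 * A z ^+ 3).

Definition omega2 : C * C -> C := fun z =>
  (12 * S z * Q z) / (5 * B z) - (54 * R z ^+ 2) / (25 * B z)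
  + Dx S z / B z - (6 * Dy R z) / (5 * B z)
  + (S z * Dx B z + A z * Dy S z - Dy (Dy B) z) / (5 * B z ^+ 2)
  + (2 * Dy A z * S z) / (5 * B z ^+ 2)
  - (3 * R z * Dy B z + 12 * S z * A z * R z) / (25 * B z ^+ 2)
  + (6 * A z ^+ 2 * S z ^+ 2 - 12 * Dy B z * A z * S z + 6 * Dy B z ^+ 2)
      / (25 * B z ^+ 3).

Definition invTheta : C * C -> C := fun z =>
  match c with
  | chartA => omega1 z / A z
  | chartB => omega2 z / B z
  end.

Definition theta1 : C * C -> C := fun z =>
  Dy invTheta z - 2 * phi2 z * invTheta z.

Definition theta2 : C * C -> C := fun z =>
  - Dx invTheta z + 2 * phi1 z * invTheta z.

Definition invL : C * C -> C := fun z =>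
  - theta1 z * theta2 z * (Dx theta1 z - Dy theta2 z)
  - theta2 z ^+ 2 * Dy theta1 z + theta1 z ^+ 2 * Dx theta2 z
  - P z * theta1 z ^+ 3 - 3 * Q z * theta1 z ^+ 2 * theta2 z
  - 3 * R z * theta1 z * theta2 z ^+ 2 - S z * theta2 z ^+ 3
  - 1 / 2 * invTheta z ^+ 2.

Definition invL1 : C * C -> C := fun z =>
  Dx invL z * theta1 z + Dy invL z * theta2 z
  - 4 * invL z * (phi1 z * theta1 z + phi2 z * theta2 z).

Definition invW : C * C -> C := fun z =>
  Dx invL1 z * theta1 z + Dy invL1 z * theta2 z
  - 5 * invL1 z * (phi1 z * theta1 z + phi2 z * theta2 z).

Definition invV : C * C -> C := fun z =>
  Dx invL1 z * B z - Dy invL1 z * A z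
  - 5 * invL1 z * (B z * phi1 z - A z * phi2 z).

Definition invI1 : C * C -> C := fun z => invL1 z ^+ 4 / invL z ^+ 5.
Definition invI2 : C * C -> C := fun z => invTheta z ^+ 2 / invL z.

(* F is meant to be a function with 3 F^5 = A G + B H on D. *)
Record painleve1_conditions (D : set (C * C)) (F : C * C -> C) : Prop := {
  cond_F : vanishes_on D F;
  cond_AB : ~ vanishes_on D A \/ ~ vanishes_on D B;
  cond_Omega : vanishes_on (chart_dom D) invOmega;
  cond_N : vanishes_on (chart_dom D) invN;
  cond_W : vanishes_on (chart_dom D) invW;
  cond_V : vanishes_on (chart_dom D) invV;
  cond_Theta : ~ vanishes_on (chart_dom D) invTheta;
  cond_L1 : ~ vanishes_on (chart_dom D) invL1 }.

(* a, b, g are analytic branches of (12 I1)^(1/5), I2^(1/2), I1^(1/10) on U;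
   d is a value of (12^3)^(1/5) and s is the sign. *)
Definition explicit_reduction_at (D : set (C * C)) (z : C * C) : Prop :=
  exists (U : set (C * C)) (a b g : C * C -> C) (d s : C),
    [/\ U z, U `<=` chart_dom D & forall w, U w -> invL w != 0] /\
    [/\ analytic_on U a, analytic_on U b & analytic_on U g] /\
    (forall w, U w ->
       [/\ a w ^+ 5 = 12 * invI1 w, b w ^+ 2 = invI2 w &
           g w ^+ 10 = invI1 w]) /\
    d ^+ 5 = 12 ^+ 3 /\ (s = 1 \/ s = -1) /\
    let u := fun w => 1 / a w in
    let v := fun w => s * (b w / (d * g w)) in
    point_transformation U u v /\ maps_ode U u v E painleve1.

End Invariants.

(* Main.v *)
Require Import Defs.
From HB Require Import structures.
From mathcomp Require Import all_boot all_order all_algebra.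
From mathcomp Require Import all_classical all_reals all_analysis.
From mathcomp Require Import complex.
From mathcomp Require Import zify ring.
Set Implicit Arguments.
Unset Strict Implicit.
Unset Printing Implicit Defensive.
Import Order.TTheory GRing.Theory Num.Theory.
Import numFieldNormedType.Exports.
Local Open Scope classical_set_scope.
Local Open Scope ring_scope.
Local Open Scope complex_scope.

(** Why the theorem holds.

    The coefficients P, Q, R, S are a projective connection on the plane, and
    (A, B) is its curvature.  The conditions F = 0 and N = 0 say that G = H = 0.
    This means that (A, B), as a covector with a weight, is parallel for the
    projective connection coupled to the connection phi = (phi1, phi2) on
    densities ([covector_parallel]), and Omega = 0 says that phi is closed.
    Everything else follows by differentiating and comparing mixed derivatives:
    - the derivatives of A and B determine those of phi, up to the function Theta
      ([schouten_hold]);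
    - the derivatives of phi give the curvature in terms of Theta
      ([curvature]), and as the curvature is (A, B) itself,
      A theta1 + B theta2 = -1 ([theta_normal]);
    - this relation determines the derivatives of theta1 and theta2, up to the
      function L ([theta_derivatives]);
    - these derivatives give d L = 4 L phi - L1 (A, B) ([L_transversal]), and
      W = V = 0 says that d L1 = 5 L1 phi.
    So a branch l of the fifth root of L1 satisfies d l = l phi, and for a
    constant k the functions u = k L / l^4 and v = - k^3 Theta / l^2 have
      d u = - k l (A, B),   d v = k^3 l^-2 (theta2, - theta1).
    Their Jacobian is - k^4 / l, their second derivatives are known by the
    equations above, and they map the equation to v'' = 6 v^2 + u when
    12 k^5 = 1 ([reduction_pullback]).  These u and v are the functions given by
    the roots of I1 and I2 ([explicit_roots]).

    Conversely, let (u, v), with Jacobian J, map the equation to Painleve I.  Then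
    the covector 12 J d u, the connection - d log J and T = - v / (12 J^2) satisfy
    the same equations ([pullback_covector], [pullback_schouten]).  The curvature
    formula shows that the covector is (A, B), and one finds in turn that
    G = H = 0, that phi = - d log J, Theta = T, L = u / (12^3 J^4) and
    L1 = - 1 / (12^4 J^5); from these the conditions can be read off.

    Such a map exists near the points of a dense open set only, and the roots only
    where A or B, L and L1 do not vanish.  The passage between the domain and these
    subsets uses that each invariant is an analytic function on the whole domain
    divided by a power of A, respectively B ([mero_on]), and that the zeros of an
    analytic function on a connected domain are nowhere dense unless it vanishes
    identically ([identity_theorem]).

    The analytic functions are sums of absolutely convergent double power series.
    Their inverses and roots come from fixed points of maps on coefficient arrays
    ([coef_fixpoint]), and the injectivity of (u, v) near a point from strict
    differentiability ([analytic_local_injective]). *)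

(** * Absolutely summable double series *)

Section DoubleSums.
Context {K : realType}.
Local Notation C := K[i].
Implicit Types (a b : nat -> nat -> C) (u v : nat -> C).

Lemma cvg_real_complex (v : nat -> K) (l : K) :
  v @ \oo --> l -> (fun n => (v n)%:C) @ \oo --> l%:C.
Proof.
move=> vl; apply/cvgrPdist_lt => e e0.
have eE : e = (complex.Re e)%:C.
  by move: e e0 => [x y]; rewrite ltcE /= => /andP[/eqP ->].
have e0' : 0 < complex.Re e by rewrite eE ltcR in e0.
move/cvgrPdist_lt : vl => /(_ _ e0'); apply: filterS => n vn.
by rewrite -rmorphB /= normc_def /= expr0n /= addr0 sqrtr_sqr eE ltcR.
Qed.

Lemma monotone_bounded_cvg u (M : C) : (forall n, 0 <= u n) ->
  (forall n, u n <= u n.+1) -> (forall n, u n <= M) ->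
  exists l : C, u @ \oo --> l.
Proof.
move=> u0 uS uM.
have uE n : u n = (complex.Re (u n))%:C.
  by have := u0 n; case: (u n) => x y; rewrite lecE /= => /andP[/eqP ->].
have : cvgn (fun n => complex.Re (u n)).
  apply: nondecreasing_is_cvgn.
    apply/nondecreasing_seqP => n; by rewrite -lecR -!uE.
  exists (complex.Re M) => _ [n _ <-].
  by have := uM n; case: (M) => x y; rewrite lecE /= => /andP[].
move=> /cvg_real_complex ul; exists (limn (fun n => complex.Re (u n)))%:C.
by rewrite (_ : u = fun n => (complex.Re (u n))%:C) //; exact/funext.
Qed.

Lemma squeeze_cvg0 u v : (forall n, `|u n| <= v n) -> v @ \oo --> (0 : C) ->
  u @ \oo --> (0 : C).
Proof.
move=> uv v0; apply/cvgrPdist_lt => e e0.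
move/cvgrPdist_lt : v0 => /(_ _ e0); apply: filterS => n.
rewrite !sub0r !normrN; apply: le_lt_trans.
by rewrite (ger0_norm (le_trans (normr_ge0 (u n)) (uv n))).
Qed.

(** Square partial sums, as in the definition of analyticity. *)
Definition psum a (n : nat) : C := \sum_(i < n) \sum_(j < n) a i j.
Definition norms a i j : C := `|a i j|.
Definition bounded_by a (M : C) := forall n, psum (norms a) n <= M.

Lemma psumD a b n : psum (fun i j => a i j + b i j) n = psum a n + psum b n.
Proof.
by rewrite /psum -big_split; apply: eq_bigr => i _; rewrite -big_split.
Qed.

Lemma psumZ (c : C) a n : psum (fun i j => c * a i j) n = c * psum a n.
Proof.
by rewrite /psum mulr_sumr; apply: eq_bigr => i _; rewrite mulr_sumr.
Qed.

Lemma psumB a b n : psum (fun i j => a i j - b i j) n = psum a n - psum b n.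
Proof.
rewrite -[- psum b n]mulN1r -psumZ -psumD; congr (psum _ n).
by apply/funext => i; apply/funext => j; rewrite mulN1r.
Qed.

Lemma eq_psum a b n : (forall i j, a i j = b i j) -> psum a n = psum b n.
Proof. by move=> ab; apply: eq_bigr => i _; apply: eq_bigr => j _. Qed.

Lemma le_psum a b n : (forall i j, a i j <= b i j) -> psum a n <= psum b n.
Proof. by move=> ab; apply: ler_sum => i _; apply: ler_sum => j _. Qed.

Lemma norm_psum a n : `|psum a n| <= psum (norms a) n.
Proof.
apply: le_trans (ler_norm_sum _ _ _) _; apply: ler_sum => i _.
exact: ler_norm_sum.
Qed.

Lemma psum_ge0 a n : (forall i j, 0 <= a i j) -> 0 <= psum a n.
Proof. by move=> a0; apply: sumr_ge0 => i _; apply: sumr_ge0. Qed.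

Lemma psum_homo a n m : (forall i j, 0 <= a i j) -> (n <= m)%N ->
  psum a n <= psum a m.
Proof.
move=> a0 /subnK <-; elim: (m - n)%N => {m} [|m IH]; first by rewrite add0n.
apply: le_trans IH _; rewrite addSn /psum big_ord_recr /= -[leLHS]addr0.
apply: lerD; last by apply: sumr_ge0.
by apply: ler_sum => i _; rewrite big_ord_recr /= lerDl.
Qed.

Lemma bounded_le a b M : (forall i j, `|a i j| <= `|b i j|) ->
  bounded_by b M -> bounded_by a M.
Proof. by move=> ab bM n; apply: le_trans (bM n); exact: le_psum. Qed.

Lemma bounded_ge0 a M : bounded_by a M -> 0 <= M.
Proof. by move=> /(_ 0); apply: le_trans; rewrite /psum big_ord0. Qed.

Lemma boundedD a b M N : bounded_by a M -> bounded_by b N ->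
  bounded_by (fun i j => a i j + b i j) (M + N).
Proof.
move=> aM bN n; apply: le_trans (lerD (aM n) (bN n)).
by rewrite -psumD; apply: le_psum => i j; exact: ler_normD.
Qed.

Lemma boundedZ (c : C) a M : bounded_by a M ->
  bounded_by (fun i j => c * a i j) (`|c| * M).
Proof.
move=> aM n; apply: le_trans (ler_wpM2l (normr_ge0 c) (aM n)).
by rewrite -psumZ; apply: le_psum => i j; rewrite /norms normrM.
Qed.

Lemma bounded_cvg_ge0 a M : (forall i j, 0 <= a i j) -> bounded_by a M ->
  exists l : C, psum a @ \oo --> l.
Proof.
move=> a0 aM; apply: (monotone_bounded_cvg (M := M)) => n.
- exact: psum_ge0.
- exact: psum_homo.
- by apply: le_trans (aM n); apply: le_psum => i j; rewrite /norms ger0_norm.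
Qed.

(** A real array r is the difference of the nonnegative arrays |r| and |r| - r. *)
Lemma bounded_cvg_real (r : nat -> nat -> K) M :
  bounded_by (fun i j => (r i j)%:C) M ->
  exists l : C, psum (fun i j => (r i j)%:C) @ \oo --> l.
Proof.
move=> rM; pose a i j : C := (r i j)%:C.
have normE i j : `|norms a i j| = `|a i j| by rewrite /norms normr_id.
have normsM : bounded_by (norms a) M.
  by apply: bounded_le rM => i j; rewrite normE.
have n0 i j : 0 <= norms a i j := normr_ge0 _.
have pos i j : 0 <= norms a i j - a i j.
  rewrite subr_ge0 /norms /a; set x := r i j.
  by rewrite normc_def /= expr0n /= addr0 sqrtr_sqr lecR ler_norm.
have [l al] := bounded_cvg_ge0 n0 normsM.
have [m am] : exists l : C,
    psum (fun i j => norms a i j - a i j) @ \oo --> l.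
  apply: bounded_cvg_ge0 pos _.
  rewrite (_ : (fun i j => _) = fun i j => norms a i j + -1 * a i j).
    exact: boundedD normsM (boundedZ (-1) rM).
  by apply/funext => i; apply/funext => j; rewrite mulN1r.
exists (l - m).
rewrite (_ : psum _ = psum (norms a) - psum (fun i j => norms a i j - a i j)).
  exact: (cvgB al am).
by apply/funext => n; rewrite !fctE psumB subKr.
Qed.

Lemma bounded_cvg a M : bounded_by a M -> exists l : C, psum a @ \oo --> l.
Proof.
move=> aM.
have reM : bounded_by (fun i j => (complex.Re (a i j))%:C) M.
  apply: bounded_le aM => i j; apply: le_trans (normc_ge_Re _).
  by rewrite (normc_def (_%:C)) /= expr0n /= addr0 sqrtr_sqr.
have imM : bounded_by (fun i j => (complex.Im (a i j))%:C) M.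
  apply: bounded_le aM => i j; case: (a i j) => x y /=.
  rewrite !normc_def /= expr0n /= addr0 lecR; apply: ler_wsqrtr.
  by rewrite lerDr sqr_ge0.
have [l al] := bounded_cvg_real reM; have [m am] := bounded_cvg_real imM.
exists (l + 'i * m).
rewrite (_ : psum a = psum (fun i j => (complex.Re (a i j))%:C) + 
  cst 'i * psum (fun i j => (complex.Im (a i j))%:C)).
  exact: (cvgD al (cvgM (cvg_cst ('i : C)) am)).
apply/funext => n; rewrite !fctE -psumZ -psumD; apply: eq_psum => i j.
by case: (a i j) => x y; simpc.
Qed.

Lemma cvg_norm_le u (l M : C) : 0 <= M -> (forall n, `|u n| <= M) ->
  u @ \oo --> l -> `|l| <= M.
Proof.
move=> M0 uM ul; rewrite real_leNgt ?normr_real ?ger0_real//; apply/negP => Ml.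
move/cvgrPdist_lt : ul => /(_ (`|l| - M)); rewrite subr_gt0 => /(_ Ml).
move=> [n _ /(_ _ (leqnn n))] /= lun.
have := lt_le_trans lun (le_trans (lerB (lexx `|l|) (uM n)) (lerB_dist _ _)).
by rewrite ltxx.
Qed.

Lemma psum_lim_le a M (l : C) :
  bounded_by a M -> psum a @ \oo --> l -> `|l| <= M.
Proof.
move=> aM; apply: cvg_norm_le; first exact: bounded_ge0 aM.
by move=> n; apply: le_trans (norm_psum _ _) _.
Qed.

(** The coefficients of a product of two double power series. *)
Definition conv a b i j : C :=
  \sum_(p < i.+1) \sum_(q < j.+1) a p q * b (i - p)%N (j - q)%N.

(** Summing along antidiagonals covers the triangle below the last of them. *)
Lemma triangular_sum (F : nat -> nat -> C) n :
  \sum_(i < n) \sum_(p < i.+1) F p (i - p)%N =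
  \sum_(p < n) \sum_(r < n) (if (p + r < n)%N then F p r else 0).
Proof.
elim: n => [|n IH]; first by rewrite !big_ord0.
rewrite big_ord_recr /= IH.
rewrite [RHS](eq_bigr (fun p : 'I_n.+1 => \sum_(r < n)
  (if (p + r < n)%N then F p r else 0) + F p (n - p)%N)); last first.
  move=> p _; have pn : (p <= n)%N by rewrite -ltnS.
  rewrite (eq_bigr (fun r : 'I_n.+1 => (if (p + r < n)%N then F p r else 0) +
      (if r == (n - p)%N :> nat then F p r else 0))).
    rewrite big_split /= big_ord_recr /= ltnNge leq_addl addr0; congr (_ + _).
    have np : (n - p < n.+1)%N by rewrite ltnS leq_subr.
    rewrite (bigD1 (Ordinal np)) //= eqxx big1 ?addr0 // => r /negPf.
    by rewrite -val_eqE /= => ->.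
  move=> r _; rewrite ltnS leq_eqVlt.
  rewrite -(eqn_add2l p r (n - p)%N) subnKC //.
  by case: eqP => [->|_]; rewrite ?ltnn ?add0r ?addr0.
rewrite [RHS]big_split /= [X in _ = X + _]big_ord_recr /=.
rewrite [X in _ = _ + X + _]big1 ?addr0 //.
by move=> r _; rewrite ltnNge leq_addr.
Qed.

Lemma psum_conv a b n : psum (conv a b) n =
  \sum_(p < n) \sum_(r < n) \sum_(q < n) \sum_(t < n)
    (if ((p + r < n) && (q + t < n))%N then a p q * b r t else 0).
Proof.
transitivity (\sum_(i < n) \sum_(p < i.+1) (\sum_(q < n) \sum_(t < n)
    if (q + t < n)%N then a p q * b (i - p)%N t else 0)).
  apply: eq_bigr => i _; rewrite /conv exchange_big /=; apply: eq_bigr => p _.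
  exact: (triangular_sum (fun q t => a p q * b (i - p)%N t)).
rewrite (triangular_sum (fun p r => \sum_(q < n) \sum_(t < n)
    if (q + t < n)%N then a p q * b r t else 0)).
apply: eq_bigr => p _; apply: eq_bigr => r _.
case: (p + r < n)%N => //=; rewrite big1 // => q _; exact: big1.
Qed.

Lemma psumM a b n : psum a n * psum b n =
  \sum_(p < n) \sum_(r < n) \sum_(q < n) \sum_(t < n) (a p q * b r t).
Proof.
rewrite /psum mulr_suml; apply: eq_bigr => p _.
rewrite mulr_sumr; apply: eq_bigr => r _.
rewrite mulr_suml; apply: eq_bigr => q _; exact: mulr_sumr.
Qed.

Lemma norm_conv a b i j : norms (conv a b) i j <= conv (norms a) (norms b) i j.
Proof.
apply: le_trans (ler_norm_sum _ _ _) _; apply: ler_sum => p _.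
apply: le_trans (ler_norm_sum _ _ _) _; apply: ler_sum => q _.
by rewrite normrM.
Qed.

(** The terms of the product of two partial sums that the partial sum of the
    convolution leaves out are at most as large as for the absolute values. *)
Lemma psum_conv_defect a b n :
  `|psum a n * psum b n - psum (conv a b) n| <=
  psum (norms a) n * psum (norms b) n - psum (conv (norms a) (norms b)) n.
Proof.
rewrite !psumM !psum_conv -!sumrB.
do 2 (apply: le_trans (ler_norm_sum _ _ _) _; apply: ler_sum => ? _;
  rewrite -!sumrB).
do 2 (apply: le_trans (ler_norm_sum _ _ _) _; apply: ler_sum => ? _;
  rewrite -?sumrB).
by case: ifP; rewrite ?subrr ?normr0 ?subr0 // normrM.
Qed.

Lemma le_sum_widen (F G : nat -> C) m n : (m <= n)%N ->
  (forall i, (i < n)%N -> 0 <= G i) -> (forall i, (i < m)%N -> F i <= G i) ->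
  \sum_(i < m) F i <= \sum_(i < n) G i.
Proof.
move=> mn G0 FG; rewrite -!(big_mkord xpredT) [leRHS](big_cat_nat (n := m)) //=.
rewrite -[leLHS]addr0; apply: lerD.
  by rewrite !big_mkord; apply: ler_sum => i _; exact: FG.
rewrite big_nat_cond; apply: sumr_ge0 => i; rewrite andbT => /andP[_]; exact: G0.
Qed.

(** Two indices below half of n have a sum below n. *)
Lemma psum_conv_half a b n :
  psum (norms a) n./2 * psum (norms b) n./2 <=
  psum (conv (norms a) (norms b)) n.
Proof.
have half_le : (n./2 <= n)%N by lia.
have pos p q r t : 0 <= norms a p q * norms b r t := mulr_ge0 (normr_ge0 _) (normr_ge0 _).
pose T p r q t := norms a p q * norms b r t.
pose V p r q t := if ((p + r < n) && (q + t < n))%N then T p r q t else 0.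
have V0 p r q t : 0 <= V p r q t by rewrite /V; case: ifP => // _; exact: pos.
rewrite psumM psum_conv.
apply: (@le_sum_widen
  (fun p => \sum_(r < _) \sum_(q < _) \sum_(t < _) T p r q t)
  (fun p => \sum_(r < _) \sum_(q < _) \sum_(t < _) V p r q t)) => // p pn.
  by do 3 (apply: sumr_ge0 => ? _).
apply: (@le_sum_widen (fun r => \sum_(q < _) \sum_(t < _) T p r q t)
  (fun r => \sum_(q < _) \sum_(t < _) V p r q t)) => // r rn.
  by do 2 (apply: sumr_ge0 => ? _).
apply: (@le_sum_widen (fun q => \sum_(t < _) T p r q t)
  (fun q => \sum_(t < _) V p r q t)) => // q qn.
  by apply: sumr_ge0 => ? _.
apply: (@le_sum_widen (T p r q) (V p r q)) => // t tn.
by rewrite /V ifT //; lia.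
Qed.

Lemma norms_id a : norms (norms a) = norms a.
Proof. by apply/funext => i; apply/funext => j; rewrite /norms normr_id. Qed.

Lemma bounded_norms a M : bounded_by a M -> bounded_by (norms a) M.
Proof. by rewrite /bounded_by norms_id. Qed.

Lemma psum_norms_ge0 a n : 0 <= psum (norms a) n.
Proof. by apply: psum_ge0 => i j; exact: normr_ge0. Qed.

Lemma bounded_conv a b M N : bounded_by a M -> bounded_by b N ->
  bounded_by (conv a b) (M * N).
Proof.
move=> aM bN n; apply: le_trans (le_psum _ (norm_conv a b)) _.
apply: le_trans (ler_pM (psum_norms_ge0 a n) (psum_norms_ge0 b n) (aM n) (bN n)).
have := psum_conv_defect (norms a) (norms b) n.
by move=> /(le_trans (normr_ge0 _)); rewrite !norms_id subr_ge0.
Qed.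

(** Cauchy product: the terms of the product of two square partial sums that
    the partial sum of [conv] leaves out lie outside a square of half the size,
    so for the absolute values they are bounded by a difference of two sequences
    with the same limit. *)
Lemma conv_cvg a b M N (l m : C) : bounded_by a M -> bounded_by b N ->
  psum a @ \oo --> l -> psum b @ \oo --> m -> psum (conv a b) @ \oo --> l * m.
Proof.
move=> aM bN al bm.
have [l' al'] := bounded_cvg (bounded_norms aM).
have [m' bm'] := bounded_cvg (bounded_norms bN).
have half : n./2 @[n --> \oo] --> \oo.
  move=> A [n _ nA]; exists n.*2 => // k /= nk; apply: nA => /=; lia.
have D0 : (fun n => psum a n * psum b n - psum (conv a b) n) @ \oo --> (0 : C).
  apply: (@squeeze_cvg0 _ (fun n => psum (norms a) n * psum (norms b) n -
    psum (norms a) n./2 * psum (norms b) n./2)).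
    move=> n; apply: le_trans (psum_conv_defect _ _ _) _.
    by rewrite lerB // psum_conv_half.
  rewrite -(subrr (l' * m')).
  apply: (cvgB (cvgM al' bm') (cvgM (cvg_comp _ _ half al') (cvg_comp _ _ half bm'))).
rewrite -[l * m]subr0 (_ : psum _ = fun n => psum a n * psum b n -
   (psum a n * psum b n - psum (conv a b) n)).
  exact: (cvgB (cvgM al bm) D0).
by apply/funext => n; rewrite subKr.
Qed.

End DoubleSums.

(** * Expansions in double power series *)

Section Expansions.
Context {K : realType}.
Local Notation C := K[i].
Implicit Types (a b : nat -> nat -> C) (f g : C * C -> C) (z : C * C).

Definition weight a (h k : C) i j : C := a i j * h ^+ i * k ^+ j.

(** Rescaling to the unit polydisc turns the bound on all partial sums of
    absolute values into one bound [M] for the coefficients themselves, and two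
    functions can then be expanded with a common scale. *)
Definition expand f z (s : C) a (M : C) : Prop :=
  [/\ 0 < s, bounded_by a M &
      forall h k : C, `|h| <= 1 -> `|k| <= 1 ->
        psum (weight a h k) @ \oo --> f (z.1 + s * h, z.2 + s * k)].

Definition tsum a : C := lim (psum a @ \oo).

Lemma cvg_tsum a (l : C) : psum a @ \oo --> l -> tsum a = l.
Proof. by move=> al; exact: (cvg_lim (@norm_hausdorff _ _) al). Qed.

Lemma tsum_cvg a M : bounded_by a M -> psum a @ \oo --> tsum a.
Proof. by move=> /bounded_cvg[l al]; rewrite (cvg_tsum al). Qed.

Lemma norm_weight_le a h k i j :
  `|h| <= 1 -> `|k| <= 1 -> `|weight a h k i j| <= `|a i j|.
Proof.
move=> h1 k1; rewrite /weight -mulrA normrM -[leRHS]mulr1 ler_wpM2l //.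
by rewrite normrM !normrX mulr_ile1 ?exprn_ge0 ?exprn_ile1.
Qed.

Lemma bounded_weight a h k M : `|h| <= 1 -> `|k| <= 1 ->
  bounded_by a M -> bounded_by (weight a h k) M.
Proof. by move=> h1 k1; apply: bounded_le => i j; exact: norm_weight_le. Qed.

Lemma weight_conv a b h k :
  conv (weight a h k) (weight b h k) = weight (conv a b) h k.
Proof.
apply/funext => i; apply/funext => j; rewrite /weight /conv !mulr_suml.
apply: eq_bigr => p _; rewrite !mulr_suml; apply: eq_bigr => q _.
have pi : (p <= i)%N by rewrite -ltnS. have qj : (q <= j)%N by rewrite -ltnS.
have -> : h ^+ i = h ^+ p * h ^+ (i - p) by rewrite -exprD subnKC.
have -> : k ^+ j = k ^+ q * k ^+ (j - q) by rewrite -exprD subnKC.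
ring.
Qed.

Lemma weightM a x y h k : weight (weight a x y) h k = weight a (x * h) (y * k).
Proof.
apply/funext => i; apply/funext => j; rewrite /weight !exprMn; ring.
Qed.

Lemma weightD a b h k : weight (fun i j => a i j + b i j) h k =
  fun i j => weight a h k i j + weight b h k i j.
Proof. by apply/funext => i; apply/funext => j; rewrite /weight; ring. Qed.

Lemma weightZ (c : C) a h k : weight (fun i j => c * a i j) h k =
  fun i j => c * weight a h k i j.
Proof. by apply/funext => i; apply/funext => j; rewrite /weight; ring. Qed.

Lemma psumD_cvg a b (l m : C) : psum a @ \oo --> l -> psum b @ \oo --> m ->
  psum (fun i j => a i j + b i j) @ \oo --> l + m.
Proof.
move=> al bm; rewrite (_ : psum _ = fun n => psum a n + psum b n).
  exact: (cvgD al bm).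
by apply/funext => n; exact: psumD.
Qed.

Lemma psumZ_cvg (c : C) a (l : C) : psum a @ \oo --> l ->
  psum (fun i j => c * a i j) @ \oo --> c * l.
Proof.
move=> al; rewrite (_ : psum _ = fun n => c * psum a n).
  exact: (cvgM (cvg_cst c) al).
by apply/funext => n; exact: psumZ.
Qed.

Lemma analytic_expand f z : analytic_at f z -> exists s a M, expand f z s a M.
Proof.
move=> [a [r [r0 fa]]]; exists (r / 2), (weight a (r / 2) (r / 2)).
have s0 : 0 < r / 2 by rewrite divr_gt0.
have sr : r / 2 < r by rewrite ltr_pdivrMr // ltr_pMr // ltr1n.
have ns : `|r / 2| < r by rewrite gtr0_norm.
have [[M aM] _] := fa _ _ ns ns; exists M.
split; [exact: s0|exact: aM|move=> h k h1 k1].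
rewrite weightM; apply: (fa _ _ _ _).2.
- by rewrite normrM (le_lt_trans _ ns) // ler_piMr.
- by rewrite normrM (le_lt_trans _ ns) // ler_piMr.
Qed.

Lemma expand_analytic f z s a M : expand f z s a M -> analytic_at f z.
Proof.
move=> [s0 aM fa]; exists (weight a s^-1 s^-1), s; split; first exact: s0.
move=> h k hs ks.
have sn0 : s != 0 by rewrite gt_eqF.
have h1 : `|s^-1 * h| <= 1.
  by rewrite normrM normfV (gtr0_norm s0) ler_pdivrMl ?mulr1 // ltW.
have k1 : `|s^-1 * k| <= 1.
  by rewrite normrM normfV (gtr0_norm s0) ler_pdivrMl ?mulr1 // ltW.
have wE : (fun i j => weight a s^-1 s^-1 i j * h ^+ i * k ^+ j) =
  weight a (s^-1 * h) (s^-1 * k) by rewrite -weightM.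
split.
  exists M => n; apply: le_trans (bounded_weight h1 k1 aM n).
  by rewrite -wE.
have sE x : s * (s^-1 * x) = x by rewrite mulVKf.
by have := fa _ _ h1 k1; rewrite (sE h) (sE k) -wE.
Qed.

Lemma expand_shrink f z s a M q : expand f z s a M -> 0 < q -> q <= 1 ->
  expand f z (s * q) (weight a q q) M.
Proof.
move=> [s0 aM fa] q0 q1; have nq : `|q| <= 1 by rewrite gtr0_norm.
split; [exact: mulr_gt0|exact: bounded_weight|move=> h k h1 k1].
rewrite weightM -!mulrA; apply: fa; rewrite normrM; exact: mulr_ile1.
Qed.

Lemma expand_common f g z : analytic_at f z -> analytic_at g z ->
  exists s a M b N, expand f z s a M /\ expand g z s b N.
Proof.
move=> /analytic_expand[s [a [M fa]]] /analytic_expand[t [b [N gb]]].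
have [s0 _ _] := fa; have [t0 _ _] := gb.
have st0 : 0 < s + t by exact: addr_gt0.
exists (s * (t / (s + t))), (weight a (t / (s + t)) (t / (s + t))), M,
  (weight b (s / (s + t)) (s / (s + t))), N; split.
  apply: expand_shrink => //; first exact: divr_gt0.
  by rewrite ler_pdivrMr // mul1r lerDr ltW.
rewrite mulrA [s * t]mulrC -mulrA; apply: expand_shrink => //.
  exact: divr_gt0.
by rewrite ler_pdivrMr // mul1r lerDl ltW.
Qed.

Lemma expandD f g z s a M b N : expand f z s a M -> expand g z s b N ->
  expand (fun w => f w + g w) z s (fun i j => a i j + b i j) (M + N).
Proof.
move=> [s0 aM fa] [_ bN gb]; split; [exact: s0|exact: boundedD|move=> h k h1 k1].
by rewrite weightD; apply: psumD_cvg; [exact: fa|exact: gb].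
Qed.

Lemma expandM f g z s a M b N : expand f z s a M -> expand g z s b N ->
  expand (fun w => f w * g w) z s (conv a b) (M * N).
Proof.
move=> [s0 aM fa] [_ bN gb]; split; [exact: s0|exact: bounded_conv|move=> h k h1 k1].
 rewrite -weight_conv.
apply: (conv_cvg (M := M) (N := N)).
- exact: bounded_weight.
- exact: bounded_weight.
- exact: fa.
- exact: gb.
Qed.

Lemma expandZ (c : C) f z s a M : expand f z s a M ->
  expand (fun w => c * f w) z s (fun i j => c * a i j) (`|c| * M).
Proof.
move=> [s0 aM fa]; split; [exact: s0|exact: boundedZ|move=> h k h1 k1].
by rewrite weightZ; apply: psumZ_cvg; exact: fa.
Qed.

Definition unit_coef (c : C) (i j : nat) : C := if (i + j == 0)%N then c else 0.

Lemma psum_unit a n :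
  (forall i j, (i + j == 0)%N = false -> a i j = 0) -> psum a n.+1 = a 0%N 0%N.
Proof.
move=> a0; rewrite /psum big_ord_recl big_ord_recl big1 ?addr0.
  by rewrite big1 ?addr0 // => i _; rewrite big1 // => j _; exact: a0.
by move=> j _; exact: a0.
Qed.

Lemma expand_cst (c : C) z s : 0 < s ->
  expand (fun=> c) z s (unit_coef c) `|c|.
Proof.
move=> s0; split; [exact: s0|move=> n|move=> h k _ _].
  case: n => [|n]; first by rewrite /psum big_ord0.
  rewrite psum_unit // /norms /unit_coef /= => i j ->; exact: normr0.
rewrite -cvg_shiftS; apply: cvg_near_cst; apply: nearW => n.
rewrite /= psum_unit; first by rewrite /weight /unit_coef /= !expr0 !mulr1.
by move=> i j ij; rewrite /weight /unit_coef ij !mul0r.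
Qed.

Lemma expand_val f z s a M : expand f z s a M -> a 0%N 0%N = f z.
Proof.
move=> [s0 aM fa].
have := fa 0 0; rewrite normr0 => /(_ ler01 ler01).
rewrite !mulr0 !addr0 -surjective_pairing -cvg_shiftS => fz.
have -> : a 0%N 0%N = weight a 0 0 0%N 0%N by rewrite /weight !mulr1.
have E n : psum (weight a 0 0) n.+1 = weight a 0 0 0%N 0%N.
  apply: psum_unit => -[|i] [|j] // _; rewrite /weight ?exprS ?mul0r ?mulr0 ?mul0r //.
have ct : psum (weight a 0 0) n.+1 @[n --> \oo] --> weight a 0 0 0%N 0%N.
  by apply: cvg_near_cst; apply: nearW => n; exact: E.
exact: (cvg_unique (@norm_hausdorff _ _) ct fz).
Qed.

(** The function that a coefficient array sums to; it turns a solution of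
    equations between coefficients into a solution in functions. *)
Definition series_at z (s : C) a (w : C * C) : C :=
  tsum (weight a ((w.1 - z.1) / s) ((w.2 - z.2) / s)).

Lemma expand_series z s a M : 0 < s -> bounded_by a M ->
  expand (series_at z s a) z s a M.
Proof.
move=> s0 aM; split; [exact: s0|exact: aM|move=> h k h1 k1].
rewrite /series_at /=.
have sE x y : (x + s * y - x) / s = y.
  by rewrite [x + _]addrC addrK mulrC mulKf // gt_eqF.
rewrite !sE; apply: (tsum_cvg (M := M)); exact: bounded_weight.
Qed.

Lemma expand_norm f z s a M h k : expand f z s a M -> `|h| <= 1 -> `|k| <= 1 ->
  `|f (z.1 + s * h, z.2 + s * k)| <= M.
Proof.
move=> [s0 aM fa] h1 k1; apply: psum_lim_le (fa _ _ h1 k1).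
exact: bounded_weight.
Qed.

Lemma near_polydisc (P : C * C -> Prop) z : (\forall w \near z, P w) <->
  exists r : C, 0 < r /\
    forall h k, `|h| < r -> `|k| < r -> P (z.1 + h, z.2 + k).
Proof.
split.
  move=> /nbhs_ballP[r r0 rP]; exists r; split => // h k hr kr.
  by apply: rP; split; rewrite /= -ball_normE /ball_ /= opprD addNKr normrN.
move=> [r [r0 rP]]; apply/nbhs_ballP; exists r => // w [/=].
rewrite -!ball_normE /ball_ /= => w1 w2.
have := rP (w.1 - z.1) (w.2 - z.2); rewrite !subrKC -surjective_pairing.
by apply; rewrite distrC.
Qed.

Lemma expand_near f z s a M (P : C * C -> Prop) : expand f z s a M ->
  (forall h k, `|h| <= 1 -> `|k| <= 1 -> P (z.1 + s * h, z.2 + s * k)) ->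
  \forall w \near z, P w.
Proof.
move=> [s0 _ _] fP; apply/near_polydisc; exists s; split => // h k hs ks.
have sE x : s * (x / s) = x by rewrite mulrC divfK // gt_eqF.
rewrite -(sE h) -(sE k); apply: fP.
  by rewrite normrM normfV (gtr0_norm s0) ler_pdivrMr // mul1r ltW.
by rewrite normrM normfV (gtr0_norm s0) ler_pdivrMr // mul1r ltW.
Qed.

Lemma near_eq_analytic f g z :
  (\forall w \near z, f w = g w) -> analytic_at f z -> analytic_at g z.
Proof.
move=> /near_polydisc[r [r0 fg]] [a [t [t0 fa]]].
have rt0 : 0 < r + t by exact: addr_gt0.
have rt : 0 < r * t / (r + t) by rewrite divr_gt0 // mulr_gt0.
exists a, (r * t / (r + t)); split => // h k hr kr.
have lt_r x : x < r * t / (r + t) -> x < r.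
  move=> /lt_trans; apply; rewrite ltr_pdivrMr // ltr_pM2l //.
  by rewrite ltrDr.
have lt_t x : x < r * t / (r + t) -> x < t.
  move=> /lt_trans; apply; rewrite ltr_pdivrMr // mulrC ltr_pM2l //.
  by rewrite ltrDl.
by rewrite -fg; [exact: fa (lt_t _ hr) (lt_t _ kr)|exact: lt_r|exact: lt_r].
Qed.

Lemma analyticD f g z : analytic_at f z -> analytic_at g z ->
  analytic_at (fun w => f w + g w) z.
Proof.
move=> fz gz; have [s [a [M [b [N [fa gb]]]]]] := expand_common fz gz.
exact: expand_analytic (expandD fa gb).
Qed.

Lemma analyticM f g z : analytic_at f z -> analytic_at g z ->
  analytic_at (fun w => f w * g w) z.
Proof.
move=> fz gz; have [s [a [M [b [N [fa gb]]]]]] := expand_common fz gz.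
exact: expand_analytic (expandM fa gb).
Qed.

Lemma analyticC (c : C) z : analytic_at (fun=> c) z.
Proof. exact: expand_analytic (expand_cst c z ltr01). Qed.

Lemma analyticN f z : analytic_at f z -> analytic_at (fun w => - f w) z.
Proof.
move=> /(analyticM (analyticC (-1) z)).
by rewrite (_ : (fun w => -1 * f w) = fun w => - f w) //; apply/funext => w; rewrite mulN1r.
Qed.

Lemma analyticX f n z : analytic_at f z -> analytic_at (fun w => f w ^+ n) z.
Proof.
move=> fz; elim: n => [|n IH]; first exact: analyticC.
rewrite (_ : (fun w => f w ^+ n.+1) = fun w => f w * f w ^+ n); first exact: analyticM.
by apply/funext => w; rewrite exprS.
Qed.

End Expansions.

(** * Inverses and roots as fixed points *)

Section FixedPoints.
Context {K : realType}.
Local Notation C := K[i].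
Implicit Types (a b : nat -> nat -> C) (f g : C * C -> C) (z : C * C).

Definition agree n a b := forall i j, (i + j < n)%N -> a i j = b i j.

Lemma agreeW n a b : agree n.+1 a b -> agree n a b.
Proof. by move=> ab i j ij; apply: ab; exact: ltnW. Qed.

(** A map on coefficient arrays that raises the order of agreement by one has
    the limit of its iterates as a fixed point: the coefficients of total degree
    below [n] are stable after [n] iterations. *)
Lemma coef_fixpoint (T : (nat -> nat -> C) -> nat -> nat -> C) (e : C) :
  0 <= e ->
  (forall a, a 0%N 0%N = 0 -> T a 0%N 0%N = 0) ->
  (forall n a b, a 0%N 0%N = 0 -> b 0%N 0%N = 0 -> agree n a b ->
     agree n.+1 (T a) (T b)) ->
  (forall a, a 0%N 0%N = 0 -> bounded_by a e -> bounded_by (T a) e) ->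
  exists w, [/\ w 0%N 0%N = 0, bounded_by w e & w = T w].
Proof.
move=> e0 T0 Tagree Tbound.
pose it n := iter n T (fun _ _ => 0).
have it0 n : it n 0%N 0%N = 0 by elim: n => //= n; exact: T0.
have itS n : agree n (it n) (it n.+1).
  elim: n => [i j //|n IH].
  exact: (Tagree _ _ _ (it0 n) (it0 n.+1) IH).
have itD n k : agree n (it n) (it (n + k)%N).
  elim: k => [|k IH] i j ij; first by rewrite addn0.
  rewrite addnS -itS ?IH //; lia.
pose w i j := it (i + j).+1 i j.
have itw n : agree n (it n) w.
  move=> i j ij; rewrite /w -{1}(subnKC ij); symmetry; exact: itD.
have w0 : w 0%N 0%N = 0 by exact: it0.
exists w; split => //; last first.
  apply/funext => i; apply/funext => j.
  rewrite -(itw (i + j).+1) // /it iterS.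
  exact: (Tagree _ _ _ (it0 (i + j)%N) w0 (itw (i + j)%N)).
have bit n : bounded_by (it n) e.
  elim: n => [|n IH]; last exact: Tbound.
  by move=> n; rewrite /psum /norms big1 // => i _; rewrite big1 // => j _; rewrite normr0.
move=> n; rewrite (_ : psum _ n = psum (norms (it n.*2)) n); first exact: bit.
apply: eq_bigr => i _; apply: eq_bigr => j _; rewrite /norms itw //.
have := ltn_ord i; have := ltn_ord j; lia.
Qed.

Lemma conv00 a b : conv a b 0%N 0%N = a 0%N 0%N * b 0%N 0%N.
Proof. by rewrite /conv !big_ord1. Qed.

Lemma agree_conv n a a' b b' : a 0%N 0%N = 0 -> a' 0%N 0%N = 0 ->
  b 0%N 0%N = 0 -> b' 0%N 0%N = 0 -> agree n a a' -> agree n b b' ->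
  agree n.+1 (conv a b) (conv a' b').
Proof.
move=> a0 a0' b0 b0' aa bb i j ij.
apply: eq_bigr => p _; apply: eq_bigr => q _.
have pi := ltn_ord p; have qj := ltn_ord q.
have [/eqP|pq] := posnP (p + q)%N.
  by rewrite addn_eq0 => /andP[/eqP -> /eqP ->]; rewrite a0 a0' !mul0r.
have [/eqP|rt] := posnP ((i - p) + (j - q))%N.
  by rewrite addn_eq0 => /andP[/eqP -> /eqP ->]; rewrite b0 b0' !mulr0.
rewrite aa ?bb //; lia.
Qed.

(** The coefficients of (1 + w)^n - 1 - n w, a multiple of w^2: through it the
    equation (1 + w)^n = 1 + g becomes a fixed point problem for w. *)
Fixpoint pow_rest n a : nat -> nat -> C :=
  if n is m.+1 then
    fun i j => pow_rest m a i j + conv a (fun p q => m%:R * a p q + pow_rest m a p q) i j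
  else fun _ _ => 0.

Lemma pow_rest00 n a : a 0%N 0%N = 0 -> pow_rest n a 0%N 0%N = 0.
Proof. by move=> a0; elim: n => //= n ->; rewrite conv00 a0 mul0r addr0. Qed.

Lemma agree_pow_rest k n a b : a 0%N 0%N = 0 -> b 0%N 0%N = 0 ->
  agree n a b -> agree n.+1 (pow_rest k a) (pow_rest k b).
Proof.
move=> a0 b0 ab; elim: k => // k IH i j ij /=; rewrite IH //; congr (_ + _).
apply: (agree_conv (n := n)) => //.
- by rewrite a0 pow_rest00 // mulr0 addr0.
- by rewrite b0 pow_rest00 // mulr0 addr0.
- by move=> p q pq; rewrite ab // (agreeW IH).
Qed.

Fixpoint pow_rest_cst n : nat := if n is m.+1 then (pow_rest_cst m).*2 + m else 0.

Lemma bounded_pow_rest n a (e : C) : e <= 1 -> bounded_by a e ->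
  bounded_by (pow_rest n a) ((pow_rest_cst n)%:R * e ^+ 2).
Proof.
move=> e1 ae; have e0 := bounded_ge0 ae; elim: n => [|n IH] /=.
  by move=> n; rewrite mul0r /psum big1 // => i _; rewrite big1 // => j _; rewrite /norms normr0.
have H := boundedD IH (bounded_conv ae (boundedD (boundedZ n%:R ae) IH)).
move=> m; apply: le_trans (H m) _; rewrite normr_nat.
set c := (pow_rest_cst n)%:R : C.
have -> : ((pow_rest_cst n).*2 + n)%:R = c + (n%:R + c) :> C.
  rewrite -addnn !natrD -/c; ring.
rewrite [leRHS]mulrDl lerD2l mulrDr [leRHS]mulrDl.
have -> : e * (n%:R * e) = n%:R * e ^+ 2 by ring.
rewrite lerD2l ler_piMl // mulr_ge0 ?ler0n ?exprn_ge0 //.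
Qed.

Lemma eq_expand f g z s a b M : f =1 g -> (forall i j, a i j = b i j) ->
  expand f z s a M -> expand g z s b M.
Proof.
move=> /funext <- ab.
by have <- : a = b by apply/funext => i; apply/funext => j.
Qed.

Lemma expand_pow_rest n f z s a M : expand f z s a M -> M <= 1 ->
  expand (fun w => (1 + f w) ^+ n - 1 - n%:R * f w) z s (pow_rest n a)
    ((pow_rest_cst n)%:R * M ^+ 2).
Proof.
move=> fa M1; have [s0 aM _] := fa.
suff [N gN] : exists N, expand (fun w => (1 + f w) ^+ n - 1 - n%:R * f w) z s (pow_rest n a) N.
  by have [_ _ H] := gN; split; [exact: s0|exact: bounded_pow_rest|exact: H].
elim: n => [|n [N IH]] /=.
  exists `|0 : C|; apply: eq_expand (expand_cst 0 z s0) => [w|i j].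
    by rewrite expr0 mul0r subrr subr0.
  by rewrite /unit_coef; case: ifP.
exists (N + M * (`|n%:R : C| * M + N)).
apply: eq_expand (expandD IH (expandM fa (expandD (expandZ n%:R fa) IH))) => // w.
rewrite exprS -natr1; ring.
Qed.

(** Shrinking the polydisc multiplies the coefficients of a function that
    vanishes at the centre by at least one factor of the ratio. *)
Lemma expand_small f z (e : C) : analytic_at f z -> f z = 0 -> 0 < e ->
  exists s a, expand f z s a e /\ a 0%N 0%N = 0.
Proof.
move=> /analytic_expand[s [a [M fa]]] fz e0.
have a00 : a 0%N 0%N = 0 by rewrite (expand_val fa).
have M0 : 0 <= M by have [_ aM _] := fa; exact: bounded_ge0 aM.
pose q := e / (e + M).
have eM : 0 < e + M by rewrite ltr_wpDr.
have q0 : 0 < q by rewrite divr_gt0.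
have q1 : q <= 1 by rewrite ler_pdivrMr // mul1r lerDl.
exists (s * q), (weight a q q); split; last by rewrite /weight a00 !mul0r.
have [sq0 _ H] := expand_shrink fa q0 q1; split; [exact: sq0| |exact: H].
have [_ aM _] := fa.
have qM := boundedZ q aM.
have qMe : `|q| * M <= e.
  by rewrite gtr0_norm // /q mulrAC ler_pdivrMr // ler_pM2l // lerDr ltW.
suff b : forall i j, `|weight a q q i j| <= `|q * a i j|.
  by move=> n; exact: le_trans (bounded_le b qM n) qMe.
move=> i j; have [/eqP|ij] := posnP (i + j)%N.
  by rewrite addn_eq0 => /andP[/eqP -> /eqP ->]; rewrite /weight a00 !mulr0 !mul0r.
rewrite /weight -mulrA -exprD (normrM (a i j)) (normrM q) mulrC ler_wpM2r //.
by rewrite normrX gtr0_norm // -[leRHS]expr1 ler_wiXn2l // ltW.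
Qed.

(** With f / f z = 1 + g the inverse is (1 + w) / f z for the fixed point w of
    w = - (g + g w). *)
Lemma analyticV f z : analytic_at f z -> f z != 0 ->
  analytic_at (fun w => (f w)^-1) z.
Proof.
move=> fz fz0.
pose g w := (f z)^-1 * f w + -1.
have gz : analytic_at g z by apply: analyticD (analyticC _ _); apply: analyticM (analyticC _ _) fz.
have gz0 : g z = 0 by rewrite /g mulVf // subrr.
have h0 : 0 < 2^-1 :> C by rewrite invr_gt0.
have [s [a [ga a0]]] := expand_small gz gz0 h0.
have [s0 aM _] := ga.
have [|||w [w0 wM wE]] := @coef_fixpoint (fun w i j => -1 * (a i j + conv a w i j)) 1 ler01.
- by move=> b b0; rewrite a0 conv00 a0 mul0r addr0 mulr0.
- move=> n b b' b0 b0' bb' i j ij; rewrite (agree_conv a0 a0 b0 b0' _ bb') //.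
- move=> b b0 b1 n; apply: le_trans (boundedZ (-1) (boundedD aM (bounded_conv aM b1)) n) _.
  have -> : 2^-1 + 2^-1 * 1 = 1 :> C by field.
  by rewrite normrN normr1 mulr1.
have we := expand_series z s0 wM.
have we' := expandZ (-1) (expandD ga (expandM ga we)).
rewrite -wE in we'.
set W := series_at z s w in we we'.
have WE : forall h k : C, `|h| <= 1 -> `|k| <= 1 -> let x := (z.1 + s * h, z.2 + s * k) in
    W x = -1 * (g x + g x * W x).
  move=> h k h1 k1; have [_ _ H] := we; have [_ _ H'] := we'.
  exact: (cvg_unique (@norm_hausdorff _ _) (H _ _ h1 k1) (H' _ _ h1 k1)).
have : analytic_at (fun x => (f z)^-1 * (1 + W x)) z.
  apply: analyticM (analyticC _ _) _; apply: analyticD (analyticC _ _) _.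
  exact: expand_analytic we.
apply: near_eq_analytic; apply: (expand_near we) => h k h1 k1.
have := WE h k h1 k1; set x := (_, _) => /= Wx.
have fW : (f z)^-1 * f x * (1 + W x) = 1.
  have -> : (f z)^-1 * f x = 1 + g x by rewrite /g addrC subrK.
  by rewrite mulrDr mulr1 mulrDl mul1r {1}Wx; ring.
have fx0 : f x != 0.
  by apply: contra_eq_neq fW => ->; rewrite mulr0 mul0r eq_sym oner_eq0.
by apply: (mulfI fx0); rewrite mulfV // -[RHS]fW; ring.
Qed.

(** The branch of the n-th root of f that takes the value c at z, on a
    neighbourhood where it stays close to c. *)
Lemma analytic_root f z n (c e : C) : (0 < n)%N -> analytic_at f z ->
  c ^+ n = f z -> c != 0 -> 0 < e ->
  exists r, [/\ analytic_at r z, r z = c &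
    \forall w \near z, r w ^+ n = f w /\ `|r w / c - 1| <= e].
Proof.
move=> n0 fz cn c0 e0.
have nn0 : n%:R != 0 :> C by rewrite pnatr_eq0 -lt0n.
have n1 : 1 <= n%:R :> C by rewrite ler1n.
have np : 0 < n%:R :> C by rewrite ltr0n.
have fz0 : f z != 0 by rewrite -cn expf_neq0.
pose N := (pow_rest_cst n)%:R : C.
have N0 : 0 <= N by exact: ler0n.
pose d := e / (1 + e * (2 * N + 1)).
have den1 : 0 < 1 + e * (2 * N + 1).
  by rewrite ltr_pwDl // mulr_ge0 ?(ltW e0) // addr_ge0 // mulr_ge0.
have d0 : 0 < d by rewrite divr_gt0.
have de : d <= e.
  rewrite ler_pdivrMr // ler_pMr // lerDl mulr_ge0 ?(ltW e0) // addr_ge0 // mulr_ge0 //.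
have dN : d * (2 * N + 1) <= 1.
  by rewrite mulrAC ler_pdivrMr // mul1r lerDr.
have d1 : d <= 1.
  apply: le_trans dN; rewrite ler_pMr // lerDr mulr_ge0 //.
pose g w := (f z)^-1 * f w + -1.
have gz : analytic_at g z by apply: analyticD (analyticC _ _); apply: analyticM (analyticC _ _) fz.
have gz0 : g z = 0 by rewrite /g mulVf // subrr.
have h0 : 0 < d / 2 by rewrite divr_gt0.
have [s [a [ga a0]]] := expand_small gz gz0 h0.
have [s0 aM _] := ga.
have [|||w [w0 wM wE]] := @coef_fixpoint (fun w i j =>
    n%:R^-1 * (a i j + -1 * pow_rest n w i j)) d (ltW d0).
- by move=> b b0; rewrite a0 pow_rest00 // mulr0 addr0 mulr0.
- by move=> m b b' b0 b0' bb' i j ij; rewrite (agree_pow_rest _ b0 b0' bb').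
- move=> b b0 bd m; apply: le_trans (boundedZ _ (boundedD aM (boundedZ (-1)
    (bounded_pow_rest n d1 bd))) m) _.
  rewrite normrN normr1 mul1r normfV normr_nat ler_pdivrMl // -/N.
  apply: le_trans (_ : d <= _); last by rewrite ler_pMl.
  have : N * d ^+ 2 <= d / 2.
    rewrite ler_pdivlMr // (_ : N * d ^+ 2 * 2 = d * (d * (2 * N))); last by ring.
    rewrite ler_piMr ?(ltW d0) //; apply: le_trans dN.
    by rewrite ler_pM2l // lerDl.
  by move=> H; apply: le_trans (lerD (lexx _) H) _; rewrite -splitr.
have we := expand_series z s0 wM.
have we' := expandZ n%:R^-1 (expandD ga (expandZ (-1) (expand_pow_rest n we d1))).
rewrite -wE in we'.
set W := series_at z s w in we we'.
have WE : forall h k : C, `|h| <= 1 -> `|k| <= 1 -> let x := (z.1 + s * h, z.2 + s * k) in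
    W x = n%:R^-1 * (g x + -1 * ((1 + W x) ^+ n - 1 - n%:R * W x)).
  move=> h k h1 k1; have [_ _ H] := we; have [_ _ H'] := we'.
  exact: (cvg_unique (@norm_hausdorff _ _) (H _ _ h1 k1) (H' _ _ h1 k1)).
exists (fun x => c * (1 + W x)); split.
- apply: analyticM (analyticC _ _) _; apply: analyticD (analyticC _ _) _.
  exact: expand_analytic we.
- by rewrite -(expand_val we) w0 addr0 mulr1.
apply: (expand_near we) => h k h1 k1.
have := WE h k h1 k1; have := expand_norm we h1 k1; set x := (_, _) => /= Wd Wx.
split; last by rewrite mulrAC mulfV // mul1r addrC addKr (le_trans Wd).
have : n%:R * W x = g x + -1 * ((1 + W x) ^+ n - 1 - n%:R * W x).
  by rewrite {1}Wx mulrA mulfV // mul1r.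
move=> /eqP; rewrite -subr_eq0 => /eqP E.
have {E} -> : (c * (1 + W x)) ^+ n = c ^+ n * (1 + g x).
  rewrite exprMn; congr (_ * _); apply/eqP; rewrite -subr_eq0; apply/eqP.
  by rewrite -E; ring.
by rewrite cn /g addrCA subrr addr0 mulrA mulfV // mul1r.
Qed.

End FixedPoints.

(** * Termwise differentiation *)

Section Differentiation.
Context {K : realType}.
Local Notation C := K[i].
Implicit Types (a b : nat -> nat -> C) (f g : C * C -> C) (z : C * C).

Lemma cvg_succ (u : nat -> C) (l : C) :
  u @ \oo --> l -> (fun n => u n.+1) @ \oo --> l.
Proof.
have S : n.+1 @[n --> \oo] --> \oo.
  by move=> A [n _ nA]; exists n => // k /= nk; apply: nA => /=; exact: leqW.
by move=> ul; exact: (cvg_comp _ _ S ul).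
Qed.

Definition shift1 a i j : C := a i.+1 j.

Lemma psum_shift1 a n : (forall j, a 0%N j = 0) ->
  psum a n.+1 = psum (shift1 a) n + \sum_(i < n) a i.+1 n.
Proof.
move=> a0; rewrite /psum big_ord_recl big1 ?add0r //.
by rewrite -big_split; apply: eq_bigr => i _; rewrite big_ord_recr.
Qed.

Lemma bounded_shift1 a M : bounded_by a M -> bounded_by (shift1 a) M.
Proof.
move=> aM n; apply: le_trans (aM n.+1).
rewrite /psum [leRHS]big_ord_recl -[leLHS]add0r; apply: lerD.
  by apply: sumr_ge0 => j _; exact: normr_ge0.
apply: ler_sum => i _; rewrite [leRHS]big_ord_recr lerDl; exact: normr_ge0.
Qed.

(** Shifting the first index changes a square partial sum by one column, which
    is small because the sums of the absolute values converge. *)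
Lemma shift1_cvg a M (l : C) : bounded_by a M -> (forall j, a 0%N j = 0) ->
  psum a @ \oo --> l -> psum (shift1 a) @ \oo --> l.
Proof.
move=> aM a0 al; have [T aT] := bounded_cvg (bounded_norms aM).
have D0 : (fun n => psum a n.+1 - psum (shift1 a) n) @ \oo --> (0 : C).
  apply: (@squeeze_cvg0 _ _ (fun n => psum (norms a) n.+1 - psum (norms a) n)).
    move=> n; rewrite psum_shift1 // addrC addKr.
    have na0 j : norms a 0%N j = 0 by rewrite /norms a0 normr0.
    apply: le_trans (ler_norm_sum _ _ _) _.
    rewrite (psum_shift1 n na0) [X in _ <= X]addrAC -[leLHS]add0r lerD2r subr_ge0.
    have -> : psum (shift1 (norms a)) n = \sum_(i < n.+1) \sum_(j < n) norms a i j.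
      by rewrite big_ord_recl [X in _ = X + _]big1 ?add0r.
    rewrite [leRHS]big_ord_recr lerDl; apply: sumr_ge0 => j _; exact: normr_ge0.
  rewrite -(subrr T); exact: (cvgB (cvg_succ aT) aT).
rewrite (_ : psum _ = fun n => psum a n.+1 - (psum a n.+1 - psum (shift1 a) n)).
  rewrite -[l]subr0; exact: (cvgB (cvg_succ al) D0).
by apply/funext => n; rewrite subKr.
Qed.

(** On a quarter of the polydisc the factors i of the derivative are absorbed by
    the powers, and the bound on the coefficients is kept. *)
Lemma nat_pow_quarter_le1 i : i%:R * (4^-1 : C) ^+ i.-1 <= 1.
Proof.
case: i => [|i] /=; first by rewrite mul0r.
rewrite exprVn ler_pdivrMr ?exprn_gt0 // mul1r -natrX ler_nat.
by elim: i => // i IH; rewrite expnS; lia.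
Qed.

Lemma norm_monomial_derivative_le1 i (h : C) : `|h| <= 4^-1 ->
  `|i%:R * h ^+ i.-1| <= 1.
Proof.
move=> h4; apply: le_trans (nat_pow_quarter_le1 i).
by rewrite normrM normr_nat normrX ler_wpM2l // lerXn2r // nnegrE.
Qed.

(** A bound uniform in the exponent, which sums over all monomials. *)
Lemma pow_increment_le (h t : C) i : `|h| <= 4^-1 -> `|h + t| <= 2^-1 ->
  `|(h + t) ^+ i - h ^+ i - i%:R * t * h ^+ i.-1| <= 2 * `|t| ^+ 2.
Proof.
move=> h4 ht; elim: i => [|i IH].
  by rewrite !expr0 subrr mul0r mul0r subr0 normr0 mulr_ge0 ?exprn_ge0.
have -> : (h + t) ^+ i.+1 - h ^+ i.+1 - i.+1%:R * t * h ^+ i =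
    (h + t) * ((h + t) ^+ i - h ^+ i - i%:R * t * h ^+ i.-1) +
    t ^+ 2 * (i%:R * h ^+ i.-1).
  case: i {IH} => [|i]; first by rewrite !expr0 !expr1; ring.
  by rewrite /= !exprS -!natr1; ring.
apply: le_trans (ler_normD _ _) _; rewrite !normrM.
have -> : 2 * `|t| ^+ 2 = 2^-1 * (2 * `|t| ^+ 2) + `|t| ^+ 2 :> C by field.
apply: lerD; first by rewrite ler_pM // -!normrM.
rewrite -expr2 -normrM -[leRHS]mulr1 ler_wpM2l ?exprn_ge0 //.
exact: norm_monomial_derivative_le1.
Qed.

Definition diff_coef a i j : C := i.+1%:R * a i.+1 j.

Lemma bounded_diff_coef a M (h k : C) : `|h| <= 4^-1 -> `|k| <= 1 ->
  bounded_by a M -> bounded_by (weight (diff_coef a) h k) M.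
Proof.
move=> h4 k1 aM; apply: bounded_le (bounded_shift1 aM) => i j.
rewrite /weight /diff_coef /shift1.
rewrite (_ : _ * _ = (i.+1%:R * h ^+ i) * k ^+ j * a i.+1 j); last by ring.
rewrite normrM ler_piMl // normrM mulr_ile1 //.
  exact: (norm_monomial_derivative_le1 i.+1).
by rewrite normrX exprn_ile1.
Qed.

(** The remainder of the first order expansion is bounded termwise by a multiple
    of the square of the increment, with a constant that is the same for all
    terms. *)
Lemma expand_derive1 f z s a M (h k : C) : expand f z s a M ->
  `|h| <= 4^-1 -> `|k| <= 1 ->
  let w := (z.1 + s * h, z.2 + s * k) in
  derivable f w (1, 0) /\ Dx f w = s^-1 * tsum (weight (diff_coef a) h k).
Proof.
move=> [s0 aM fa] h4 k1 w; set d := tsum _.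
have sn0 : s != 0 by rewrite gt_eqF.
have h1 : `|h| <= 1 by apply: le_trans h4 _; rewrite invf_le1 ?ler1n.
pose e i j := i%:R * a i j * h ^+ i.-1 * k ^+ j.
have eM : bounded_by e M.
  apply: bounded_le aM => i j; rewrite /e.
  rewrite (_ : _ * _ = (i%:R * h ^+ i.-1) * k ^+ j * a i j); last by ring.
  rewrite normrM ler_piMl // normrM mulr_ile1 //.
    exact: norm_monomial_derivative_le1.
  by rewrite normrX exprn_ile1.
have e0 j : e 0%N j = 0 by rewrite /e !mul0r.
have ed : psum e @ \oo --> d.
  have [l el] := bounded_cvg eM.
  have := shift1_cvg eM e0 el.
  have -> : shift1 e = weight (diff_coef a) h k.
    apply/funext => i; apply/funext => j; rewrite /shift1 /e /weight /diff_coef.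
    by rewrite /=; ring.
  by move=> /cvg_tsum dl; rewrite /d dl.
have incr (t : C) : `|h + t| <= 2^-1 ->
   `|f (w.1 + s * t, w.2) - f w - t * d| <= 2 * `|t| ^+ 2 * M.
  move=> ht.
  have ht1 : `|h + t| <= 1 by apply: le_trans ht _; rewrite invf_le1 ?ler1n.
  have := fa _ _ ht1 k1; rewrite mulrDr addrA => f1.
  have f2 := fa _ _ h1 k1.
  have cv := psumD_cvg (psumD_cvg f1 (psumZ_cvg (c := -1) f2)) (psumZ_cvg (c := - t) ed).
  rewrite (_ : f _ - f w - t * d = f (z.1 + s * h + s * t, z.2 + s * k) + -1 * f (z.1 + s * h, z.2 + s * k) + - t * d); last first.
    by rewrite mulN1r mulNr.
  apply: psum_lim_le cv.
  have tt0 : 0 <= 2 * `|t| ^+ 2 :> C by rewrite mulr_ge0 ?exprn_ge0.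
  have := boundedZ (2 * `|t| ^+ 2) aM; rewrite (ger0_norm tt0).
  apply: bounded_le => i j.
  rewrite (_ : _ + _ = ((h + t) ^+ i - h ^+ i - i%:R * t * h ^+ i.-1) * k ^+ j * a i j).
    rewrite (normrM (_ * _) (a i j)) (normrM _ (a i j)) ler_wpM2r //.
    rewrite normrM (ger0_norm tt0) -[leRHS]mulr1.
    apply: ler_pM => //; first exact: pow_increment_le.
    by rewrite normrX exprn_ile1.
  by rewrite /weight /e; ring.
suff cv : t^-1 *: ((f \o shift w) (t *: ((1, 0) : C * C)) - f w) @[t --> (0 : C)^'] --> s^-1 * d.
  split; first by apply/cvg_ex; exists (s^-1 * d).
  exact: (cvg_lim (@norm_hausdorff _ _) cv).
have M0 := bounded_ge0 aM.
apply/cvgrPdist_le => eps eps0.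
have s4 : 0 < s / 4 by rewrite divr_gt0.
have dM : 0 < eps * s ^+ 2 / (2 * M + 1).
  by rewrite divr_gt0 ?mulr_gt0 ?exprn_gt0 // ltr_wpDl ?mulr_ge0.
have bound (t : C) : t != 0 -> `|t| < s / 4 -> `|t| < eps * s ^+ 2 / (2 * M + 1) ->
    `|s^-1 * d - t^-1 *: ((f \o shift w) (t *: ((1, 0) : C * C)) - f w)| <= eps.
  move=> t0 t1 t2.
  have -> : (f \o shift w) (t *: ((1, 0) : C * C)) = f (w.1 + s * (t / s), w.2).
    rewrite (mulrC s) divfK //=; congr f; apply: injective_projections => /=.
      have -> : t%:A = t :> C := mulr1 t.
      by rewrite addrC.
    by rewrite scaler0 add0r.
  have nts : `|t / s| <= 4^-1.
    by rewrite normrM normfV (gtr0_norm s0) ler_pdivrMr // mulrC ltW.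
  have := incr (t / s); set x := f _ => H.
  have {H} : `|x - f w - t / s * d| <= 2 * `|t / s| ^+ 2 * M.
    apply: H; apply: le_trans (ler_normD _ _) _; apply: le_trans (lerD h4 nts) _.
    by rewrite (_ : 4^-1 + 4^-1 = 2^-1 :> C) //; field.
  move=> H.
  have -> : s^-1 * d - t^-1 *: (x - f w) = - t^-1 * (x - f w - t / s * d).
    by rewrite /GRing.scale /=; field; rewrite t0 sn0.
  rewrite normrM normrN normfV ler_pdivrMl ?normr_gt0 //.
  apply: le_trans H _; rewrite normrM normfV (gtr0_norm s0) expr2.
  rewrite (_ : _ * M = `|t| * (2 * M * `|t| / s ^+ 2)); last by field; rewrite sn0.
  rewrite ler_wpM2l // ler_pdivrMr ?exprn_gt0 //.
  apply: le_trans (_ : (2 * M + 1) * `|t| <= _); first by rewrite ler_wpM2r // lerDl.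
  by rewrite mulrC -ler_pdivlMr ?(ltW t2) // ltr_wpDl ?mulr_ge0.
near=> t; apply: bound; near: t.
- exact: nbhs_dnbhs_neq.
- exact: dnbhs0_lt.
- exact: dnbhs0_lt.
Unshelve. all: by end_near.
Qed.

Lemma expand_Dx f z s a M : expand f z s a M ->
  expand (Dx f) z (s * 4^-1) (fun i j => s^-1 * weight (diff_coef a) 4^-1 4^-1 i j)
    (`|s^-1| * M).
Proof.
move=> fa; have [s0 aM _] := fa.
have q4 : `|4^-1| <= 4^-1 :> C by rewrite gtr0_norm.
have q1 : 4^-1 <= 1 :> C by rewrite invf_le1 ?ler1n.
split; first by rewrite mulr_gt0.
  by apply: boundedZ; apply: bounded_diff_coef => //; exact: le_trans q4 q1.
move=> h k h1 k1; rewrite weightZ -!mulrA.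
have h4 : `|4^-1 * h| <= 4^-1 by rewrite normrM -[leRHS]mulr1 ler_pM.
have k4 : `|4^-1 * k| <= 1.
  by rewrite normrM; apply: mulr_ile1 => //; exact: le_trans q4 q1.
have [_ ->] := expand_derive1 fa h4 k4.
apply: psumZ_cvg; rewrite weightM; apply: (tsum_cvg (M := M)).
exact: bounded_diff_coef.
Qed.

End Differentiation.

(** * Differential calculus of analytic functions *)

Section Calculus.
Context {K : realType}.
Local Notation C := K[i].
Implicit Types (a b : nat -> nat -> C) (f g : C * C -> C) (z : C * C).

(** Exchanging the variables reduces derivatives in y to derivatives in x. *)
Definition swapf f : C * C -> C := fun w => f (w.2, w.1).
Definition swapz z : C * C := (z.2, z.1).

Lemma expand_swap f z s a M : expand f z s a M ->
  expand (swapf f) (swapz z) s (fun i j => a j i) M.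
Proof.
have psum_swap b n : psum (fun i j => b j i) n = psum b n by exact: exchange_big.
move=> [s0 aM fa]; split; [exact: s0| |move=> h k h1 k1].
  by move=> n; rewrite (psum_swap (norms a)).
have -> : psum (weight (fun i j => a j i) h k) = psum (weight a k h).
  apply/funext => n; rewrite -psum_swap; apply: eq_psum => i j.
  by rewrite /weight mulrAC.
exact: fa.
Qed.

Lemma quotient_swap f w :
  (fun t : C => t^-1 *: ((swapf f \o shift (swapz w)) (t *: ((1, 0) : C * C)) - swapf f (swapz w))) =
  (fun t : C => t^-1 *: ((f \o shift w) (t *: ((0, 1) : C * C)) - f w)).
Proof. by apply/funext => t; case: w. Qed.

Lemma Dy_swap f w : Dy f w = Dx (swapf f) (swapz w).
Proof. by rewrite /Dx /derive quotient_swap. Qed.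

Lemma derivable_swap f w :
  derivable (swapf f) (swapz w) (1, 0) -> derivable f w (0, 1).
Proof. by rewrite /derivable quotient_swap. Qed.

Lemma Dy_swapf f : Dy f = swapf (Dx (swapf f)).
Proof. by apply/funext => w; rewrite Dy_swap. Qed.

Lemma analytic_swap f z : analytic_at f z -> analytic_at (swapf f) (swapz z).
Proof.
by move=> /analytic_expand[s [a [M /expand_swap]]]; exact: expand_analytic.
Qed.

Lemma analytic_Dx f z : analytic_at f z -> analytic_at (Dx f) z.
Proof.
by move=> /analytic_expand[s [a [M /expand_Dx]]]; exact: expand_analytic.
Qed.

Lemma analytic_Dy f z : analytic_at f z -> analytic_at (Dy f) z.
Proof.
move=> /analytic_swap/analytic_Dx/analytic_swap; rewrite Dy_swapf.
by rewrite /swapz /= -surjective_pairing.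
Qed.

Lemma expand_Dy f z s a M : expand f z s a M ->
  expand (Dy f) z (s * 4^-1)
    (fun i j => s^-1 * weight (diff_coef (fun i j => a j i)) 4^-1 4^-1 j i)
    (`|s^-1| * M).
Proof.
move=> /expand_swap/expand_Dx/expand_swap; rewrite -Dy_swapf.
by rewrite /swapz /= -surjective_pairing.
Qed.

Lemma expand_derivable f z s a M : expand f z s a M ->
  derivable f z (1, 0) /\ derivable f z (0, 1).
Proof.
move=> fa; have h0 : `|0 : C| <= 4^-1 by rewrite normr0 invr_ge0.
have k0 : `|0 : C| <= 1 by rewrite normr0.
have [] := expand_derive1 fa h0 k0; rewrite !mulr0 !addr0 -surjective_pairing => D1 _.
have [] := expand_derive1 (expand_swap fa) h0 k0; rewrite !mulr0 !addr0 => D2 _.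
by split; [exact: D1|exact: (derivable_swap D2)].
Qed.

Lemma analytic_derivable f z : analytic_at f z ->
  derivable f z (1, 0) /\ derivable f z (0, 1).
Proof. by move=> /analytic_expand[s [a [M /expand_derivable]]]. Qed.

Lemma expand_Dx_val f z s a M : expand f z s a M -> Dx f z = s^-1 * a 1%N 0%N.
Proof.
move=> /expand_Dx/expand_val <-; rewrite /weight /diff_coef !expr0 !mulr1.
by rewrite mul1r.
Qed.

Lemma expand_Dy_val f z s a M : expand f z s a M -> Dy f z = s^-1 * a 0%N 1%N.
Proof.
move=> /expand_Dy/expand_val <-; rewrite /weight /diff_coef !expr0 !mulr1.
by rewrite mul1r.
Qed.

Lemma Dx_Dy f z : analytic_at f z -> Dx (Dy f) z = Dy (Dx f) z.
Proof.
move=> /analytic_expand[s [a [M fa]]].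
rewrite (expand_Dx_val (expand_Dy fa)) (expand_Dy_val (expand_Dx fa)).
rewrite /weight /diff_coef !expr0 !expr1; ring.
Qed.

Lemma DxD f g z : analytic_at f z -> analytic_at g z ->
  Dx (fun w => f w + g w) z = Dx f z + Dx g z.
Proof. by move=> /analytic_derivable[fz _] /analytic_derivable[gz _]; exact: (deriveD fz gz). Qed.

Lemma DyD f g z : analytic_at f z -> analytic_at g z ->
  Dy (fun w => f w + g w) z = Dy f z + Dy g z.
Proof. by move=> /analytic_derivable[_ fz] /analytic_derivable[_ gz]; exact: (deriveD fz gz). Qed.

Lemma DxM f g z : analytic_at f z -> analytic_at g z ->
  Dx (fun w => f w * g w) z = Dx f z * g z + f z * Dx g z.
Proof.
move=> /analytic_derivable[fz _] /analytic_derivable[gz _].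
rewrite addrC [Dx f z * _]mulrC; exact: (deriveM fz gz).
Qed.

Lemma DyM f g z : analytic_at f z -> analytic_at g z ->
  Dy (fun w => f w * g w) z = Dy f z * g z + f z * Dy g z.
Proof.
move=> /analytic_derivable[_ fz] /analytic_derivable[_ gz].
rewrite addrC [Dy f z * _]mulrC; exact: (deriveM fz gz).
Qed.

Lemma DxC (c : C) z : Dx (fun=> c) z = 0.
Proof. exact: derive_cst. Qed.

Lemma DyC (c : C) z : Dy (fun=> c) z = 0.
Proof. exact: derive_cst. Qed.

Lemma DxV f z : analytic_at f z -> f z != 0 ->
  Dx (fun w => (f w)^-1) z = - Dx f z / f z ^+ 2.
Proof.
move=> /analytic_derivable[fz _] f0; rewrite mulNr mulrC -mulNr.
exact: (deriveV f0 fz).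
Qed.

Lemma DyV f z : analytic_at f z -> f z != 0 ->
  Dy (fun w => (f w)^-1) z = - Dy f z / f z ^+ 2.
Proof.
move=> /analytic_derivable[_ fz] f0; rewrite mulNr mulrC -mulNr.
exact: (deriveV f0 fz).
Qed.

Lemma near_eq_Dx f g z : (\forall w \near z, f w = g w) -> Dx f z = Dx g z.
Proof. exact: near_eq_derive. Qed.

Lemma near_eq_Dy f g z : (\forall w \near z, f w = g w) -> Dy f z = Dy g z.
Proof. exact: near_eq_derive. Qed.

Lemma open_near (U : set (C * C)) z : open U -> U z -> \forall w \near z, U w.
Proof. by move=> Uo Uz; exact: open_nbhs_nbhs. Qed.

Lemma pow_diff_le (x y rho : C) n : `|x| <= rho -> `|y| <= rho ->
  `|x ^+ n - y ^+ n| <= n%:R * rho ^+ n.-1 * `|x - y|.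
Proof.
move=> xr yr; have r0 : 0 <= rho by exact: le_trans xr.
elim: n => [|n IH]; first by rewrite !expr0 subrr normr0 mul0r mul0r.
have -> : x ^+ n.+1 - y ^+ n.+1 = x * (x ^+ n - y ^+ n) + (x - y) * y ^+ n.
  by rewrite !exprS; ring.
apply: le_trans (ler_normD _ _) _; rewrite !normrM -natr1 mulrDl mulrDl mul1r.
apply: lerD; last by rewrite mulrC ler_wpM2r // normrX lerXn2r // nnegrE.
apply: le_trans (ler_pM (normr_ge0 _) (normr_ge0 _) xr IH) _.
rewrite mulrA ler_wpM2r //; case: (n) => [|m] /=; first by rewrite !mul0r mulr0.
by rewrite mulrCA -exprS.
Qed.

Lemma nat_pow_half_le i (rho : C) : 0 <= rho -> rho <= 2^-1 -> (1 < i)%N ->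
  i%:R * rho ^+ i.-1 <= 2 * rho.
Proof.
case: i => [|[|i]] // r0 r2 _ /=; rewrite exprS mulrCA mulrC ler_wpM2r //.
apply: le_trans (_ : i.+2%:R * 2^-1 ^+ i <= _).
  by rewrite ler_wpM2l // lerXn2r // nnegrE ?invr_ge0.
rewrite exprVn ler_pdivrMr ?exprn_gt0 // -exprS -natrX ler_nat.
by elim: i => // i IH; rewrite expnS; lia.
Qed.

(** The part of an expansion of degree at least two is a contraction with
    small constant near the centre. *)
Lemma expand_strict f z s a M (rho h k h' k' : C) : expand f z s a M ->
  rho <= 2^-1 -> `|h| <= rho -> `|k| <= rho -> `|h'| <= rho -> `|k'| <= rho ->
  `|f (z.1 + s * h, z.2 + s * k) - f (z.1 + s * h', z.2 + s * k') -
    (a 1%N 0%N * (h - h') + a 0%N 1%N * (k - k'))| <=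
  2 * rho * (`|h - h'| + `|k - k'|) * M.
Proof.
move=> [s0 aM fa] r2 hr kr hr' kr'.
have r0 : 0 <= rho by exact: le_trans hr.
have r1 : rho <= 1 by apply: le_trans r2 _; rewrite invf_le1 ?ler1n.
pose e i j : C := match i, j with
  | 1%N, 0%N => a 1%N 0%N * (h - h') | 0%N, 1%N => a 0%N 1%N * (k - k') | _, _ => 0 end.
have ecv : psum e @ \oo --> a 1%N 0%N * (h - h') + a 0%N 1%N * (k - k').
  have E n : psum e n.+2 = a 1%N 0%N * (h - h') + a 0%N 1%N * (k - k').
    have row0 : \sum_(j < n.+2) e 0%N j = a 0%N 1%N * (k - k').
      by rewrite 2!big_ord_recl /= big1 ?addr0 ?add0r.
    have row1 : \sum_(j < n.+2) e 1%N j = a 1%N 0%N * (h - h').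
      by rewrite big_ord_recl /= big1 ?addr0.
    rewrite /psum big_ord_recl row0 big_ord_recl [X in _ + (X + _)]row1.
    rewrite [X in _ + (_ + X)]big1 ?addr0; first by rewrite addrC.
    by move=> i _; rewrite big1.
  have : (fun n => psum e n.+2) @ \oo --> a 1%N 0%N * (h - h') + a 0%N 1%N * (k - k').
    by apply: cvg_near_cst; apply: nearW => n; exact: E.
  move=> H; rewrite -cvg_shiftS -cvg_shiftS; exact: H.
have cv := psumD_cvg (psumD_cvg (fa _ _ (le_trans hr r1) (le_trans kr r1))
  (psumZ_cvg (c := -1) (fa _ _ (le_trans hr' r1) (le_trans kr' r1)))) (psumZ_cvg (c := -1) ecv).
rewrite (_ : _ - _ = f (z.1 + s * h, z.2 + s * k) +
    -1 * f (z.1 + s * h', z.2 + s * k') +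
    -1 * (a 1%N 0%N * (h - h') + a 0%N 1%N * (k - k'))); last by rewrite !mulN1r.
apply: psum_lim_le cv.
have c0 : 0 <= 2 * rho * (`|h - h'| + `|k - k'|).
  by rewrite !mulr_ge0 // addr_ge0.
have := boundedZ (2 * rho * (`|h - h'| + `|k - k'|)) aM; rewrite (ger0_norm c0).
apply: bounded_le => i j; rewrite (normrM _ (a i j)) (ger0_norm c0).
have [ij|ij] := ltnP 1 (i + j); last first.
  rewrite (_ : _ + _ = 0); first by rewrite normr0 mulr_ge0.
  case: i j ij => [|[|i]] [|[|j]] //= _; rewrite /weight /=;
    rewrite ?expr0 ?expr1; ring.
have -> : e i j = 0 by case: i j ij => [|[|i]] [|[|j]].
rewrite (_ : _ + _ = ((h ^+ i - h' ^+ i) * k ^+ j + h' ^+ i * (k ^+ j - k' ^+ j)) * a i j); last first.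
  by rewrite /weight; ring.
rewrite (normrM _ (a i j)) ler_wpM2r // [leRHS]mulrDr.
apply: le_trans (ler_normD _ _) _; rewrite !normrM !normrX.
have pow p q : (1 < p + q)%N -> p%:R * rho ^+ p.-1 * rho ^+ q <= 2 * rho.
  case: p => [|p] pq; first by rewrite !mul0r mulr_ge0.
  rewrite -mulrA -exprD; apply: le_trans (nat_pow_half_le r0 r2 pq).
  by rewrite addSn /= ler_wpM2r ?exprn_ge0 // ler_nat ltnS leq_addr.
apply: lerD.
  apply: le_trans (ler_pM _ _ (pow_diff_le i hr hr') (_ : `|k| ^+ j <= rho ^+ j)) _; rewrite ?exprn_ge0 //.
    by rewrite lerXn2r // nnegrE.
  by rewrite mulrAC ler_wpM2r // pow.
apply: le_trans (ler_pM _ _ (_ : `|h'| ^+ i <= rho ^+ i) (pow_diff_le j kr kr')) _; rewrite ?exprn_ge0 //.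
  by rewrite lerXn2r // nnegrE.
by rewrite mulrA ler_wpM2r // mulrC pow // addnC.
Qed.

(** Differentiability with an error proportional to the distance of two
    arbitrary nearby points; a map with this property and an invertible
    differential is injective nearby. *)
Definition strictly_differentiable_at f z (fx fy : C) : Prop :=
  forall e : C, 0 < e -> exists r : C, 0 < r /\ forall w w' : C * C,
    `|w.1 - z.1| < r -> `|w.2 - z.2| < r -> `|w'.1 - z.1| < r -> `|w'.2 - z.2| < r ->
    `|f w - f w' - (fx * (w.1 - w'.1) + fy * (w.2 - w'.2))| <=
      e * (`|w.1 - w'.1| + `|w.2 - w'.2|).

Lemma analytic_strict f z : analytic_at f z ->
  strictly_differentiable_at f z (Dx f z) (Dy f z).
Proof.
move=> /analytic_expand[s [a [M fa]]] e e0; have [s0 aM _] := fa.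
have M0 := bounded_ge0 aM.
have sn0 : s != 0 by rewrite gt_eqF.
have es0 : 0 < e * s by exact: mulr_gt0.
have D0 : 0 < 2 * (e * s + M) by rewrite mulr_gt0 // ltr_wpDr.
pose rho := e * s / (2 * (e * s + M)).
have rho0 : 0 < rho by rewrite divr_gt0.
have rho2 : rho <= 2^-1.
  rewrite ler_pdivrMr // mulrA mulVf ?pnatr_eq0 // mul1r lerDl //.
have rhoM : 2 * rho * M <= e * s.
  rewrite /rho mulrA mulrAC ler_pdivrMr //.
  rewrite (_ : 2 * (e * s) * M = e * s * (2 * M)); last by ring.
  by rewrite ler_pM2l // ler_pM2l // lerDr ltW.
exists (s * rho); split; first exact: mulr_gt0.
have sE x y : `|x - y| < s * rho -> `|(x - y) / s| <= rho.
  by move=> /ltW xy; rewrite normrM normfV (gtr0_norm s0) ler_pdivrMr // mulrC.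
have zE (x y : C) : y + s * ((x - y) / s) = x.
  by rewrite mulrC divfK // addrC subrK.
move=> w w' w1 w2 w1' w2'.
have := expand_strict fa rho2 (sE _ _ w1) (sE _ _ w2) (sE _ _ w1') (sE _ _ w2').
rewrite !zE -!surjective_pairing (expand_Dx_val fa) (expand_Dy_val fa).
have dE (x y t : C) : (x - t) / s - (y - t) / s = (x - y) / s by field; rewrite sn0.
rewrite !dE !normrM normfV (gtr0_norm s0) => H.
rewrite (_ : s^-1 * _ * _ + _ = a 1%N 0%N * ((w.1 - w'.1) / s) + a 0%N 1%N * ((w.2 - w'.2) / s)); last by ring.
apply: le_trans H _.
rewrite -mulrDl (_ : _ * M = 2 * rho * M / s * (`|w.1 - w'.1| + `|w.2 - w'.2|)); last by ring.
by rewrite ler_wpM2r ?addr_ge0 // ler_pdivrMr.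
Qed.

Lemma analytic_continuous f z (e : C) : analytic_at f z -> 0 < e ->
  \forall w \near z, `|f w - f z| <= e.
Proof.
move=> fz e0; have [r [r0 fr]] := analytic_strict fz ltr01.
pose c : C := `|Dx f z| + `|Dy f z| + 1.
have c0 : 0 < c by rewrite ltr_wpDl // addr_ge0.
have r'0 : 0 < r * e / (r * (2 * c) + e).
  by rewrite divr_gt0 ?mulr_gt0 // addr_gt0 ?mulr_gt0.
apply/near_polydisc; exists (r * e / (r * (2 * c) + e)); split => // h k hr kr.
have D0 : 0 < r * (2 * c) + e by rewrite addr_gt0 ?mulr_gt0.
have ltr x : x < r * e / (r * (2 * c) + e) -> x < r.
  move=> /lt_trans; apply; rewrite ltr_pdivrMr // ltr_pM2l //.
  by rewrite ltrDr !mulr_gt0.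
have lte x : 0 <= x -> x < r * e / (r * (2 * c) + e) -> c * x <= e / 2.
  move=> x0 xr; rewrite ler_pdivlMr // mulrAC -ler_pdivlMl ?mulr_gt0 //.
  apply: le_trans (ltW xr) _; rewrite ler_pdivrMr // (_ : _ * (_ + _) = r * e + e ^+ 2 / (c * 2)).
    by rewrite lerDl divr_ge0 ?exprn_ge0 ?mulr_ge0 // ltW.
  by field; rewrite gt_eqF.
have shiftE (x y : C) : x + y - x = y by rewrite addrC addKr.
have := fr (z.1 + h, z.2 + k) z; rewrite /= !shiftE !subrr normr0 mul1r.
move=> /(_ (ltr _ hr) (ltr _ kr) r0 r0) H.
have := le_trans (lerB_dist _ _) H; rewrite lerBlDr => /le_trans; apply.
apply: le_trans (lerD (lexx _) (ler_normD _ _)) _; rewrite !normrM.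
apply: le_trans (_ : c * `|h| + c * `|k| <= _).
  rewrite addrACA; apply: lerD.
    rewrite -{1}[`|h|]mul1r -mulrDl ler_wpM2r // addrC /c lerD2r lerDl //.
  rewrite -{1}[`|k|]mul1r -mulrDl ler_wpM2r // addrC /c lerD2r lerDr //.
by rewrite [e in leRHS]splitr lerD // lte.
Qed.

Lemma analytic_neq0 f z : analytic_at f z -> f z != 0 ->
  \forall w \near z, f w != 0.
Proof.
move=> fz f0.
have e0 : 0 < `|f z| / 2 by rewrite divr_gt0 // normr_gt0.
apply: filterS (analytic_continuous fz e0) => w; apply: contraTneq => ->.
rewrite sub0r normrN; apply/negP; rewrite ler_pdivlMr // mulr_natr mulr2n.
by rewrite gerDl normr_le0 (negPf f0).
Qed.

(** If f and g agree at two points, the differential maps the difference of the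
    points to a vector that is small compared to that difference; solving with
    Cramer's rule, the difference is at most half of itself. *)
Lemma strict_local_injective f g z (fx fy gx gy : C) :
  strictly_differentiable_at f z fx fy -> strictly_differentiable_at g z gx gy ->
  fx * gy - fy * gx != 0 -> exists r : C, 0 < r /\ forall w w' : C * C,
    `|w.1 - z.1| < r -> `|w.2 - z.2| < r -> `|w'.1 - z.1| < r -> `|w'.2 - z.2| < r ->
    f w = f w' -> g w = g w' -> w = w'.
Proof.
move=> strict_f strict_g J0.
pose c : C := `|fx| + `|fy| + `|gx| + `|gy| + 1.
have c0 : 0 < c by rewrite ltr_wpDl // !addr_ge0.
pose J : C := fx * gy - fy * gx; have nJ0 : 0 < `|J| by rewrite normr_gt0.
have e0 : 0 < `|J| / (2 * c) by rewrite divr_gt0 // mulr_gt0.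
set e := `|J| / (2 * c) in e0.
have [r1 [r10 fr]] := strict_f _ e0.
have [r2 [r20 gr]] := strict_g _ e0.
have r120 : 0 < r1 + r2 by exact: addr_gt0.
exists (r1 * r2 / (r1 + r2)); split; first by rewrite divr_gt0 ?mulr_gt0.
have lt1 x : x < r1 * r2 / (r1 + r2) -> x < r1.
  by move=> /lt_trans; apply; rewrite ltr_pdivrMr // ltr_pM2l // ltrDr.
have lt2 x : x < r1 * r2 / (r1 + r2) -> x < r2.
  by move=> /lt_trans; apply; rewrite ltr_pdivrMr // mulrC ltr_pM2l // ltrDl.
move=> w w' w1 w2 w1' w2' fw gw.
have := gr _ _ (lt2 _ w1) (lt2 _ w2) (lt2 _ w1') (lt2 _ w2').
have := fr _ _ (lt1 _ w1) (lt1 _ w2) (lt1 _ w1') (lt1 _ w2').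
have nE (x y X : C) : x = y -> `|x - y - X| = `|X|.
  by move=> ->; rewrite subrr sub0r normrN.
rewrite (nE _ _ _ fw) (nE _ _ _ gw).
set p := w.1 - w'.1; set q := w.2 - w'.2; set S := `|p| + `|q| => Hf Hg.
have S0 : 0 <= S by rewrite addr_ge0.
have Jp : `|J| * `|p| <= (`|gy| + `|fy|) * (e * S).
  rewrite -normrM (_ : J * p = gy * (fx * p + fy * q) - fy * (gx * p + gy * q)); last by rewrite /J; ring.
  apply: le_trans (ler_normB _ _) _; rewrite !normrM mulrDl.
  by apply: lerD; exact: ler_wpM2l.
have Jq : `|J| * `|q| <= (`|gx| + `|fx|) * (e * S).
  rewrite -normrM (_ : J * q = fx * (gx * p + gy * q) - gx * (fx * p + fy * q)); last by rewrite /J; ring.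
  apply: le_trans (ler_normB _ _) _; rewrite !normrM addrC mulrDl.
  by apply: lerD; exact: ler_wpM2l.
have cge : `|gy| + `|fy| + (`|gx| + `|fx|) <= c.
  rewrite (_ : _ + _ = `|fx| + `|fy| + `|gx| + `|gy|); last by ring.
  by rewrite /c lerDl.
have ce : c * (e * S) = `|J| * S / 2 by rewrite /e; field; rewrite gt_eqF.
have JS : `|J| * S <= `|J| * S / 2.
  rewrite -ce {1}/S mulrDr; apply: le_trans (lerD Jp Jq) _; rewrite -mulrDl.
  by apply: ler_wpM2r cge; rewrite mulr_ge0 // ltW.
move: JS; rewrite ler_pdivlMr // mulr_natr mulr2n gerDl pmulr_rle0 // => SS.
have /eqP : S = 0 by apply/eqP; rewrite eq_le SS S0.
rewrite paddr_eq0 // !normr_eq0 !subr_eq0 => /andP[/eqP E1 /eqP E2].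
by apply: injective_projections.
Qed.

Lemma analytic_local_injective f g z : analytic_at f z -> analytic_at g z ->
  Defs.jacobian f g z != 0 -> exists r : C, 0 < r /\ forall w w' : C * C,
    `|w.1 - z.1| < r -> `|w.2 - z.2| < r -> `|w'.1 - z.1| < r -> `|w'.2 - z.2| < r ->
    f w = f w' -> g w = g w' -> w = w'.
Proof.
by move=> fz gz; exact: strict_local_injective (analytic_strict fz) (analytic_strict gz).
Qed.

End Calculus.

(** * The identity theorem, and roots on open sets *)

Section IdentityTheorem.
Context {K : realType}.
Local Notation C := K[i].
Implicit Types (a b : nat -> nat -> C) (f g : C * C -> C) (z : C * C) (U D : set (C * C)).

(** Each differentiation brings the next coefficient to index zero, up to a
    nonzero factor, so the coefficients are recovered from the derivatives. *)
Lemma coef_row0 j f z s a M : expand f z s a M ->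
  (forall q, iter q Dy f z = 0) -> a 0%N j = 0.
Proof.
elim: j f a s M => [|j IH] f a s M fa f0.
  by rewrite (expand_val fa); exact: (f0 0%N).
have := IH _ _ _ _ (expand_Dy fa) (fun q => _).
rewrite /weight /diff_coef => /(_ (fun q => etrans (esym (congr1 (fun h => h z) (iterSr q Dy f))) (f0 q.+1))).
move=> /eqP; have [s0 _ _] := fa; rewrite !mulf_eq0 invr_eq0 (gt_eqF s0) pnatr_eq0 /=.
by rewrite !expf_eq0 !invr_eq0 pnatr_eq0 !andbF !orbF => /eqP.
Qed.

Lemma coef_flat i j f z s a M : expand f z s a M ->
  (forall p q, iter q Dy (iter p Dx f) z = 0) -> a i j = 0.
Proof.
elim: i j f a s M => [|i IH] j f a s M fa f0.
  exact: (coef_row0 j fa (f0 0%N)).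
have f1 p q : iter q Dy (iter p Dx (Dx f)) z = 0 by rewrite -iterSr.
have := IH j _ _ _ _ (expand_Dx fa) f1; rewrite /weight /diff_coef.
move=> /eqP; have [s0 _ _] := fa; rewrite !mulf_eq0 invr_eq0 (gt_eqF s0) pnatr_eq0 /=.
by rewrite !expf_eq0 !invr_eq0 pnatr_eq0 !andbF !orbF => /eqP.
Qed.

Lemma flat_near0 f z : analytic_at f z ->
  (forall p q, iter q Dy (iter p Dx f) z = 0) -> \forall w \near z, f w = 0.
Proof.
move=> /analytic_expand[s [a [M fa]]] f0; apply: (expand_near fa) => h k h1 k1.
have [_ _ cv] := fa.
have E : psum (weight a h k) = fun=> 0.
  apply/funext => n; rewrite /psum big1 // => i _; rewrite big1 // => j _.
  by rewrite /weight (coef_flat i j fa f0) !mul0r.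
have := cv _ _ h1 k1; rewrite E => cv0.
exact: (cvg_unique (@norm_hausdorff _ _) cv0 (cvg_cst (0 : C))).
Qed.

Lemma near_Dx0 f z : (\forall w \near z, f w = 0) -> \forall w \near z, Dx f w = 0.
Proof.
move=> /nbhs_interior; apply: filterS => w fw.
by rewrite -(DxC (0 : C) w); exact: near_eq_Dx.
Qed.

Lemma near_Dy0 f z : (\forall w \near z, f w = 0) -> \forall w \near z, Dy f w = 0.
Proof.
move=> /nbhs_interior; apply: filterS => w fw.
by rewrite -(DyC (0 : C) w); exact: near_eq_Dy.
Qed.

Lemma near0_flat f z : (\forall w \near z, f w = 0) ->
  forall p q, iter q Dy (iter p Dx f) z = 0.
Proof.
move=> f0 p q; suff : \forall w \near z, iter q Dy (iter p Dx f) w = 0.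
  by move=> /nbhs_singleton.
elim: q => [|q IH] /=; last exact: near_Dy0.
by elim: p => [|p IH] /=; [exact: f0|exact: near_Dx0].
Qed.

Lemma analytic_iter f z p q :
  analytic_at f z -> analytic_at (iter q Dy (iter p Dx f)) z.
Proof.
move=> fz; elim: q => [|q IH] /=; last exact: analytic_Dy.
by elim: p => [|p IH] /=; [exact: fz|exact: analytic_Dx].
Qed.

(** Identity theorem: where all derivatives vanish the function vanishes in a
    neighbourhood, so the set of such points is open and closed in the domain. *)
Lemma identity_theorem D f z : open D -> connected D -> analytic_on D f ->
  D z -> (\forall w \near z, f w = 0) -> vanishes_on D f.
Proof.
move=> Do Dc fD Dz fz.
pose B := [set w | D w /\ \forall w' \near w, f w' = 0].
suff BD : B = D by move=> w Dw; have [_ /nbhs_singleton] : B w by rewrite BD.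
apply: Dc.
- by exists z.
- exists [set w | \forall w' \near w, f w' = 0]; last exact: erefl.
  by rewrite openE => w /= fw; exact: nbhs_interior.
- exists (closure B); first exact: closed_closure.
  apply/seteqP; split=> w [Dw Bw]; first by split; [exact: Dw|exact: (subset_closure (conj Dw Bw))].
  split; [exact: Dw|]; apply: flat_near0 (fD _ Dw) _ => p q.
  apply/eqP/negP => /negP dn0.
  have [w' [[_ /near0_flat ->]]] := Bw _ (analytic_neq0 (analytic_iter p q (fD _ Dw)) dn0).
  by rewrite eqxx.
Qed.

Lemma nonzero_dense D f : open D -> connected D -> analytic_on D f ->
  ~ vanishes_on D f -> D `<=` closure [set z | D z /\ f z != 0].
Proof.
move=> Do Dc fD f0 z Dz V Vz; apply: contrapT => noV; apply: f0.
apply: (identity_theorem Do Dc fD Dz).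
apply: filterS2 (open_near Do Dz) Vz => w Dw Vw.
by apply/eqP/negP => /negP fw; apply: noV; exists w.
Qed.

Lemma nonzero_open U f : open U -> analytic_on U f ->
  open [set z | U z /\ f z != 0].
Proof.
move=> Uo fU; rewrite openE => z [Uz fz].
exact: filterS2 (fun w => @conj _ _) (open_near Uo Uz) (analytic_neq0 (fU _ Uz) fz).
Qed.

Lemma not_vanishesM D f g : open D -> connected D -> analytic_on D f ->
  analytic_on D g -> ~ vanishes_on D f -> ~ vanishes_on D g ->
  ~ vanishes_on D (fun z => f z * g z).
Proof.
move=> Do Dc fD gD f0 g0 fg0; apply: f0 => z Dz; apply: contrapT => /eqP fz.
apply: g0; apply: (identity_theorem Do Dc gD Dz).
apply: filterS2 (open_near Do Dz) (analytic_neq0 (fD _ Dz) fz) => w Dw fw.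
by have /eqP := fg0 w Dw; rewrite mulf_eq0 (negPf fw) => /eqP.
Qed.

(** Unless x = 1, the n powers of an n-th root of unity sum to zero, although
    each of them is close to 1 when x is. *)
Lemma unity_root_near1 n (x : C) : (0 < n)%N -> x ^+ n = 1 ->
  `|x - 1| * n%:R < 1 -> x = 1.
Proof.
move=> n0 xn xn1; apply/eqP; rewrite -subr_eq0; apply/negP => /negP x1.
have nx : `|x| = 1.
  by apply/eqP; rewrite -(@pexpr_eq1 _ _ n) // -normrX xn normr1.
have : (x - 1) * \sum_(i < n) x ^+ i = 0 by rewrite -subrX1 xn subrr.
move=> /eqP; rewrite mulf_eq0 (negPf x1) /= => /eqP S0.
have : `|n%:R : C| <= n%:R * (`|x - 1| * n%:R).
  have nE (c : C) : \sum_(i < n) c = n%:R * c.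
    by rewrite sumr_const card_ord mulr_natl.
  have E : n%:R = \sum_(i < n) (1 - x ^+ i) by rewrite sumrB S0 subr0 nE mulr1.
  rewrite -[leRHS]nE [X in `|X|]E.
  apply: le_trans (ler_norm_sum _ _ _) _; apply: ler_sum => i _.
  rewrite distrC -[X in `|_ - X|](expr1n _ i).
  have n1 : `|1 : C| <= 1 by rewrite normr1.
  have x1' : `|x| <= 1 by rewrite nx.
  apply: le_trans (pow_diff_le i x1' n1) _; rewrite expr1n mulr1 mulrC.
  by rewrite ler_wpM2l // ler_nat ltnW.
rewrite normr_nat ler_pMr ?ltr0n // => /le_lt_trans /(_ xn1).
by rewrite ltxx.
Qed.

Lemma near_root_unique n (x y c d e : C) : (0 < n)%N -> c != 0 -> d != 0 ->
  0 <= e -> e * (4 * n%:R + 3) < 1 -> x ^+ n = y ^+ n ->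
  `|x / c - 1| <= e -> `|d / c - 1| <= e -> `|y / d - 1| <= e -> x = y.
Proof.
move=> n0 c0 d0 e0 en xy xc dc yd.
have n1 : 1 <= n%:R :> C by rewrite ler1n.
have e1 : e <= 1.
  apply: ltW; apply: le_lt_trans en; rewrite ler_peMr //.
  by rewrite ler_wpDl ?mulr_ge0 ?ler0n // ler1n.
have yc : `|y / c - 1| <= 3 * e.
  have -> : y / c - 1 = (y / d - 1) * (d / c - 1) + (y / d - 1) + (d / c - 1).
    by field; rewrite c0 d0.
  rewrite (_ : 3 * e = e + e + e); last by ring.
  apply: le_trans (ler_normD _ _) _; apply: (lerD _ dc).
  apply: le_trans (ler_normD _ _) _; apply: (lerD _ yd).
  rewrite normrM; apply: le_trans (ler_pM _ _ yd dc) _; rewrite ?normr_ge0 //.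
  by rewrite ler_piMr.
have yc1 : 1 - 3 * e <= `|y / c|.
  rewrite lerBlDr -[leLHS]normr1.
  rewrite -[X in `|X| <= _](subrK (y / c)) addrC.
  apply: le_trans (ler_normD _ _) _; rewrite lerD2l distrC //.
have e3 : 4 * e * n%:R < 1 - 3 * e.
  rewrite ltrBrDr; apply: le_lt_trans en; rewrite le_eqVlt; apply/orP; left.
  by apply/eqP; ring.
have yc0 : 0 < `|y / c|.
  by apply: lt_le_trans yc1; apply: le_lt_trans e3; rewrite !mulr_ge0.
have y0 : y != 0 by apply: contraTneq yc0 => ->; rewrite mul0r normr0 ltxx.
suff : x / y = 1 by move=> /(congr1 (fun t => t * y)); rewrite divfK // mul1r.
apply: (unity_root_near1 n0); first by rewrite expr_div_n xy divff // expf_neq0.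
have -> : x / y - 1 = ((x / c - 1) - (y / c - 1)) / (y / c).
  by field; rewrite c0 y0.
rewrite normrM normfV mulrAC ltr_pdivrMr // mul1r.
apply: lt_le_trans yc1; apply: le_lt_trans e3; rewrite ler_wpM2r //.
apply: le_trans (ler_normB _ _) _; rewrite (_ : 4 * e = e + 3 * e); last by ring.
exact: lerD.
Qed.

(** The branches of an n-th root at two nearby points are both close to the
    same value, so they agree; hence the branch at a point is analytic on a
    whole neighbourhood. *)
Lemma analytic_root_on n U f z : (0 < n)%N -> open U -> analytic_on U f ->
  U z -> f z != 0 -> exists V r, [/\ open V, V z, V `<=` U, analytic_on V r &
    forall w, V w -> r w ^+ n = f w /\ r w != 0].
Proof.
move=> n0 Uo fU Uz fz0.
pose e : C := (4 * n%:R + 4)^-1.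
have n40 : 0 < 4 * n%:R + 4 :> C by rewrite ltr_wpDl ?mulr_ge0.
have e0 : 0 < e by rewrite invr_gt0.
have en : e * (4 * n%:R + 3) < 1 by rewrite mulrC ltr_pdivrMr // mul1r ltrD2l ltr_nat.
pose c := n.-root (f z).
have cn : c ^+ n = f z by rewrite rootCK.
have c0 : c != 0 by apply: contra_eq_neq cn => ->; rewrite expr0n gtn_eqF // eq_sym.
have [r [rz rzc rn]] := analytic_root n0 (fU _ Uz) cn c0 e0.
pose W := [set w | (r w ^+ n = f w /\ `|r w / c - 1| <= e) /\ U w /\ f w != 0].
have Wz : nbhs z W.
  apply: filterS2 rn (open_nbhs_nbhs (conj (nonzero_open Uo fU) (conj Uz fz0))) => w H1 H2.
  exact: (conj H1 H2).
have WV w : W° w -> W w by exact: interior_subset.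
exists W°, r; split.
- exact: open_interior.
- exact: Wz.
- by move=> w /WV[_ []].
- move=> w Ww; have [[rwn rwc] [Uw fw]] := WV _ Ww.
  have rw0 : r w != 0.
    apply: contra_neq fw => rw0; rewrite -rwn rw0 expr0n gtn_eqF //.
  have [r' [r'w r'wc r'n]] := analytic_root n0 (fU _ Uw) rwn rw0 e0.
  apply: near_eq_analytic r'w.
  apply: filterS2 r'n (Ww : nbhs w W) => t [r't r'tw] [[rt rtc] _].
  apply/esym; apply: (near_root_unique n0 c0 rw0 (ltW e0) en _ rtc rwc r'tw).
  by rewrite rt r't.
- move=> w /WV[[rwn _] [_ fw]]; split; first exact: rwn.
  by apply: contra_neq fw => rw0; rewrite -rwn rw0 expr0n gtn_eqF.
Qed.

End IdentityTheorem.

(** * Functions with poles along one zero set *)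

(* From here on derivatives are used through the rules of calculus only, not
   through the limits that define them. *)
#[global] Opaque Dx Dy.

Ltac generalize_derivatives :=
  repeat match goal with
  | |- context [Dx ?f ?z] => generalize (Dx f z); intro
  | |- context [Dy ?f ?z] => generalize (Dy f z); intro
  end.

Section AnalyticOn.
Context {K : realType}.
Local Notation C := K[i].
Implicit Types (f g den : C * C -> C) (z : C * C) (U D : set (C * C)).

Lemma analytic_onD U f g : analytic_on U f -> analytic_on U g ->
  analytic_on U (fun z => f z + g z).
Proof. by move=> fU gU z Uz; exact: analyticD (fU z Uz) (gU z Uz). Qed.

Lemma analytic_onM U f g : analytic_on U f -> analytic_on U g ->
  analytic_on U (fun z => f z * g z).
Proof. by move=> fU gU z Uz; exact: analyticM (fU z Uz) (gU z Uz). Qed.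

Lemma analytic_onC U (c : C) : analytic_on U (fun=> c).
Proof. by move=> z _; exact: analyticC. Qed.

Lemma analytic_onN U f : analytic_on U f -> analytic_on U (fun z => - f z).
Proof. by move=> fU z Uz; exact: analyticN (fU z Uz). Qed.

Lemma analytic_onX U f n : analytic_on U f -> analytic_on U (fun z => f z ^+ n).
Proof. by move=> fU z Uz; exact: analyticX (fU z Uz). Qed.

Lemma analytic_onV U f : analytic_on U f -> (forall z, U z -> f z != 0) ->
  analytic_on U (fun z => (f z)^-1).
Proof. by move=> fU f0 z Uz; exact: analyticV (fU z Uz) (f0 z Uz). Qed.

Lemma analytic_on_Dx U f : analytic_on U f -> analytic_on U (Dx f).
Proof. by move=> fU z Uz; exact: analytic_Dx (fU z Uz). Qed.

Lemma analytic_on_Dy U f : analytic_on U f -> analytic_on U (Dy f).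
Proof. by move=> fU z Uz; exact: analytic_Dy (fU z Uz). Qed.

End AnalyticOn.

(** Analyticity by induction on the expression of a function; what remains is
    that the denominators have no zeros. *)
Ltac analytic_on_tac :=
  lazymatch goal with
  | |- analytic_on _ (fun _ => ?c) => exact (@analytic_onC _ _ c)
  | |- analytic_on _ (fun z => @?f z + @?g z) =>
      refine (analytic_onD (f := f) (g := g) _ _); analytic_on_tac
  | |- analytic_on _ (fun z => @?f z * @?g z) =>
      refine (analytic_onM (f := f) (g := g) _ _); analytic_on_tac
  | |- analytic_on _ (fun z => - @?f z) =>
      refine (analytic_onN (f := f) _); analytic_on_tac
  | |- analytic_on _ (fun z => @?f z ^+ ?n) =>
      refine (analytic_onX (f := f) n _); analytic_on_tac
  | |- analytic_on _ (fun z => (@?f z)^-1) =>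
      refine (analytic_onV (f := f) _ _); analytic_on_tac
  | |- analytic_on _ (Dx _) => refine (analytic_on_Dx _); analytic_on_tac
  | |- analytic_on _ (Dy _) => refine (analytic_on_Dy _); analytic_on_tac
  | |- analytic_on ?U (fun z => ?f z) =>
      change (analytic_on U f); analytic_on_tac
  | |- analytic_on _ _ =>
      match goal with
      | fU : analytic_on ?U ?f |- analytic_on ?U ?f => exact fU
      | |- _ => idtac
      end
  | |- _ => idtac
  end.

Section Meromorphic.
Context {K : realType}.
Local Notation C := K[i].
Implicit Types (f g den : C * C -> C) (z : C * C) (U D : set (C * C)).

Lemma eq_analytic_on U f g : open U -> (forall z, U z -> f z = g z) ->
  analytic_on U f -> analytic_on U g.
Proof.
move=> Uo fg fU z Uz; apply: near_eq_analytic (fU z Uz).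
by apply: filterS (open_near Uo Uz) => w Uw; exact: fg.
Qed.

Lemma eq_on_Dx U f g z : open U -> (forall w, U w -> f w = g w) -> U z ->
  Dx f z = Dx g z.
Proof.
move=> Uo fg Uz; apply: near_eq_Dx.
by apply: filterS (open_near Uo Uz) => w Uw; exact: fg.
Qed.

Lemma eq_on_Dy U f g z : open U -> (forall w, U w -> f w = g w) -> U z ->
  Dy f z = Dy g z.
Proof.
move=> Uo fg Uz; apply: near_eq_Dy.
by apply: filterS (open_near Uo Uz) => w Uw; exact: fg.
Qed.

Lemma DxX f n z : analytic_at f z ->
  Dx (fun w => f w ^+ n) z = n%:R * f z ^+ n.-1 * Dx f z.
Proof.
move=> fz; elim: n => [|n IH]; first by rewrite DxC !mul0r.
rewrite (_ : (fun w => f w ^+ n.+1) = fun w => f w * f w ^+ n); last first.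
  by apply/funext => w; rewrite exprS.
rewrite (DxM fz (analyticX n fz)) IH -natr1.
by case: n {IH} => [|n]; rewrite /= ?expr0 ?exprS; ring.
Qed.

Lemma DyX f n z : analytic_at f z ->
  Dy (fun w => f w ^+ n) z = n%:R * f z ^+ n.-1 * Dy f z.
Proof.
move=> fz; elim: n => [|n IH]; first by rewrite DyC !mul0r.
rewrite (_ : (fun w => f w ^+ n.+1) = fun w => f w * f w ^+ n); last first.
  by apply/funext => w; rewrite exprS.
rewrite (DyM fz (analyticX n fz)) IH -natr1.
by case: n {IH} => [|n]; rewrite /= ?expr0 ?exprS; ring.
Qed.

(** Functions that become analytic on all of D when multiplied by a power of
    den.  Off the zeros of den they vanish where an analytic function on D does,
    and to that function the identity theorem on D applies. *)
Definition mero_on D den f : Prop := exists n g, analytic_on D g /\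
  forall z, D z -> den z != 0 -> f z = g z / den z ^+ n.

Definition nonzero_set D den := [set z | D z /\ den z != 0].

Variables (D : set (C * C)) (den : C * C -> C).
Hypotheses (D_open : open D) (den_analytic : analytic_on D den).
Local Notation mero := (mero_on D den).

Lemma mero_analytic f : analytic_on D f -> mero f.
Proof. by move=> fD; exists 0%N, f; split=> // z _ _; rewrite expr0 divr1. Qed.

Lemma meroC (c : C) : mero (fun=> c).
Proof. by apply: mero_analytic; exact: analytic_onC. Qed.

Lemma meroD f g : mero f -> mero g -> mero (fun z => f z + g z).
Proof.
move=> [n [f' [fD fE]]] [m [g' [gD gE]]].
exists (n + m)%N, (fun z => f' z * den z ^+ m + g' z * den z ^+ n); split.
  by analytic_on_tac.
move=> z Dz dz; rewrite fE // gE // exprD; field.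
by rewrite !expf_neq0.
Qed.

Lemma meroM f g : mero f -> mero g -> mero (fun z => f z * g z).
Proof.
move=> [n [f' [fD fE]]] [m [g' [gD gE]]].
exists (n + m)%N, (fun z => f' z * g' z); split; first by analytic_on_tac.
move=> z Dz dz; rewrite fE // gE // exprD; field.
by rewrite !expf_neq0.
Qed.

Lemma meroN f : mero f -> mero (fun z => - f z).
Proof.
move=> [n [f' [fD fE]]]; exists n, (fun z => - f' z); split.
  exact: analytic_onN.
by move=> z Dz dz; rewrite fE // mulNr.
Qed.

Lemma meroX f k : mero f -> mero (fun z => f z ^+ k).
Proof.
move=> [n [f' [fD fE]]]; exists (n * k)%N, (fun z => f' z ^+ k); split.
  exact: analytic_onX.
by move=> z Dz dz; rewrite fE // expr_div_n exprM.
Qed.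

Lemma mero_Vden : mero (fun z => (den z)^-1).
Proof.
exists 1%N, (fun=> 1); split; first exact: analytic_onC.
by move=> z _ _; rewrite expr1 mul1r.
Qed.

Lemma mero_VM f g : mero (fun z => (f z)^-1) -> mero (fun z => (g z)^-1) ->
  mero (fun z => (f z * g z)^-1).
Proof.
move=> fm gm; rewrite (_ : (fun z => _) = fun z => (f z)^-1 * (g z)^-1).
  exact: meroM.
by apply/funext => z; rewrite invfM.
Qed.

Lemma mero_VX f k : mero (fun z => (f z)^-1) -> mero (fun z => (f z ^+ k)^-1).
Proof.
move=> fm; rewrite (_ : (fun z => _) = fun z => (f z)^-1 ^+ k).
  exact: meroX.
by apply/funext => z; rewrite exprVn.
Qed.

Lemma nonzero_set_open : open (nonzero_set D den).
Proof. exact: nonzero_open. Qed.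

Lemma mero_analytic_on f : mero f -> analytic_on (nonzero_set D den) f.
Proof.
move=> [n [g [gD gE]]].
apply: (eq_analytic_on (f := fun z => g z * (den z ^+ n)^-1) nonzero_set_open).
  by move=> z [Dz dz]; rewrite gE.
apply: analytic_onM; first by move=> z [Dz _]; exact: gD.
apply: analytic_onV; last by move=> z [_ dz]; rewrite expf_neq0.
by apply: analytic_onX => z [Dz _]; exact: den_analytic.
Qed.

Lemma mero_Dx f : mero f -> mero (Dx f).
Proof.
move=> [n [g [gD gE]]].
exists n.+1, (fun z => Dx g z * den z + - (n%:R * g z * Dx den z)); split.
  by analytic_on_tac.
move=> z Dz dz.
have dn : den z ^+ n != 0 by rewrite expf_neq0.
rewrite (eq_on_Dx (g := fun w => g w * (den w ^+ n)^-1) nonzero_set_open _ (conj Dz dz)); last first.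
  by move=> w [Dw dw]; exact: gE.
have dX := analyticX n (den_analytic Dz).
rewrite (DxM (gD _ Dz) (analyticV dX dn)) (DxV dX dn) (DxX n (den_analytic Dz)).
generalize_derivatives.
case: n {gE dX} dn => [|n] dn; first by rewrite /= expr0 expr1; field.
have dn' : den z ^+ n != 0 by rewrite expf_neq0.
by rewrite /= !exprS; field; rewrite dn' dz.
Qed.

Lemma mero_Dy f : mero f -> mero (Dy f).
Proof.
move=> [n [g [gD gE]]].
exists n.+1, (fun z => Dy g z * den z + - (n%:R * g z * Dy den z)); split.
  by analytic_on_tac.
move=> z Dz dz.
have dn : den z ^+ n != 0 by rewrite expf_neq0.
rewrite (eq_on_Dy (g := fun w => g w * (den w ^+ n)^-1) nonzero_set_open _ (conj Dz dz)); last first.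
  by move=> w [Dw dw]; exact: gE.
have dX := analyticX n (den_analytic Dz).
rewrite (DyM (gD _ Dz) (analyticV dX dn)) (DyV dX dn) (DyX n (den_analytic Dz)).
generalize_derivatives.
case: n {gE dX} dn => [|n] dn; first by rewrite /= expr0 expr1; field.
have dn' : den z ^+ n != 0 by rewrite expf_neq0.
by rewrite /= !exprS; field; rewrite dn' dz.
Qed.

Lemma mero_numerator f : mero f -> ~ vanishes_on (nonzero_set D den) f ->
  exists g, [/\ analytic_on D g, ~ vanishes_on D g &
    forall z, nonzero_set D den z -> g z != 0 -> f z != 0].
Proof.
move=> [n [g [gD gE]]] f0; exists g; split.
- exact: gD.
- move=> g0; apply: f0 => z [Dz dz]; by rewrite gE // g0 // mul0r.
- move=> z [Dz dz] gz; by rewrite gE // mulf_neq0 // invr_neq0 // expf_neq0.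
Qed.

End Meromorphic.

(** * Differentiating an equation *)

Section DerivativeRules.
Context {K : realType}.
Local Notation C := K[i].
Implicit Types (f g : C * C -> C) (z : C * C) (U : set (C * C)).

(** The derivatives are recorded as expressions, so that the rules below compute
    them by induction on the expression of f. *)
Definition has_derivatives U f fx fy : Prop :=
  analytic_on U f /\ forall z, U z -> Dx f z = fx z /\ Dy f z = fy z.

Lemma hd_atom U f : analytic_on U f -> has_derivatives U f (Dx f) (Dy f).
Proof. by move=> fU; split. Qed.

Lemma hdC U (c : C) : has_derivatives U (fun=> c) (fun=> 0) (fun=> 0).
Proof.
split; first exact: analytic_onC.
by move=> z _; rewrite DxC DyC.
Qed.

Lemma hdD U f g fx fy gx gy :
  has_derivatives U f fx fy -> has_derivatives U g gx gy ->
  has_derivatives U (fun z => f z + g z) (fun z => fx z + gx z)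
    (fun z => fy z + gy z).
Proof.
move=> [fU fE] [gU gE]; split; first exact: analytic_onD.
move=> z Uz; rewrite (DxD (fU z Uz) (gU z Uz)) (DyD (fU z Uz) (gU z Uz)).
by have [-> ->] := fE z Uz; have [-> ->] := gE z Uz.
Qed.

Lemma hdM U f g fx fy gx gy :
  has_derivatives U f fx fy -> has_derivatives U g gx gy ->
  has_derivatives U (fun z => f z * g z) (fun z => fx z * g z + f z * gx z)
    (fun z => fy z * g z + f z * gy z).
Proof.
move=> [fU fE] [gU gE]; split; first exact: analytic_onM.
move=> z Uz; rewrite (DxM (fU z Uz) (gU z Uz)) (DyM (fU z Uz) (gU z Uz)).
by have [-> ->] := fE z Uz; have [-> ->] := gE z Uz.
Qed.

Lemma hdN U f fx fy : has_derivatives U f fx fy ->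
  has_derivatives U (fun z => - f z) (fun z => - fx z) (fun z => - fy z).
Proof.
move=> fU; have [mU mE] := hdM (hdC U (-1)) fU.
have E : (fun z => - f z) = fun z => -1 * f z by apply/funext => z; rewrite mulN1r.
rewrite E; split; first exact: mU.
by move=> z Uz; have [-> ->] := mE z Uz; rewrite !mul0r !add0r !mulN1r.
Qed.

Lemma hdX U f fx fy n : has_derivatives U f fx fy ->
  has_derivatives U (fun z => f z ^+ n) (fun z => n%:R * f z ^+ n.-1 * fx z)
    (fun z => n%:R * f z ^+ n.-1 * fy z).
Proof.
move=> [fU fE]; split; first exact: analytic_onX.
move=> z Uz; rewrite (DxX n (fU z Uz)) (DyX n (fU z Uz)).
by have [-> ->] := fE z Uz.
Qed.

Lemma hdV U f fx fy : has_derivatives U f fx fy -> (forall z, U z -> f z != 0) ->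
  has_derivatives U (fun z => (f z)^-1) (fun z => - fx z / f z ^+ 2)
    (fun z => - fy z / f z ^+ 2).
Proof.
move=> [fU fE] f0; split; first exact: analytic_onV.
move=> z Uz; rewrite (DxV (fU z Uz) (f0 z Uz)) (DyV (fU z Uz) (f0 z Uz)).
by have [-> ->] := fE z Uz.
Qed.

Lemma hd_Dx U f fx fy : has_derivatives U f fx fy ->
  has_derivatives U (Dx f) (Dx (Dx f)) (Dy (Dx f)).
Proof. by move=> [fU _]; apply: hd_atom; exact: analytic_on_Dx. Qed.

(** Mixed derivatives are put in the order y after x; a function is thus
    differentiated to the same atoms whichever way it is done. *)
Lemma hd_Dy U f fx fy : has_derivatives U f fx fy ->
  has_derivatives U (Dy f) (Dy (Dx f)) (Dy (Dy f)).
Proof.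
move=> [fU _]; split; first exact: analytic_on_Dy.
by move=> z Uz; rewrite (Dx_Dy (fU z Uz)).
Qed.

Lemma hd_DyDy U f fx fy : open U -> has_derivatives U f fx fy ->
  has_derivatives U (Dy (Dy f)) (Dy (Dy (Dx f))) (Dy (Dy (Dy f))).
Proof.
move=> Uo [fU _]; split; first by analytic_on_tac.
move=> z Uz; split; last exact: erefl.
rewrite (Dx_Dy (analytic_Dy (fU z Uz))).
by apply: (eq_on_Dy Uo _ Uz) => w Uw; exact: (Dx_Dy (fU w Uw)).
Qed.

Lemma transfer_derivatives U f g fx fy gx gy : open U ->
  has_derivatives U f fx fy -> has_derivatives U g gx gy ->
  (forall w, U w -> f w = g w) ->
  forall z, U z -> fx z = gx z /\ fy z = gy z.
Proof.
move=> Uo [fU fE] [gU gE] fg z Uz.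
have [<- <-] := fE z Uz; have [<- <-] := gE z Uz.
by split; [exact: (eq_on_Dx Uo)|exact: (eq_on_Dy Uo)].
Qed.

End DerivativeRules.

Ltac derivatives U f :=
  lazymatch f with
  | (fun _ => ?c) => constr:(hdC U c)
  | (fun z => @?g z + @?h z) =>
      let p := derivatives U g in let q := derivatives U h in constr:(hdD p q)
  | (fun z => @?g z * @?h z) =>
      let p := derivatives U g in let q := derivatives U h in constr:(hdM p q)
  | (fun z => - @?g z) => let p := derivatives U g in constr:(hdN p)
  | (fun z => @?g z ^+ ?n) => let p := derivatives U g in constr:(hdX n p)
  | (fun z => (@?g z)^-1) =>
      let p := derivatives U g in
      lazymatch goal with
      | g0 : forall z, U z -> is_true (@?k z != 0) |- _ => constr:(hdV p g0)
      end
  | (fun z => ?g z) => derivatives U g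
  | Dy (Dy ?g) =>
      let p := derivatives U g in
      lazymatch goal with Uo : open U |- _ => constr:(hd_DyDy Uo p) end
  | Dx ?g => let p := derivatives U g in constr:(hd_Dx p)
  | Dy ?g => let p := derivatives U g in constr:(hd_Dy p)
  | _ => lazymatch goal with fU : analytic_on U f |- _ => constr:(hd_atom fU) end
  end.

(** An equation between analytic functions on an open set holds for the
    derivatives too; [Hx] and [Hy] name the two differentiated equations. *)
Ltac differentiate eqn Uz Hx Hy :=
  lazymatch type of Uz with ?U ?z0 =>
  lazymatch goal with Uo : open U |- _ =>
  lazymatch type of eqn with
  | forall w, U w -> @?l w = @?r w =>
      let p := derivatives U l in let q := derivatives U r in
      destruct (transfer_derivatives Uo p q eqn Uz) as [Hx Hy];
      cbv beta in Hx, Hy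
  end end end.

(** * A parallel covector and its differential consequences *)

(** The values at z become independent variables, between which only an algebraic
    identity remains. *)
Ltac abstract_values z :=
  repeat match goal with |- context [?f z] => generalize (f z); intro end.

Section LinearCombinations.
Context {F : fieldType}.
Implicit Types (x y l r k : F).

(** An equation follows from others as soon as the difference of its sides is a
    combination of theirs; checking the combination is an identity of fractions. *)
Lemma by_combination1 x y l r k : l = r -> x - y = k * (l - r) -> x = y.
Proof. by move=> ->; rewrite subrr mulr0 => /subr0_eq. Qed.

Lemma by_combination2 x y l r k l' r' k' : l = r -> l' = r' ->
  x - y = k * (l - r) + k' * (l' - r') -> x = y.
Proof. by move=> -> ->; rewrite !subrr !mulr0 addr0 => /subr0_eq. Qed.

(** A traceless pair of vectors annihilated by the covector (a, b) is a multiple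
    of one tensor, and the cubic form in (t1, t2) detects that multiple. *)
Lemma traceless_annihilated (a b t1 t2 d1x d1y d2x d2y : F) :
  (a * t1 + b * t2) ^+ 2 = 1 -> a * d1x + b * d2x = 0 ->
  a * d1y + b * d2y = 0 -> d1x + d2y = 0 ->
  - t1 * t2 * (d1x - d2y) - t2 ^+ 2 * d1y + t1 ^+ 2 * d2x = 0 ->
  [/\ d1x = 0, d1y = 0, d2x = 0 & d2y = 0].
Proof.
move=> n e1 e2 /eqP; rewrite addrC addr_eq0 => /eqP d2yE; rewrite {}d2yE in e2 *.
move=> e4.
have x1 : d1x * (a * t1 + b * t2) ^+ 2 = - (a * b) * (- t1 * t2 * (d1x - - d1x) - t2 ^+ 2 * d1y + t1 ^+ 2 * d2x)
  + t1 ^+ 2 * a * (a * d1x + b * d2x) - b * t2 ^+ 2 * (a * d1y + b * - d1x) by ring.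
have x2 : d2x * (a * t1 + b * t2) ^+ 2 = a ^+ 2 * (- t1 * t2 * (d1x - - d1x) - t2 ^+ 2 * d1y + t1 ^+ 2 * d2x)
  + (2 * a * t1 * t2 + b * t2 ^+ 2) * (a * d1x + b * d2x) + a * t2 ^+ 2 * (a * d1y + b * - d1x) by ring.
have y1 : d1y * (a * t1 + b * t2) ^+ 2 = - b ^+ 2 * (- t1 * t2 * (d1x - - d1x) - t2 ^+ 2 * d1y + t1 ^+ 2 * d2x)
  + b * t1 ^+ 2 * (a * d1x + b * d2x) + (2 * b * t1 * t2 + a * t1 ^+ 2) * (a * d1y + b * - d1x) by ring.
move: x1 x2 y1; rewrite n e1 e2 e4 !mulr1 !mulr0 !addr0 ?oppr0 ?addr0 => -> -> ->.
by rewrite oppr0.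
Qed.

End LinearCombinations.

Section CartanStructure.
Context {K : realType}.
Local Notation C := K[i].
Variables (E : cubic_ode K) (U : set (C * C)) (U_open : open U).
Local Notation P := (coefP E).
Local Notation Q := (coefQ E).
Local Notation R := (coefR E).
Local Notation S := (coefS E).
Hypotheses (P_analytic : analytic_on U P) (Q_analytic : analytic_on U Q)
  (R_analytic : analytic_on U R) (S_analytic : analytic_on U S).
Variables (a b p q T : C * C -> C).
Hypotheses (a_analytic : analytic_on U a) (b_analytic : analytic_on U b)
  (p_analytic : analytic_on U p) (q_analytic : analytic_on U q)
  (T_analytic : analytic_on U T).

(** The covector (a, b), of weight 1, is parallel for the projective connection
    (P, Q, R, S) coupled to the connection (p, q) on densities. *)
Definition parallel_covector : Prop := forall z, U z ->
  [/\ Dx a z = - (5 / 3) * a z * p z + a z * Q z - b z * P z,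
      Dy a z = - (4 / 3) * a z * q z - 1 / 3 * b z * p z + a z * R z - b z * Q z,
      Dx b z = - (1 / 3) * a z * q z - 4 / 3 * b z * p z + a z * R z - b z * Q z &
      Dy b z = - (5 / 3) * b z * q z + a z * S z - b z * R z].

(** The Schouten tensor of the connection that (p, q) selects in the projective
    class is symmetric and is, up to a constant factor, T times the square of the
    covector (a, b). *)
Definition schouten_equations : Prop := forall z, U z ->
  [/\ Dx p z = 3 * a z ^+ 2 * T z + 3 * (Dy P z - Dx Q z)
        - P z * (6 * R z + q z) + (Q z + p z / 3) * (6 * Q z - p z),
      Dy p z = 3 * a z * b z * T z + 3 * (Dy Q z - Dx R z) - 3 * P z * S z
        + 3 * (Q z + p z / 3) * (R z - q z / 3),
      Dx q z = 3 * a z * b z * T z + 3 * (Dy Q z - Dx R z) - 3 * P z * S z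
        + 3 * (Q z + p z / 3) * (R z - q z / 3) &
      Dy q z = 3 * b z ^+ 2 * T z + 3 * (Dy R z - Dx S z)
        - S z * (6 * Q z - p z) + (R z - q z / 3) * (6 * R z + q z)].

Hypotheses (cov : parallel_covector) (schouten : schouten_equations).

Let cov_ax z (Uz : U z) := let: And4 h _ _ _ := cov Uz in h.
Let cov_ay z (Uz : U z) := let: And4 _ h _ _ := cov Uz in h.
Let cov_bx z (Uz : U z) := let: And4 _ _ h _ := cov Uz in h.
Let cov_by z (Uz : U z) := let: And4 _ _ _ h := cov Uz in h.
Let sch_px z (Uz : U z) := let: And4 h _ _ _ := schouten Uz in h.
Let sch_py z (Uz : U z) := let: And4 _ h _ _ := schouten Uz in h.
Let sch_qx z (Uz : U z) := let: And4 _ _ h _ := schouten Uz in h.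
Let sch_qy z (Uz : U z) := let: And4 _ _ _ h := schouten Uz in h.

(** (A, B) is the curvature of the projective connection, the antisymmetrised
    derivative of its Schouten tensor; as (a, b) is parallel, only derivatives of
    T appear.  The equations are the equality of the mixed derivatives of p and
    of q. *)
Lemma curvature z : U z ->
  let t1 := Dy T z - 2 * q z * T z in let t2 := - Dx T z + 2 * p z * T z in
  invA E z = - a z * (a z * t1 + b z * t2) /\
  invB E z = - b z * (a z * t1 + b z * t2).
Proof.
move=> Uz t1 t2.
differentiate sch_px Uz pxx pxy.
differentiate sch_py Uz pyx pyy.
differentiate sch_qx Uz qxx qxy.
differentiate sch_qy Uz qyx qyy.
have eA := etrans (esym pxy) pyx; have eB := etrans (esym qxy) qyx.
move: eA eB; rewrite {pxx pxy pyx pyy qxx qxy qyx qyy}.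
rewrite (cov_ax Uz) (cov_ay Uz) (cov_bx Uz) (cov_by Uz).
rewrite (sch_px Uz) (sch_py Uz) (sch_qx Uz) (sch_qy Uz) /t1 /t2 => eA eB.
split.
  apply: (by_combination1 (k := 1 / 3) eA).
  rewrite /invA; abstract_values z; by field.
apply: (by_combination1 (k := 1 / 3) eB).
rewrite /invB; abstract_values z; by field.
Qed.

Variables (t1 t2 L : C * C -> C).
Hypotheses (t1_analytic : analytic_on U t1) (t2_analytic : analytic_on U t2)
  (L_analytic : analytic_on U L).
Hypotheses (t1E : forall z, U z -> t1 z = Dy T z - 2 * q z * T z)
  (t2E : forall z, U z -> t2 z = - Dx T z + 2 * p z * T z)
  (at_normal : forall z, U z -> a z * t1 z + b z * t2 z = -1)
  (LE : forall z, U z -> L z = - t1 z * t2 z * (Dx t1 z - Dy t2 z)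
    - t2 z ^+ 2 * Dy t1 z + t1 z ^+ 2 * Dx t2 z - P z * t1 z ^+ 3
    - 3 * Q z * t1 z ^+ 2 * t2 z - 3 * R z * t1 z * t2 z ^+ 2
    - S z * t2 z ^+ 3 - 1 / 2 * T z ^+ 2).

(** The covariant derivative of (t1, t2) is the trace-free tensor made of the
    square of (a, b), with the coefficient L + T^2 / 2. *)
Definition theta_equations : Prop := forall z, U z ->
  [/\ Dx t1 z = (5 / 3 * p z - Q z) * t1 z - (R z - q z / 3) * t2 z
        - a z * b z * (L z + T z ^+ 2 / 2),
      Dy t1 z = (4 / 3 * q z - R z) * t1 z - S z * t2 z
        - b z ^+ 2 * (L z + T z ^+ 2 / 2),
      Dx t2 z = (Q z + 4 / 3 * p z) * t2 z + P z * t1 z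
        + a z ^+ 2 * (L z + T z ^+ 2 / 2) &
      Dy t2 z = (R z + 5 / 3 * q z) * t2 z + (Q z + p z / 3) * t1 z
        + a z * b z * (L z + T z ^+ 2 / 2)].

(** Differentiating a t1 + b t2 = -1 with (a, b) parallel shows that the
    covariant derivative of (t1, t2) is annihilated by (a, b); its trace vanishes
    because the mixed derivatives of T agree and (p, q) is closed.  One degree of
    freedom is left, and the definition of L measures it. *)
Lemma theta_derivatives : theta_equations.
Proof.
move=> z Uz.
differentiate at_normal Uz nx ny.
differentiate t1E Uz t1x t1y.
differentiate t2E Uz t2x t2y.
have n2 : (a z * t1 z + b z * t2 z) ^+ 2 = 1 by rewrite at_normal // sqrrN expr1n.
have trace : Dx t1 z + Dy t2 z = 2 * (p z * t1 z + q z * t2 z).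
  rewrite t1x t2y t1E // t2E // (sch_py Uz) (sch_qx Uz).
  by abstract_values z; field.
have L0 := LE Uz.
move: nx ny trace L0; rewrite (cov_ax Uz) (cov_ay Uz) (cov_bx Uz) (cov_by Uz).
move=> nx ny trace L0 {t1x t1y t2x t2y}.
lazymatch goal with |- [/\ _ = ?x1, _ = ?y1, _ = ?x2 & _ = ?y2] =>
  pose F1x := x1; pose F1y := y1; pose F2x := x2; pose F2y := y2 end.
have [|||||h1 h2 h3 h4] := @traceless_annihilated _ (a z) (b z) (t1 z) (t2 z)
   (Dx t1 z - F1x) (Dy t1 z - F1y) (Dx t2 z - F2x) (Dy t2 z - F2y).
- exact: n2.
- apply: (by_combination1 (k := 1) nx); rewrite /F1x /F2x.
  by abstract_values z; field.
- apply: (by_combination1 (k := 1) ny); rewrite /F1y /F2y.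
  by abstract_values z; field.
- apply: (by_combination1 (k := 1) trace); rewrite /F1x /F2y.
  by abstract_values z; field.
- apply: (by_combination2 (k := -1) (k' := - (L z + T z ^+ 2 / 2)) L0 n2).
  rewrite /F1x /F1y /F2x /F2y.
  by abstract_values z; field.
by split; exact: subr0_eq.
Qed.

(** Equality of the mixed derivatives of t1 and of t2: the two equations are a
    and b times the same one, and a and b have no common zero. *)
Lemma L_transversal z : U z ->
  b z * (Dx L z - 4 * p z * L z) = a z * (Dy L z - 4 * q z * L z).
Proof.
move=> Uz.
have th_1x w (Uw : U w) := let: And4 h _ _ _ := theta_derivatives Uw in h.
have th_1y w (Uw : U w) := let: And4 _ h _ _ := theta_derivatives Uw in h.
have th_2x w (Uw : U w) := let: And4 _ _ h _ := theta_derivatives Uw in h.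
have th_2y w (Uw : U w) := let: And4 _ _ _ h := theta_derivatives Uw in h.
differentiate th_1x Uz x1 x2.
differentiate th_1y Uz x3 x4.
differentiate th_2x Uz x5 x6.
differentiate th_2y Uz x7 x8.
have e1 := etrans (esym x2) x3; have e2 := etrans (esym x6) x7.
have Tx : Dx T z = 2 * p z * T z - t2 z by rewrite (t2E Uz); abstract_values z; ring.
have Ty : Dy T z = 2 * q z * T z + t1 z by rewrite (t1E Uz); abstract_values z; ring.
move: e1 e2; rewrite {x1 x2 x3 x4 x5 x6 x7 x8}.
rewrite (th_1x z Uz) (th_1y z Uz) (th_2x z Uz) (th_2y z Uz) Tx Ty.
rewrite (cov_ax Uz) (cov_ay Uz) (cov_bx Uz) (cov_by Uz).
rewrite (sch_px Uz) (sch_py Uz) (sch_qx Uz) (sch_qy Uz) => e1 e2.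
have n := at_normal Uz.
pose X := b z * (Dx L z - 4 * p z * L z).
pose Y := a z * (Dy L z - 4 * q z * L z).
have eb : b z * (X - Y) = 0.
  apply: (by_combination1 (k := 1) e1); rewrite /X /Y.
  by abstract_values z; field.
have ea : a z * (X - Y) = 0.
  apply: (by_combination1 (k := -1) e2); rewrite /X /Y.
  by abstract_values z; field.
have : (a z * t1 z + b z * t2 z) * (X - Y) = 0.
  by rewrite mulrDl mulrAC ea mul0r mulrAC eb mul0r addr0.
by rewrite n mulN1r => /eqP; rewrite oppr_eq0 => /eqP/subr0_eq.
Qed.

End CartanStructure.

(** * The invariants have poles only where the denominator vanishes *)

(** As for analyticity; a denominator is a product of constants and powers of
    [den], and is treated factor by factor. *)
Ltac mero_tac :=
  lazymatch goal with
  | |- mero_on _ _ (fun _ => ?c) => exact (@meroC _ _ _ c)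
  | |- mero_on _ _ (fun z => @?f z + @?g z) =>
      unshelve eapply (@meroD _ _ _ _ f g); mero_tac
  | |- mero_on _ _ (fun z => @?f z * @?g z) =>
      eapply (@meroM _ _ _ f g); mero_tac
  | |- mero_on _ _ (fun z => - @?f z) =>
      eapply (@meroN _ _ _ f); mero_tac
  | |- mero_on _ _ (fun z => @?f z ^+ ?n) =>
      eapply (@meroX _ _ _ f n); mero_tac
  | |- mero_on _ _ (fun z => (@?f z * @?g z)^-1) =>
      eapply (@mero_VM _ _ _ f g); mero_tac
  | |- mero_on _ _ (fun z => (@?f z ^+ ?n)^-1) =>
      eapply (@mero_VX _ _ _ f n); mero_tac
  | |- mero_on ?D ?den (fun z => (?f z)^-1) => exact (mero_Vden D den)
  | |- mero_on _ _ (Dx _) => apply: mero_Dx; mero_tac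
  | |- mero_on _ _ (Dy _) => apply: mero_Dy; mero_tac
  | |- mero_on ?D ?den (fun z => ?f z) => change (mero_on D den f); mero_tac
  | |- mero_on _ _ _ =>
      match goal with
      | fm : mero_on ?D ?den ?f |- mero_on ?D ?den ?f => exact fm
      | |- _ => idtac
      end
  | |- open _ => assumption
  | |- analytic_on _ _ => assumption
  | |- _ => idtac
  end.

Section InvariantsMeromorphic.
Context {K : realType}.
Local Notation C := K[i].
Variables (E : cubic_ode K) (c : chart) (D : set (C * C)) (D_open : open D).
Hypotheses (P_analytic : analytic_on D (coefP E))
  (Q_analytic : analytic_on D (coefQ E)) (R_analytic : analytic_on D (coefR E))
  (S_analytic : analytic_on D (coefS E)).

Lemma invA_analytic : analytic_on D (invA E).
Proof. by rewrite /invA; analytic_on_tac. Qed.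

Lemma invB_analytic : analytic_on D (invB E).
Proof. by rewrite /invB; analytic_on_tac. Qed.

Lemma chart_den_analytic : analytic_on D (chart_den E c).
Proof. by rewrite /chart_den; case: c; [exact: invA_analytic|exact: invB_analytic]. Qed.

Local Notation mero := (mero_on D (chart_den E c)).

Let P_mero : mero (coefP E) := mero_analytic _ P_analytic.
Let Q_mero : mero (coefQ E) := mero_analytic _ Q_analytic.
Let R_mero : mero (coefR E) := mero_analytic _ R_analytic.
Let S_mero : mero (coefS E) := mero_analytic _ S_analytic.
Let A_mero : mero (invA E) := mero_analytic _ invA_analytic.
Let B_mero : mero (invB E) := mero_analytic _ invB_analytic.
Let den_an := chart_den_analytic.

Lemma phi1_mero : mero (phi1 E c).
Proof.
move: den_an P_mero Q_mero R_mero S_mero A_mero B_mero.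
by rewrite /phi1 /chart_den; case: c => *; mero_tac.
Qed.

Lemma phi2_mero : mero (phi2 E c).
Proof.
move: den_an P_mero Q_mero R_mero S_mero A_mero B_mero.
by rewrite /phi2 /chart_den; case: c => *; mero_tac.
Qed.

Lemma invTheta_mero : mero (invTheta E c).
Proof.
move: den_an P_mero Q_mero R_mero S_mero A_mero B_mero.
by rewrite /invTheta /omega1 /omega2 /chart_den; case: c => *; mero_tac.
Qed.

Lemma invN_mero : mero (invN E c).
Proof.
move: den_an P_mero Q_mero R_mero S_mero A_mero B_mero.
by rewrite /invN /invG /invH /chart_den; case: c => *; mero_tac.
Qed.

Lemma invOmega_mero : mero (invOmega E c).
Proof. have := phi1_mero; have := phi2_mero => h1 h2; rewrite /invOmega; by mero_tac. Qed.

Lemma theta1_mero : mero (theta1 E c).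
Proof.
have := phi2_mero; have := invTheta_mero => h1 h2; rewrite /theta1; by mero_tac.
Qed.

Lemma theta2_mero : mero (theta2 E c).
Proof.
have := phi1_mero; have := invTheta_mero => h1 h2; rewrite /theta2; by mero_tac.
Qed.

Lemma invL_mero : mero (invL E c).
Proof.
have := theta1_mero; have := theta2_mero; have := invTheta_mero => h1 h2 h3.
by rewrite /invL; mero_tac.
Qed.

Lemma invL1_mero : mero (invL1 E c).
Proof.
have := theta1_mero; have := theta2_mero; have := invL_mero => h1 h2 h3.
have := phi1_mero; have := phi2_mero => h4 h5.
by rewrite /invL1; mero_tac.
Qed.

Lemma invW_mero : mero (invW E c).
Proof.
have := theta1_mero; have := theta2_mero; have := invL1_mero => h1 h2 h3.
have := phi1_mero; have := phi2_mero => h4 h5.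
by rewrite /invW; mero_tac.
Qed.

Lemma invV_mero : mero (Defs.invV E c).
Proof.
have := invL1_mero; have := phi1_mero; have := phi2_mero => h4 h5 h6.
by rewrite /Defs.invV; mero_tac.
Qed.

End InvariantsMeromorphic.

(** * The conditions make (A, B) parallel *)

Section CovectorAlgebra.
Context {F : numFieldType}.
Variables (A B P Q R S Ax Ay Bx By p q : F).
Let G := - B * Bx - 3 * A * By + 4 * B * Ay + 3 * S * A ^+ 2
  - 6 * R * A * B + 3 * Q * B ^+ 2.
Let H := - A * Ay - 3 * B * Ax + 4 * A * Bx - 3 * P * B ^+ 2
  + 6 * Q * A * B - 3 * R * A ^+ 2.
Hypotheses (G0 : G = 0) (H0 : H = 0).

(** The definitions of phi1 and phi2 are the first equation and the sum of the two
    middle ones, solved for the connection; the rest is G = H = 0.  In the other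
    chart the last equation takes the place of the first. *)
Lemma covector_of_chartA : A != 0 ->
  p = - (3 * (B * P + Ax)) / (5 * A) + 3 / 5 * Q ->
  q = (3 * B * (B * P + Ax)) / (5 * A ^+ 2)
      - (3 * (Bx + Ay + 3 * B * Q)) / (5 * A) + 6 / 5 * R ->
  [/\ Ax = - (5 / 3) * A * p + A * Q - B * P,
      Ay = - (4 / 3) * A * q - 1 / 3 * B * p + A * R - B * Q,
      Bx = - (1 / 3) * A * q - 4 / 3 * B * p + A * R - B * Q &
      By = - (5 / 3) * B * q + A * S - B * R].
Proof.
move=> A0 -> ->; split.
- by field.
- by apply: (by_combination1 (k := - (5 * A)^-1) H0); rewrite /H; field.
- by apply: (by_combination1 (k := (5 * A)^-1) H0); rewrite /H; field.
- apply: (by_combination2 (k := - (3 * A)^-1) (k' := - B / (3 * A ^+ 2)) G0 H0).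
  by rewrite /G /H; field.
Qed.

Lemma covector_of_chartB : B != 0 ->
  p = - (3 * A * (A * S - By)) / (5 * B ^+ 2)
      - (3 * (Ay + Bx - 3 * A * R)) / (5 * B) - 6 / 5 * Q ->
  q = (3 * (A * S - By)) / (5 * B) - 3 / 5 * R ->
  [/\ Ax = - (5 / 3) * A * p + A * Q - B * P,
      Ay = - (4 / 3) * A * q - 1 / 3 * B * p + A * R - B * Q,
      Bx = - (1 / 3) * A * q - 4 / 3 * B * p + A * R - B * Q &
      By = - (5 / 3) * B * q + A * S - B * R].
Proof.
move=> B0 -> ->; split.
- apply: (by_combination2 (k := - (3 * B)^-1) (k' := - A / (3 * B ^+ 2)) H0 G0).
  by rewrite /G /H; field.
- by apply: (by_combination1 (k := (5 * B)^-1) G0); rewrite /G; field.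
- by apply: (by_combination1 (k := - (5 * B)^-1) G0); rewrite /G; field.
- by field.
Qed.

Lemma five_thirds_cancel (x y : F) : 5 / 3 * (x - y) = 0 -> x = y.
Proof.
move=> /eqP; rewrite mulf_eq0 subr_eq0 => /orP[|/eqP //].
by rewrite mulf_eq0 invr_eq0 !pnatr_eq0.
Qed.

End CovectorAlgebra.

Section StructureFromConditions.
Context {K : realType}.
Local Notation C := K[i].
Variables (E : cubic_ode K) (c : chart) (U : set (C * C)) (U_open : open U).
Local Notation P := (coefP E).
Local Notation Q := (coefQ E).
Local Notation R := (coefR E).
Local Notation S := (coefS E).
Local Notation A := (invA E).
Local Notation B := (invB E).
Hypotheses (P_analytic : analytic_on U P) (Q_analytic : analytic_on U Q)
  (R_analytic : analytic_on U R) (S_analytic : analytic_on U S).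
Hypotheses (phi1_analytic : analytic_on U (phi1 E c))
  (phi2_analytic : analytic_on U (phi2 E c))
  (Theta_analytic : analytic_on U (invTheta E c)).
Hypotheses (den0 : forall z, U z -> chart_den E c z != 0)
  (F0 : forall z, U z -> A z * invG E z + B z * invH E z = 0)
  (N0 : vanishes_on U (invN E c)) (Omega0 : vanishes_on U (invOmega E c)).

Lemma GH_vanish z : U z -> invG E z = 0 /\ invH E z = 0.
Proof.
move=> Uz; have := den0 Uz; have := N0 Uz; have := F0 Uz.
rewrite /invN /chart_den; case: c => F0z /eqP N0z dz.
  have H0 : invH E z = 0.
    move: N0z; rewrite mulf_eq0 oppr_eq0 invr_eq0 mulf_eq0 pnatr_eq0 (negPf dz).
    by rewrite /= orbF => /eqP.
  split=> //; move/eqP: F0z; rewrite H0 mulr0 addr0 mulf_eq0 (negPf dz).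
  by move/eqP.
have G0 : invG E z = 0.
  move: N0z; rewrite mulf_eq0 invr_eq0 mulf_eq0 pnatr_eq0 (negPf dz).
  by rewrite /= orbF => /eqP.
split=> //; move/eqP: F0z; rewrite G0 mulr0 add0r mulf_eq0 (negPf dz).
by move/eqP.
Qed.

Lemma covector_parallel : parallel_covector E U A B (phi1 E c) (phi2 E c).
Proof.
move=> z Uz; have [G0 H0] := GH_vanish Uz; move: (den0 Uz) G0 H0.
rewrite /chart_den /invG /invH; case: c => dz G0 H0.
  exact: (covector_of_chartA G0 H0 dz (erefl _) (erefl _)).
exact: (covector_of_chartB G0 H0 dz (erefl _) (erefl _)).
Qed.

Lemma phi_closed z : U z -> Dy (phi1 E c) z = Dx (phi2 E c) z.
Proof.
by move=> Uz; exact: five_thirds_cancel (Omega0 Uz).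
Qed.

Let cov_ax z (Uz : U z) := let: And4 h _ _ _ := covector_parallel Uz in h.
Let cov_ay z (Uz : U z) := let: And4 _ h _ _ := covector_parallel Uz in h.
Let cov_bx z (Uz : U z) := let: And4 _ _ h _ := covector_parallel Uz in h.
Let cov_by z (Uz : U z) := let: And4 _ _ _ h := covector_parallel Uz in h.

(** The integrability conditions of the parallel covector.  One equation is the
    definition of Theta, two are the equality of the mixed derivatives of A and
    of B, and Omega = 0 gives the last. *)
Lemma schouten_hold :
  schouten_equations E U A B (phi1 E c) (phi2 E c) (invTheta E c).
Proof.
have A_analytic : analytic_on U A by exact: invA_analytic.
have B_analytic : analytic_on U B by exact: invB_analytic.
move=> z Uz.
differentiate cov_ax Uz axx axy.
differentiate cov_ay Uz ayx ayy.
differentiate cov_bx Uz bxx bxy.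
differentiate cov_by Uz byx byy.
have eA := etrans (esym axy) ayx; have eB := etrans (esym bxy) byx.
have closed := phi_closed Uz.
have charts : (A z != 0 /\ invTheta E c z = omega1 E z / A z) \/
    (B z != 0 /\ invTheta E c z = omega2 E z / B z).
  by move: (den0 Uz); rewrite /chart_den /invTheta; case: c => dz; [left|right].
move: eA eB axx byy; rewrite {axy ayx ayy bxx bxy byx}.
rewrite (cov_ax Uz) (cov_ay Uz) (cov_bx Uz) (cov_by Uz) closed => eA eB axx byy.
case: charts => -[d0 TE].
- have px : Dx (phi1 E c) z = 3 * A z ^+ 2 * invTheta E c z + 3 * (Dy P z - Dx Q z)
      - P z * (6 * R z + phi2 E c z)
      + (Q z + phi1 E c z / 3) * (6 * Q z - phi1 E c z).
    apply: (by_combination1 (k := 3 / (5 * A z)) axx); rewrite TE /omega1.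
    rewrite (cov_ax Uz) (cov_ay Uz) (cov_bx Uz); move: d0.
    by abstract_values z => d0; field.
  have qx : Dx (phi2 E c) z = 3 * A z * B z * invTheta E c z
      + 3 * (Dy Q z - Dx R z) - 3 * P z * S z
      + 3 * (Q z + phi1 E c z / 3) * (R z - phi2 E c z / 3).
    apply: (by_combination1 (k := - 3 / A z) eA); rewrite px; move: d0.
    by abstract_values z => d0; field.
  have qy : Dy (phi2 E c) z = 3 * B z ^+ 2 * invTheta E c z
      + 3 * (Dy R z - Dx S z) - S z * (6 * Q z - phi1 E c z)
      + (R z - phi2 E c z / 3) * (6 * R z + phi2 E c z).
    apply: (by_combination1 (k := - 3 / A z) eB); rewrite qx; move: d0.
    by abstract_values z => d0; field.
  by split; rewrite ?closed.
- have qy : Dy (phi2 E c) z = 3 * B z ^+ 2 * invTheta E c z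
      + 3 * (Dy R z - Dx S z) - S z * (6 * Q z - phi1 E c z)
      + (R z - phi2 E c z / 3) * (6 * R z + phi2 E c z).
    apply: (by_combination1 (k := 3 / (5 * B z)) byy); rewrite TE /omega2.
    rewrite (cov_ay Uz) (cov_bx Uz) (cov_by Uz); move: d0.
    by abstract_values z => d0; field.
  have qx : Dx (phi2 E c) z = 3 * A z * B z * invTheta E c z
      + 3 * (Dy Q z - Dx R z) - 3 * P z * S z
      + 3 * (Q z + phi1 E c z / 3) * (R z - phi2 E c z / 3).
    apply: (by_combination1 (k := 3 / B z) eB); rewrite qy; move: d0.
    by abstract_values z => d0; field.
  have px : Dx (phi1 E c) z = 3 * A z ^+ 2 * invTheta E c z + 3 * (Dy P z - Dx Q z)
      - P z * (6 * R z + phi2 E c z)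
      + (Q z + phi1 E c z / 3) * (6 * Q z - phi1 E c z).
    apply: (by_combination1 (k := 3 / B z) eA); rewrite qx; move: d0.
    by abstract_values z => d0; field.
  by split; rewrite ?closed.
Qed.

(** The curvature formula applied to (a, b) = (A, B) itself. *)
Lemma theta_normal z : U z ->
  A z * theta1 E c z + B z * theta2 E c z = -1.
Proof.
have A_analytic : analytic_on U A by exact: invA_analytic.
have B_analytic : analytic_on U B by exact: invB_analytic.
move=> Uz; have [eA eB] := curvature U_open P_analytic Q_analytic R_analytic
  S_analytic A_analytic B_analytic phi1_analytic phi2_analytic Theta_analytic
  covector_parallel schouten_hold Uz.
have cancel (d n : C) : d != 0 -> d = - d * n -> n = -1.
  by move=> d0; rewrite mulNr -mulrN -{1}[d]mulr1 => /(mulfI d0) ->; rewrite opprK.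
move: (den0 Uz) eA eB; rewrite /chart_den; case: c => d0 eA eB.
  exact: cancel d0 eA.
exact: cancel d0 eB.
Qed.

End StructureFromConditions.

(** * The equations for a map to Painleve I *)

Section CubicIdentities.
Context {F : numFieldType}.

Lemma poly_zero_everywhere (r : {poly F}) : (forall x, r.[x] = 0) -> r = 0.
Proof.
move=> r0; apply/eqP/negP => /negP rn0.
have := max_poly_roots rn0 (rs := [seq i%:R | i <- iota 0 (size r)]).
rewrite size_map size_iota ltnn => H; suff : false by []; apply: H.
  by apply/allP => x _; rewrite rootE r0.
rewrite map_inj_in_uniq ?iota_uniq // => i j _ _ /eqP.
by rewrite eqr_nat => /eqP.
Qed.

(** The value of p where ux + uy p = 0 has to be left out, since u is no local
    parameter there; multiplying by this factor makes the cubic vanish at all p. *)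
Lemma cubic_zero_off_root (h0 h1 h2 h3 ux uy : F) : (ux != 0) || (uy != 0) ->
  (forall p, ux + uy * p != 0 -> h0 + h1 * p + h2 * p ^+ 2 + h3 * p ^+ 3 = 0) ->
  [/\ h0 = 0, h1 = 0, h2 = 0 & h3 = 0].
Proof.
move=> u0 H.
pose r : {poly F} := h0%:P + h1 *: 'X + h2 *: 'X^2 + h3 *: 'X^3.
pose l : {poly F} := ux%:P + uy *: 'X.
have rE x : r.[x] = h0 + h1 * x + h2 * x ^+ 2 + h3 * x ^+ 3.
  by rewrite /r !hornerE.
have lE x : l.[x] = ux + uy * x by rewrite /l !hornerE.
have : r * l = 0.
  apply: poly_zero_everywhere => x; rewrite hornerM rE lE.
  by have [->|/H ->] := eqVneq (ux + uy * x) 0; rewrite ?mulr0 ?mul0r.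
move=> /eqP; rewrite mulf_eq0 => /orP[/eqP r0|/eqP l0].
  have c i : r`_i = 0 by rewrite r0 coef0.
  have := c 0%N; have := c 1%N; have := c 2%N; have := c 3%N.
  by rewrite /r !coefE /= !mulr0 !mulr1 !addr0 !add0r => -> -> -> ->.
have c i : l`_i = 0 by rewrite l0 coef0.
have := c 0%N; have := c 1%N; rewrite /l !coefE /= !mulr0 !mulr1 !addr0 !add0r.
by move=> uy0 ux0; move: u0; rewrite ux0 uy0 eqxx.
Qed.

Section SecondDerivative.
Variables (P Q R S ux uy vx vy uxx uxy uyy vxx vxy vyy f : F).
Let J := ux * vy - uy * vx.
Let h0 := vxx * ux - vx * uxx + J * P - f * ux ^+ 3.
Let h1 := 2 * vxy * ux + vxx * uy - vy * uxx - 2 * vx * uxy + 3 * J * Q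
  - 3 * f * ux ^+ 2 * uy.
Let h2 := vyy * ux + 2 * vxy * uy - 2 * vy * uxy - vx * uyy + 3 * J * R
  - 3 * f * ux * uy ^+ 2.
Let h3 := vyy * uy - vy * uyy + J * S - f * uy ^+ 3.
Let d p := ux + uy * p.
Let rhs p := P + 3 * Q * p + 3 * R * p ^+ 2 + S * p ^+ 3.
Let num p q := (vxx + 2 * vxy * p + vyy * p ^+ 2 + vy * q) * d p
  - (vx + vy * p) * (uxx + 2 * uxy * p + uyy * p ^+ 2 + uy * q).

(** Substituting the equation y'' = q in the derivatives of v with respect to u
    gives a cubic in y' = p, and q enters through the Jacobian only. *)
Lemma second_derivative_defect p q : num p q - f * d p ^+ 3 =
  h0 + h1 * p + h2 * p ^+ 2 + h3 * p ^+ 3 + J * (q - rhs p).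
Proof. by rewrite /num /d /h0 /h1 /h2 /h3 /rhs /J; ring. Qed.

Lemma second_derivative_eq p q : d p != 0 -> J != 0 ->
  h0 = 0 -> h1 = 0 -> h2 = 0 -> h3 = 0 ->
  q = rhs p <-> num p q / d p ^+ 3 = f.
Proof.
move=> d0 J0 e0 e1 e2 e3; have := second_derivative_defect p q.
rewrite e0 e1 e2 e3 !mul0r !add0r => defect.
have d3 : d p ^+ 3 != 0 by rewrite expf_neq0.
split=> [qE|/(canRL (divfK d3)) nE].
  move: defect; rewrite qE subrr mulr0 => /subr0_eq ->.
  by rewrite mulfK.
move: defect; rewrite nE subrr => /esym/eqP; rewrite mulf_eq0 (negPf J0) /=.
by move=> /eqP/subr0_eq.
Qed.

Lemma second_derivative_coefs : J != 0 ->
  (forall p, d p != 0 -> num p (rhs p) / d p ^+ 3 = f) ->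
  [/\ h0 = 0, h1 = 0, h2 = 0 & h3 = 0].
Proof.
move=> J0 H; apply: (cubic_zero_off_root (ux := ux) (uy := uy)).
  apply: contraNT J0; rewrite negb_or !negbK /J => /andP[/eqP -> /eqP ->].
  by rewrite !mul0r subrr.
move=> p d0; have := second_derivative_defect p (rhs p).
rewrite subrr mulr0 addr0 => <-.
have d3 : d p ^+ 3 != 0 by rewrite expf_neq0.
by move: (H p d0) => /(canRL (divfK d3)) ->; rewrite subrr.
Qed.

End SecondDerivative.

End CubicIdentities.

Section PullbackEquations.
Context {K : realType}.
Local Notation C := K[i].
Variables (E : cubic_ode K).
Local Notation P := (coefP E).
Local Notation Q := (coefQ E).
Local Notation R := (coefR E).
Local Notation S := (coefS E).
Implicit Types (u v : C * C -> C) (z : C * C).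

(** The coefficients of the powers of y' in the statement that (u, v) maps the
    equation to Painleve I. *)
Definition pullback_equations u v z : Prop :=
  let J := Defs.jacobian u v z in let f := 6 * v z ^+ 2 + u z in
  [/\ Dx (Dx v) z * Dx u z - Dx v z * Dx (Dx u) z + J * P z = f * Dx u z ^+ 3,
      2 * Dy (Dx v) z * Dx u z + Dx (Dx v) z * Dy u z - Dy v z * Dx (Dx u) z
        - 2 * Dx v z * Dy (Dx u) z + 3 * J * Q z = 3 * f * Dx u z ^+ 2 * Dy u z,
      Dy (Dy v) z * Dx u z + 2 * Dy (Dx v) z * Dy u z - 2 * Dy v z * Dy (Dx u) z
        - Dx v z * Dy (Dy u) z + 3 * J * R z = 3 * f * Dx u z * Dy u z ^+ 2 &
      Dy (Dy v) z * Dy u z - Dy v z * Dy (Dy u) z + J * S z = f * Dy u z ^+ 3].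

Lemma ode_rhs_painleve1 (w : C * C) (p : C) :
  ode_rhs painleve1 w p = 6 * w.2 ^+ 2 + w.1.
Proof. by rewrite /ode_rhs /= !mulr0 !mul0r !addr0. Qed.

Lemma pullback_maps_ode U u v :
  (forall z, U z -> Defs.jacobian u v z != 0) ->
  (forall z, U z -> pullback_equations u v z) -> maps_ode U u v E painleve1.
Proof.
move=> J0 eqs z Uz p q d0; rewrite ode_rhs_painleve1 /=.
have [e0 e1 e2 e3] := eqs z Uz.
have sub0 (x y : C) : x = y -> x - y = 0 by move=> ->; rewrite subrr.
exact: (@second_derivative_eq _ (P z) (Q z) (R z) (S z) (Dx u z) (Dy u z)
  (Dx v z) (Dy v z) (Dx (Dx u) z) (Dy (Dx u) z) (Dy (Dy u) z)
  (Dx (Dx v) z) (Dy (Dx v) z) (Dy (Dy v) z) (6 * v z ^+ 2 + u z) p q d0 (J0 z Uz)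
  (sub0 _ _ e0) (sub0 _ _ e1) (sub0 _ _ e2) (sub0 _ _ e3)).
Qed.

Lemma maps_ode_pullback U u v z : maps_ode U u v E painleve1 -> U z ->
  Defs.jacobian u v z != 0 -> pullback_equations u v z.
Proof.
move=> maps Uz J0.
have [|h0 h1 h2 h3] := second_derivative_coefs (P := P z) (Q := Q z) (R := R z)
  (S := S z) (uxx := Dx (Dx u) z) (uxy := Dy (Dx u) z) (uyy := Dy (Dy u) z)
  (vxx := Dx (Dx v) z) (vxy := Dy (Dx v) z) (vyy := Dy (Dy v) z)
  (f := 6 * v z ^+ 2 + u z) J0.
  move=> p d0; have [/(_ (erefl _)) H _] := maps z Uz p (ode_rhs E z p) d0.
  by rewrite ode_rhs_painleve1 /= in H.
split.
- exact: (subr0_eq h0).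
- exact: (subr0_eq h1).
- exact: (subr0_eq h2).
- exact: (subr0_eq h3).
Qed.

End PullbackEquations.

(** * Coordinates built from a fifth root of L1 *)

Section Reduction.
Context {K : realType}.
Local Notation C := K[i].
Variables (E : cubic_ode K) (U : set (C * C)) (U_open : open U).
Variables (a b p q T t1 t2 L l : C * C -> C) (k : C).
Hypotheses (a_analytic : analytic_on U a) (b_analytic : analytic_on U b)
  (T_analytic : analytic_on U T) (t1_analytic : analytic_on U t1)
  (t2_analytic : analytic_on U t2) (L_analytic : analytic_on U L)
  (l_analytic : analytic_on U l).
Hypotheses (l_neq0 : forall z, U z -> l z != 0) (k5 : 12 * k ^+ 5 = 1).
Hypotheses (cov : parallel_covector E U a b p q)
  (theta : theta_equations E U a b p q T t1 t2 L)
  (at_normal : forall z, U z -> a z * t1 z + b z * t2 z = -1)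
  (Tx : forall z, U z -> Dx T z = 2 * p z * T z - t2 z)
  (Ty : forall z, U z -> Dy T z = 2 * q z * T z + t1 z)
  (Lx : forall z, U z -> Dx L z = 4 * p z * L z - l z ^+ 5 * a z)
  (Ly : forall z, U z -> Dy L z = 4 * q z * L z - l z ^+ 5 * b z)
  (lx : forall z, U z -> Dx l z = p z * l z)
  (ly : forall z, U z -> Dy l z = q z * l z).
Variables u v : C * C -> C.
Hypotheses (uE : forall z, U z -> u z = k * L z / l z ^+ 4)
  (vE : forall z, U z -> v z = - k ^+ 3 * T z / l z ^+ 2)
  (u_analytic : analytic_on U u) (v_analytic : analytic_on U v).

Let lX_neq0 n z (Uz : U z) : l z ^+ n != 0.
Proof. by rewrite expf_neq0 ?l_neq0. Qed.

(** The gradients of u and v: that of u is proportional to the parallel covector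
    (a, b), that of v is dual to (t1, t2). *)
Let ux z : U z -> Dx u z = - k * l z * a z.
Proof.
have l4 := @lX_neq0 4; move=> Uz; differentiate uE Uz u1 u2; rewrite u1.
rewrite (lx Uz) (Lx Uz); move: (l_neq0 Uz); abstract_values z => l0.
by rewrite /=; field.
Qed.

Let uy z : U z -> Dy u z = - k * l z * b z.
Proof.
have l4 := @lX_neq0 4; move=> Uz; differentiate uE Uz u1 u2; rewrite u2.
rewrite (ly Uz) (Ly Uz); move: (l_neq0 Uz); abstract_values z => l0.
by rewrite /=; field.
Qed.

Let vx z : U z -> Dx v z = k ^+ 3 * t2 z / l z ^+ 2.
Proof.
have l2 := @lX_neq0 2; move=> Uz; differentiate vE Uz u1 u2; rewrite u1.
rewrite (lx Uz) (Tx Uz); move: (l_neq0 Uz); abstract_values z => l0.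
by rewrite /=; field.
Qed.

Let vy z : U z -> Dy v z = - k ^+ 3 * t1 z / l z ^+ 2.
Proof.
have l2 := @lX_neq0 2; move=> Uz; differentiate vE Uz u1 u2; rewrite u2.
rewrite (ly Uz) (Ty Uz); move: (l_neq0 Uz); abstract_values z => l0.
by rewrite /=; field.
Qed.

Lemma reduction_jacobian z : U z -> Defs.jacobian u v z = - k ^+ 4 / l z.
Proof.
move=> Uz; rewrite /Defs.jacobian (ux Uz) (uy Uz) (vx Uz) (vy Uz).
have n := at_normal Uz; apply: (by_combination1 (k := k ^+ 4 / l z) n).
by move: (l_neq0 Uz); abstract_values z => l0; field.
Qed.

(** After substituting the gradients, the second derivatives are known from the
    equations for (a, b), (t1, t2) and l, and what remains of the equation is
    12 k^5 = 1. *)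
Lemma reduction_pullback z : U z -> pullback_equations E u v z.
Proof.
have l2 := @lX_neq0 2; move=> Uz.
differentiate ux Uz uxx uxy.
differentiate uy Uz uyx uyy.
differentiate vx Uz vxx vxy.
differentiate vy Uz vyx vyy.
have [ax ay bx b_y] := cov Uz; have [t1x t1y t2x t2y] := theta Uz.
rewrite /pullback_equations /Defs.jacobian.
move: (ux Uz) (uy Uz) (vx Uz) (vy Uz) uxx uxy uyy vxx vxy vyy (lx Uz) (ly Uz)
  ax ay b_y t1y t2x t2y (uE Uz) (vE Uz) (l_neq0 Uz) => {uyx vyx bx t1x}.
generalize (a z); intro aa; generalize (b z); intro bb.
generalize (l z); intro ll; generalize (T z); intro TT.
abstract_values z.
do 20 (move=> ->); move=> l0; split.
- apply: (by_combination1 (k := k ^+ 4 * TT ^+ 2 * aa ^+ 3 / (2 * ll)) k5).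
  by rewrite /=; field.
- apply: (by_combination1 (k := 3 * k ^+ 4 * TT ^+ 2 * aa ^+ 2 * bb / (2 * ll)) k5).
  by rewrite /=; field.
- apply: (by_combination1 (k := 3 * k ^+ 4 * TT ^+ 2 * aa * bb ^+ 2 / (2 * ll)) k5).
  by rewrite /=; field.
- apply: (by_combination1 (k := k ^+ 4 * TT ^+ 2 * bb ^+ 3 / (2 * ll)) k5).
  by rewrite /=; field.
Qed.

End Reduction.

(** * The invariants of an equation equivalent to Painleve I *)

Section JetAlgebra.
Context {F : numFieldType}.

Lemma by_combination4 (x y l1 r1 k1 l2 r2 k2 l3 r3 k3 l4 r4 k4 : F) :
  l1 = r1 -> l2 = r2 -> l3 = r3 -> l4 = r4 ->
  x - y = k1 * (l1 - r1) + k2 * (l2 - r2) + k3 * (l3 - r3) + k4 * (l4 - r4) ->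
  x = y.
Proof. by do 4 (move=> ->); rewrite !subrr !mulr0 !addr0 => /subr0_eq. Qed.

Variables (P Q R S ux uy vx vy uxx uxy uyy vxx vxy vyy f p q : F).
Let J := ux * vy - uy * vx.
Hypotheses (J0 : J != 0)
  (e0 : vxx * ux - vx * uxx + J * P = f * ux ^+ 3)
  (e1 : 2 * vxy * ux + vxx * uy - vy * uxx - 2 * vx * uxy + 3 * J * Q =
    3 * f * ux ^+ 2 * uy)
  (e2 : vyy * ux + 2 * vxy * uy - 2 * vy * uxy - vx * uyy + 3 * J * R =
    3 * f * ux * uy ^+ 2)
  (e3 : vyy * uy - vy * uyy + J * S = f * uy ^+ 3)
  (ex : uxx * vy + ux * vxy - uxy * vx - uy * vxx = - p * J)
  (ey : uxy * vy + ux * vyy - uyy * vx - uy * vxy = - q * J).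

(** The four pullback equations and the two derivatives of the Jacobian are
    linear in the six second derivatives of u and v, with an invertible matrix. *)
Lemma jets_solved :
  [/\ uxx = (Q - 2 / 3 * p) * ux - P * uy,
      uxy = (R - q / 3) * ux - (Q + p / 3) * uy &
      uyy = S * ux - (R + 2 / 3 * q) * uy] /\
  [/\ vxx = (Q - 2 / 3 * p) * vx - P * vy + f * ux ^+ 2,
      vxy = (R - q / 3) * vx - (Q + p / 3) * vy + f * ux * uy &
      vyy = S * vx - (R + 2 / 3 * q) * vy + f * uy ^+ 2].
Proof.
split; split.
- apply: (by_combination4 (k1 := uy / J) (k2 := - ux / (3 * J)) (k3 := 2 * ux / (3 * J)) (k4 := 0) e0 e1 ex ey).
  by move: J0; rewrite /J => J0'; field.
- apply: (by_combination4 (k1 := uy / (3 * J)) (k2 := - ux / (3 * J)) (k3 := uy / (3 * J)) (k4 := ux / (3 * J)) e1 e2 ex ey).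
  by move: J0; rewrite /J => J0'; field.
- apply: (by_combination4 (k1 := uy / (3 * J)) (k2 := - ux / J) (k3 := 0) (k4 := 2 * uy / (3 * J)) e2 e3 ex ey).
  by move: J0; rewrite /J => J0'; field.
- apply: (by_combination4 (k1 := vy / J) (k2 := - vx / (3 * J)) (k3 := 2 * vx / (3 * J)) (k4 := 0) e0 e1 ex ey).
  by move: J0; rewrite /J => J0'; field.
- apply: (by_combination4 (k1 := vy / (3 * J)) (k2 := - vx / (3 * J)) (k3 := vy / (3 * J)) (k4 := vx / (3 * J)) e1 e2 ex ey).
  by move: J0; rewrite /J => J0'; field.
- apply: (by_combination4 (k1 := vy / (3 * J)) (k2 := - vx / J) (k3 := 0) (k4 := 2 * vy / (3 * J)) e2 e3 ex ey).
  by move: J0; rewrite /J => J0'; field.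
Qed.

End JetAlgebra.

Section PullbackInvariants.
Context {K : realType}.
Local Notation C := K[i].
Variables (E : cubic_ode K) (U : set (C * C)) (U_open : open U).
Local Notation P := (coefP E).
Local Notation Q := (coefQ E).
Local Notation R := (coefR E).
Local Notation S := (coefS E).
Hypotheses (P_analytic : analytic_on U P) (Q_analytic : analytic_on U Q)
  (R_analytic : analytic_on U R) (S_analytic : analytic_on U S).
Variables (u v J p q a b T : C * C -> C).
Hypotheses (u_analytic : analytic_on U u) (v_analytic : analytic_on U v)
  (J_analytic : analytic_on U J) (p_analytic : analytic_on U p)
  (q_analytic : analytic_on U q) (a_analytic : analytic_on U a)
  (b_analytic : analytic_on U b) (T_analytic : analytic_on U T).
Hypotheses (J_neq0 : forall z, U z -> J z != 0)
  (JE : forall z, U z -> J z = Dx u z * Dy v z - Dy u z * Dx v z)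
  (Jx : forall z, U z -> Dx J z = - p z * J z)
  (Jy : forall z, U z -> Dy J z = - q z * J z)
  (aE : forall z, U z -> a z = 12 * J z * Dx u z)
  (bE : forall z, U z -> b z = 12 * J z * Dy u z)
  (TE : forall z, U z -> T z = - v z / (12 * J z ^+ 2)).
Hypothesis pullback : forall z, U z -> pullback_equations E u v z.

Let jets z : U z ->
  [/\ Dx (Dx u) z = (Q z - 2 / 3 * p z) * Dx u z - P z * Dy u z,
      Dy (Dx u) z = (R z - q z / 3) * Dx u z - (Q z + p z / 3) * Dy u z &
      Dy (Dy u) z = S z * Dx u z - (R z + 2 / 3 * q z) * Dy u z] /\
  [/\ Dx (Dx v) z = (Q z - 2 / 3 * p z) * Dx v z - P z * Dy v z
        + (6 * v z ^+ 2 + u z) * Dx u z ^+ 2,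
      Dy (Dx v) z = (R z - q z / 3) * Dx v z - (Q z + p z / 3) * Dy v z
        + (6 * v z ^+ 2 + u z) * Dx u z * Dy u z &
      Dy (Dy v) z = S z * Dx v z - (R z + 2 / 3 * q z) * Dy v z
        + (6 * v z ^+ 2 + u z) * Dy u z ^+ 2].
Proof.
move=> Uz; have [e0 e1 e2 e3] := pullback Uz.
differentiate JE Uz J1 J2.
have J0 := J_neq0 Uz; rewrite (JE Uz) in J0.
apply: (jets_solved J0 e0 e1 e2 e3).
  move: (JE Uz) (Jx Uz) J1; abstract_values z => JE' Jx' J1'.
  by rewrite -JE' -Jx' J1'; ring.
move: (JE Uz) (Jy Uz) J2; abstract_values z => JE' Jy' J2'.
by rewrite -JE' -Jy' J2'; ring.
Qed.

Let uxx z (Uz : U z) := let: conj (And3 h _ _) _ := jets Uz in h.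
Let uxy z (Uz : U z) := let: conj (And3 _ h _) _ := jets Uz in h.
Let uyy z (Uz : U z) := let: conj (And3 _ _ h) _ := jets Uz in h.
Let vxx z (Uz : U z) := let: conj _ (And3 h _ _) := jets Uz in h.
Let vxy z (Uz : U z) := let: conj _ (And3 _ h _) := jets Uz in h.
Let vyy z (Uz : U z) := let: conj _ (And3 _ _ h) := jets Uz in h.

(** With (p, q) = - d log J, the gradient of u times J is parallel for any
    equation v'' = f (u, v); the factor 12 makes it equal to (A, B) below. *)
Lemma pullback_covector : parallel_covector E U a b p q.
Proof.
move=> z Uz.
differentiate aE Uz ax ay.
differentiate bE Uz bx b_y.
rewrite {}ax {}ay {}bx {}b_y.
move: (uxx Uz) (uxy Uz) (uyy Uz) (Jx Uz) (Jy Uz) (aE Uz) (bE Uz).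
abstract_values z; do 7 (move=> ->).
by split; field.
Qed.

Let closed z : U z -> Dy p z = Dx q z.
Proof.
move=> Uz; differentiate Jx Uz x1 x2; differentiate Jy Uz y1 y2.
have e := etrans (esym x2) y1; move: e (J_neq0 Uz); rewrite (Jx Uz) (Jy Uz).
move=> e J0; apply: (by_combination1 (k := - (J z)^-1) e).
by move: J0; abstract_values z => J0; field.
Qed.

(** The equality of the mixed second derivatives of u_x, u_y, v_x and v_y,
    solved for the derivatives of p and q.  The coefficient of the square of
    (a, b) comes from the derivative 12 v of 6 v^2 + u with respect to v. *)
Lemma pullback_schouten : schouten_equations E U a b p q T.
Proof.
move=> z Uz.
differentiate uxx Uz u1 u2; differentiate uxy Uz u3 u4; differentiate uyy Uz u5 u6.
differentiate vxx Uz v1 v2; differentiate vxy Uz v3 v4; differentiate vyy Uz v5 v6.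
have eu1 := etrans (esym u2) u3; have eu2 := etrans (esym u4) u5.
have ev1 := etrans (esym v2) v3; have ev2 := etrans (esym v4) v5.
move: (uxx Uz) (uxy Uz) (uyy Uz) (vxx Uz) (vxy Uz) (vyy Uz) => h1 h2 h3 h4 h5 h6.
have J0 := J_neq0 Uz; rewrite (JE Uz) in J0.
have cl := closed Uz.
move: h1 h2 h3 h4 h5 h6 eu1 eu2 ev1 ev2 cl (aE Uz) (bE Uz) (TE Uz) (JE Uz) J0.
rewrite {u1 u2 u3 u4 u5 u6 v1 v2 v3 v4 v5 v6}.
generalize (Dx u z); intro ux; generalize (Dy u z); intro uy.
generalize (Dx v z); intro vx; generalize (Dy v z); intro vy.
abstract_values z; do 6 (move=> ->).
move=> eu1 eu2 ev1 ev2 cl; move: eu1 eu2 ev1 ev2; rewrite cl.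
move=> eu1 eu2 ev1 ev2 -> -> -> -> J0.
set D := ux * vy - uy * vx in J0 *.
split.
- apply: (by_combination2 (k := - 3 * vx / D) (k' := 3 * ux / D) eu1 ev1).
  by move: J0; rewrite /D /= => J0; field.
- apply: (by_combination2 (k := - 3 * vy / D) (k' := 3 * uy / D) eu1 ev1).
  by move: J0; rewrite /D /= => J0; field.
- apply: (by_combination2 (k := - 3 * vy / D) (k' := 3 * uy / D) eu1 ev1).
  by move: J0; rewrite /D /= => J0; field.
- apply: (by_combination2 (k := - 3 * vy / D) (k' := 3 * uy / D) eu2 ev2).
  by move: J0; rewrite /D /= => J0; field.
Qed.

Let Tx z : U z -> Dx T z = 2 * p z * T z - Dx v z / (12 * J z ^+ 2).
Proof.
move=> Uz; have J12 w : U w -> 12 * J w ^+ 2 != 0.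
  by move=> Uw; rewrite mulf_neq0 ?pnatr_eq0 // expf_neq0 // J_neq0.
differentiate TE Uz T1 T2; move: (Jx Uz) (TE Uz) (J_neq0 Uz); rewrite {}T1 {T2 J12}.
by abstract_values z; do 2 (move=> ->); move=> J0 /=; field.
Qed.

Let Ty z : U z -> Dy T z = 2 * q z * T z - Dy v z / (12 * J z ^+ 2).
Proof.
move=> Uz; have J12 w : U w -> 12 * J w ^+ 2 != 0.
  by move=> Uw; rewrite mulf_neq0 ?pnatr_eq0 // expf_neq0 // J_neq0.
differentiate TE Uz T1 T2; move: (Jy Uz) (TE Uz) (J_neq0 Uz); rewrite {}T2 {T1 J12}.
by abstract_values z; do 2 (move=> ->); move=> J0 /=; field.
Qed.

(** a t1 + b t2 = -1 is here a multiple of the definition of the Jacobian. *)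
Lemma pullback_invAB z : U z -> invA E z = a z /\ invB E z = b z.
Proof.
move=> Uz; have [-> ->] := curvature U_open P_analytic Q_analytic R_analytic
  S_analytic a_analytic b_analytic p_analytic q_analytic T_analytic
  pullback_covector pullback_schouten Uz.
rewrite (Tx Uz) (Ty Uz).
move: (aE Uz) (bE Uz) (JE Uz) (J_neq0 Uz); abstract_values z.
do 3 (move=> ->); move=> J0; split; by field.
Qed.

Lemma pullback_GH z : U z -> invG E z = 0 /\ invH E z = 0.
Proof.
move=> Uz.
have A1 : Dx (invA E) z = Dx a z by apply: (eq_on_Dx U_open _ Uz) => w /pullback_invAB[].
have A2 : Dy (invA E) z = Dy a z by apply: (eq_on_Dy U_open _ Uz) => w /pullback_invAB[].
have B1 : Dx (invB E) z = Dx b z by apply: (eq_on_Dx U_open _ Uz) => w /pullback_invAB[].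
have B2 : Dy (invB E) z = Dy b z by apply: (eq_on_Dy U_open _ Uz) => w /pullback_invAB[].
have [Az Bz] := pullback_invAB Uz; have [ax ay bx b_y] := pullback_covector Uz.
rewrite /invG /invH A1 A2 B1 B2 Az Bz ax ay bx b_y.
by split; abstract_values z; field.
Qed.

Section Chart.
Variable c : chart.
Hypothesis den0 : forall z, U z -> chart_den E c z != 0.

Lemma pullback_phi z : U z -> phi1 E c z = p z /\ phi2 E c z = q z.
Proof.
move=> Uz.
have A1 : Dx (invA E) z = Dx a z by apply: (eq_on_Dx U_open _ Uz) => w /pullback_invAB[].
have A2 : Dy (invA E) z = Dy a z by apply: (eq_on_Dy U_open _ Uz) => w /pullback_invAB[].
have B1 : Dx (invB E) z = Dx b z by apply: (eq_on_Dx U_open _ Uz) => w /pullback_invAB[].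
have B2 : Dy (invB E) z = Dy b z by apply: (eq_on_Dy U_open _ Uz) => w /pullback_invAB[].
have [Az Bz] := pullback_invAB Uz; have [ax ay bx b_y] := pullback_covector Uz.
move: (den0 Uz); rewrite /chart_den /phi1 /phi2; case: c => d0; move: d0;
  rewrite ?A1 ?A2 ?B1 ?B2 Az Bz ?ax ?ay ?bx ?b_y;
  abstract_values z => d0; split; by field.
Qed.

Lemma pullback_Theta z : U z -> invTheta E c z = T z.
Proof.
move=> Uz.
have AE w : U w -> invA E w = a w by case/pullback_invAB.
have BE w : U w -> invB E w = b w by case/pullback_invAB.
have A1 w : U w -> Dx (invA E) w = Dx a w by exact: (eq_on_Dx U_open AE).
have A2 w : U w -> Dy (invA E) w = Dy a w by exact: (eq_on_Dy U_open AE).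
have B1 w : U w -> Dx (invB E) w = Dx b w by exact: (eq_on_Dx U_open BE).
have B2 w : U w -> Dy (invB E) w = Dy b w by exact: (eq_on_Dy U_open BE).
have A11 : Dx (Dx (invA E)) z = Dx (Dx a) z by exact: (eq_on_Dx U_open A1 Uz).
have B22 : Dy (Dy (invB E)) z = Dy (Dy b) z by exact: (eq_on_Dy U_open B2 Uz).
have cov_ax w (Uw : U w) := let: And4 h _ _ _ := pullback_covector Uw in h.
have cov_by w (Uw : U w) := let: And4 _ _ _ h := pullback_covector Uw in h.
differentiate cov_ax Uz axx axy; differentiate cov_by Uz byx byy.
have [ax ay bx b_y] := pullback_covector Uz; have [px py qx qy] := pullback_schouten Uz.
move: (den0 Uz); rewrite /chart_den /invTheta /omega1 /omega2.
move: A11 B22 (A1 z Uz) (A2 z Uz) (B1 z Uz) (B2 z Uz) (AE z Uz) (BE z Uz).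
move: axx byy ax ay bx b_y px qy.
case: c; abstract_values z; do 16 (move=> ?); subst; move=> d0; rewrite /=; by field.
Qed.

Lemma pullback_theta z : U z -> theta1 E c z = - Dy v z / (12 * J z ^+ 2) /\
  theta2 E c z = Dx v z / (12 * J z ^+ 2).
Proof.
move=> Uz; rewrite /theta1 /theta2.
rewrite (eq_on_Dx U_open pullback_Theta Uz) (eq_on_Dy U_open pullback_Theta Uz).
have [-> ->] := pullback_phi Uz; rewrite (pullback_Theta Uz) (Tx Uz) (Ty Uz).
move: (J_neq0 Uz); abstract_values z => J0; split; by field.
Qed.

Let J12_neq0 w : U w -> 12 * J w ^+ 2 != 0.
Proof. by move=> Uw; rewrite mulf_neq0 ?pnatr_eq0 // expf_neq0 // J_neq0. Qed.

Let J4_neq0 w : U w -> 12 ^+ 3 * J w ^+ 4 != 0.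
Proof. by move=> Uw; rewrite mulf_neq0 // expf_neq0 ?pnatr_eq0 // J_neq0. Qed.

Let J5_neq0 w : U w -> J w ^+ 5 != 0.
Proof. by move=> Uw; rewrite expf_neq0 // J_neq0. Qed.

Let theta1E w : U w -> theta1 E c w = - Dy v w / (12 * J w ^+ 2).
Proof. by case/pullback_theta. Qed.

Let theta2E w : U w -> theta2 E c w = Dx v w / (12 * J w ^+ 2).
Proof. by case/pullback_theta. Qed.

(** The term 6 v^2 of the Painleve I equation is cancelled by Theta^2 / 2, and u
    remains. *)
Lemma pullback_L z : U z -> invL E c z = u z / (12 ^+ 3 * J z ^+ 4).
Proof.
have J12 := J12_neq0.
have theta1_analytic : analytic_on U (theta1 E c).
  apply: (eq_analytic_on U_open (fun w Uw => esym (theta1E Uw))).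
  by analytic_on_tac.
have theta2_analytic : analytic_on U (theta2 E c).
  apply: (eq_analytic_on U_open (fun w Uw => esym (theta2E Uw))).
  by analytic_on_tac.
move=> Uz; differentiate theta1E Uz t1x t1y; differentiate theta2E Uz t2x t2y.
rewrite /invL.
move: t1x t1y t2x t2y (Jx Uz) (Jy Uz) (vxx Uz) (vxy Uz) (vyy Uz).
move: (theta1E Uz) (theta2E Uz) (pullback_Theta Uz) (TE Uz) (JE Uz) (J_neq0 Uz).
abstract_values z; do 15 (move=> ?); subst => /=; by field.
Qed.

Lemma pullback_L1 z : U z -> invL1 E c z = - (12 ^+ 4 * J z ^+ 5)^-1.
Proof.
have J4 := J4_neq0; move=> Uz.
have L_analytic : analytic_on U (invL E c).
  by apply: (eq_analytic_on U_open (fun w Uw => esym (pullback_L Uw))); analytic_on_tac.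
differentiate pullback_L Uz Lx Ly; rewrite /invL1.
have [pE qE] := pullback_phi Uz.
move: Lx Ly (Jx Uz) (Jy Uz) (pullback_L Uz) (theta1E Uz) (theta2E Uz) pE qE.
move: (JE Uz) (J_neq0 Uz).
abstract_values z; do 11 (move=> ?); subst => /=; by field.
Qed.

Lemma pullback_WV z : U z -> invW E c z = 0 /\ Defs.invV E c z = 0.
Proof.
have J5 := J5_neq0; move=> Uz.
have [k L1E] : exists k : C, forall w, U w -> invL1 E c w = k * (J w ^+ 5)^-1.
  by exists (- (12 ^+ 4)^-1) => w Uw; rewrite (pullback_L1 Uw) invfM mulNr.
have L1_analytic : analytic_on U (invL1 E c).
  by apply: (eq_analytic_on U_open (fun w Uw => esym (L1E w Uw))); analytic_on_tac.
differentiate L1E Uz Lx Ly; rewrite /invW /Defs.invV.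
have [pE qE] := pullback_phi Uz.
move: Lx Ly (Jx Uz) (Jy Uz) (L1E z Uz) pE qE (J_neq0 Uz).
abstract_values z; do 8 (move=> ?); subst => /=; split; by field.
Qed.

Lemma pullback_Omega z : U z -> invOmega E c z = 0.
Proof.
move=> Uz; rewrite /invOmega.
have pE w : U w -> phi1 E c w = p w by case/pullback_phi.
have qE w : U w -> phi2 E c w = q w by case/pullback_phi.
rewrite (eq_on_Dy U_open pE Uz) (eq_on_Dx U_open qE Uz) (closed Uz) subrr.
exact: mulr0.
Qed.

Lemma pullback_N z : U z -> invN E c z = 0.
Proof.
move=> Uz; have [G0 H0] := pullback_GH Uz.
by rewrite /invN; case: c; rewrite ?G0 ?H0 ?oppr0 mul0r.
Qed.

End Chart.
End PullbackInvariants.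

(** * From an equivalence to the conditions *)

Section Density.
Context {K : realType}.
Local Notation C := K[i].
Implicit Types (f g : C * C -> C) (z : C * C) (U D O : set (C * C)).

Lemma sub_analytic_on U D f : U `<=` D -> analytic_on D f -> analytic_on U f.
Proof. by move=> UD fD z Uz; exact: fD (UD z Uz). Qed.

(** A nonzero value persists nearby, hence at a point of the dense set. *)
Lemma vanishes_dense D O U f : open U -> U `<=` D -> D `<=` closure O ->
  analytic_on U f -> (forall z, O z -> U z -> f z = 0) -> vanishes_on U f.
Proof.
move=> Uo UD Ocl fU f0 z Uz; apply: contrapT => /eqP fz.
have nz := open_near (nonzero_open Uo fU) (conj Uz fz).
have [w [Ow [Uw fw]]] := Ocl z (UD z Uz) _ nz.
by move: fw; rewrite (f0 w Ow Uw) eqxx.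
Qed.

Lemma open_polydisc z (r : C) : 0 < r ->
  open [set w : C * C | `|w.1 - z.1| < r /\ `|w.2 - z.2| < r].
Proof.
move=> r0; rewrite openE => w [w1 w2].
apply/near_polydisc; pose d1 := r - `|w.1 - z.1|; pose d2 := r - `|w.2 - z.2|.
have d10 : 0 < d1 by rewrite subr_gt0.
have d20 : 0 < d2 by rewrite subr_gt0.
have d120 : 0 < d1 + d2 by rewrite addr_gt0.
exists (d1 * d2 / (d1 + d2)); split; first by rewrite divr_gt0 ?mulr_gt0.
have lt1 (x : C) : x < d1 * d2 / (d1 + d2) -> x < d1.
  by move=> /lt_trans; apply; rewrite ltr_pdivrMr // ltr_pM2l // ltrDr.
have lt2 (x : C) : x < d1 * d2 / (d1 + d2) -> x < d2.
  by move=> /lt_trans; apply; rewrite ltr_pdivrMr // mulrC ltr_pM2l // ltrDl.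
move=> h k hd kd; split => /=.
  rewrite addrAC; apply: le_lt_trans (ler_normD _ _) _.
  by rewrite -ltrBrDl; exact: (lt1 _ hd).
rewrite addrAC; apply: le_lt_trans (ler_normD _ _) _.
by rewrite -ltrBrDl; exact: (lt2 _ kd).
Qed.

End Density.

Section FromEquivalence.
Context {K : realType}.
Local Notation C := K[i].
Variables (E : cubic_ode K) (U : set (C * C)) (u v : C * C -> C).
Hypotheses (P_analytic : analytic_on U (coefP E))
  (Q_analytic : analytic_on U (coefQ E))
  (R_analytic : analytic_on U (coefR E))
  (S_analytic : analytic_on U (coefS E)).
Hypotheses (trans : point_transformation U u v)
  (maps : maps_ode U u v E painleve1).

Let U_open : open U. Proof. by have [] := trans. Qed.
Let u_analytic : analytic_on U u. Proof. by have [] := trans. Qed.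
Let v_analytic : analytic_on U v. Proof. by have [] := trans. Qed.
Let J := Defs.jacobian u v.
Let J_neq0 z : U z -> J z != 0. Proof. by have [_ _ _ J0 _] := trans; exact: J0. Qed.
Let J_analytic : analytic_on U J. Proof. by rewrite /J /Defs.jacobian; analytic_on_tac. Qed.
Let p z := - Dx J z / J z.
Let q z := - Dy J z / J z.
Let a z := 12 * J z * Dx u z.
Let b z := 12 * J z * Dy u z.
Let T z := - v z / (12 * J z ^+ 2).

Let p_analytic : analytic_on U p.
Proof. by have J0 := J_neq0; rewrite /p; analytic_on_tac. Qed.
Let q_analytic : analytic_on U q.
Proof. by have J0 := J_neq0; rewrite /q; analytic_on_tac. Qed.
Let a_analytic : analytic_on U a. Proof. by rewrite /a; analytic_on_tac. Qed.
Let b_analytic : analytic_on U b. Proof. by rewrite /b; analytic_on_tac. Qed.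
Let T_analytic : analytic_on U T.
Proof.
have J2 z : U z -> 12 * J z ^+ 2 != 0.
  by move=> Uz; rewrite mulf_neq0 ?pnatr_eq0 // expf_neq0 // J_neq0.
by rewrite /T; analytic_on_tac.
Qed.

Let pullback z : U z -> pullback_equations E u v z.
Proof. by move=> Uz; exact: maps_ode_pullback maps Uz (J_neq0 Uz). Qed.

Let Jx z : U z -> Dx J z = - p z * J z.
Proof. by move=> Uz; rewrite /p -mulNr opprK divfK // J_neq0. Qed.

Let Jy z : U z -> Dy J z = - q z * J z.
Proof. by move=> Uz; rewrite /q -mulNr opprK divfK // J_neq0. Qed.

(** A and B are multiples of the derivatives of u, which do not vanish together
    as the Jacobian is not zero. *)
Lemma equivalent_invAB z : U z ->
  invA E z * invG E z + invB E z * invH E z = 0 /\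
  (invA E z != 0 \/ invB E z != 0).
Proof.
move=> Uz.
have [-> ->] := pullback_GH U_open P_analytic Q_analytic R_analytic S_analytic
  u_analytic v_analytic J_analytic p_analytic q_analytic a_analytic b_analytic
  T_analytic J_neq0 (fun z _ => erefl) Jx Jy (fun z _ => erefl)
  (fun z _ => erefl) (fun z _ => erefl) pullback Uz.
have [-> ->] := pullback_invAB U_open P_analytic Q_analytic R_analytic S_analytic
  u_analytic v_analytic J_analytic p_analytic q_analytic a_analytic b_analytic
  T_analytic J_neq0 (fun z _ => erefl) Jx Jy (fun z _ => erefl)
  (fun z _ => erefl) (fun z _ => erefl) pullback Uz.
have zero (x y : C) : x * 0 + y * 0 = 0 by rewrite !mulr0 addr0.
split; first exact: zero.
have J0 := J_neq0 Uz; rewrite /a /b.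
have J12 : 12 * J z != 0 by rewrite mulf_neq0 ?pnatr_eq0.
have [ux0|ux0] := eqVneq (Dx u z) 0; last by left; rewrite mulf_neq0.
right; rewrite mulf_neq0 //; apply: contraNneq J0 => uy0.
have det0 (x y s t : C) : x = 0 -> y = 0 -> x * s - y * t = 0.
  by move=> -> ->; rewrite !mul0r subrr.
by apply/eqP; exact: (det0 _ _ _ _ ux0 uy0).
Qed.

Section Chart.
Variable c : chart.
Hypothesis den0 : forall z, U z -> chart_den E c z != 0.

Lemma equivalent_invariants z : U z ->
  [/\ invOmega E c z = 0, invN E c z = 0, invW E c z = 0 & Defs.invV E c z = 0] /\
  (invTheta E c z = - v z / (12 * J z ^+ 2) /\ invL1 E c z != 0).
Proof.
move=> Uz.
have N0 := pullback_N U_open P_analytic Q_analytic R_analytic S_analytic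
  u_analytic v_analytic J_analytic p_analytic q_analytic a_analytic b_analytic
  T_analytic J_neq0 (fun z _ => erefl) Jx Jy (fun z _ => erefl)
  (fun z _ => erefl) (fun z _ => erefl) pullback c Uz.
have O0 := pullback_Omega U_open P_analytic Q_analytic R_analytic S_analytic
  u_analytic v_analytic J_analytic p_analytic q_analytic a_analytic b_analytic
  T_analytic J_neq0 (fun z _ => erefl) Jx Jy (fun z _ => erefl)
  (fun z _ => erefl) (fun z _ => erefl) pullback den0 Uz.
have [W0 V0] := pullback_WV U_open P_analytic Q_analytic R_analytic S_analytic
  u_analytic v_analytic J_analytic p_analytic q_analytic a_analytic b_analytic
  T_analytic J_neq0 (fun z _ => erefl) Jx Jy (fun z _ => erefl)
  (fun z _ => erefl) (fun z _ => erefl) pullback den0 Uz.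
have TE := pullback_Theta U_open P_analytic Q_analytic R_analytic S_analytic
  u_analytic v_analytic J_analytic p_analytic q_analytic a_analytic b_analytic
  T_analytic J_neq0 (fun z _ => erefl) Jx Jy (fun z _ => erefl)
  (fun z _ => erefl) (fun z _ => erefl) pullback den0 Uz.
have L1E := pullback_L1 U_open P_analytic Q_analytic R_analytic S_analytic
  u_analytic v_analytic J_analytic p_analytic q_analytic a_analytic b_analytic
  T_analytic J_neq0 (fun z _ => erefl) Jx Jy (fun z _ => erefl)
  (fun z _ => erefl) (fun z _ => erefl) pullback den0 Uz.
split; first by split.
split; first exact: TE.
rewrite L1E oppr_eq0 invr_eq0; apply: mulf_neq0; apply: expf_neq0.
  by rewrite pnatr_eq0.
exact: J_neq0.
Qed.

(** Theta is a multiple of v, which is not constant. *)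
Lemma equivalent_Theta_neq0 z : U z -> ~ vanishes_on U (invTheta E c).
Proof.
move=> Uz T0; have := J_neq0 Uz.
have v0 w : U w -> v w = 0.
  move=> Uw; have := (equivalent_invariants Uw).2.1; rewrite (T0 w Uw) => /esym/eqP.
  rewrite mulf_eq0 oppr_eq0 invr_eq0 => /orP[/eqP //|].
  by rewrite mulf_eq0 pnatr_eq0 expf_eq0 (negPf (J_neq0 Uw)).
have vx0 := etrans (eq_on_Dx (g := fun=> 0) U_open v0 Uz) (DxC 0 z).
have vy0 := etrans (eq_on_Dy (g := fun=> 0) U_open v0 Uz) (DyC 0 z).
have det0 (x y s t : C) : s = 0 -> t = 0 -> x * s - y * t = 0.
  by move=> -> ->; rewrite !mulr0 subrr.
by move=> /eqP; apply; exact: (det0 _ _ _ _ vy0 vx0).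
Qed.

End Chart.

End FromEquivalence.

Lemma restrict_point_transformation (K : realType) (U V : set (K[i] * K[i])) u v :
  open V -> V `<=` U -> point_transformation U u v -> point_transformation V u v.
Proof.
move=> Vo VU [_ uU vU J0 inj]; split.
- exact: Vo.
- exact: sub_analytic_on VU uU.
- exact: sub_analytic_on VU vU.
- by move=> z /VU; exact: J0.
- by move=> z w /VU Uz /VU Uw; exact: inj.
Qed.

Section FromEquivalentOdes.
Context {K : realType}.
Local Notation C := K[i].
Variables (D : set (C * C)) (D_open : open D) (D_nonempty : D !=set0).
Variables (E : cubic_ode K).
Hypotheses (P_analytic : analytic_on D (coefP E))
  (Q_analytic : analytic_on D (coefQ E)) (R_analytic : analytic_on D (coefR E))
  (S_analytic : analytic_on D (coefS E)).
Variables (F : C * C -> C) (c : chart).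
Hypothesis F_def : forall z, D z ->
  3 * F z ^+ 5 = invA E z * invG E z + invB E z * invH E z.
Hypothesis c_admissible : ~ vanishes_on D (invA E) \/ ~ vanishes_on D (invB E) ->
  ~ vanishes_on D (chart_den E c).

(** The conditions hold on the dense open set where the equation is equivalent to
    Painleve I, and the identities extend by density. *)
Lemma equivalent_conditions : equivalent_odes D E painleve1 ->
  painleve1_conditions E c D F.
Proof.
move=> [X [Xo OD Ocl Oeq]].
have AD := invA_analytic P_analytic Q_analytic R_analytic S_analytic.
have BD := invB_analytic P_analytic Q_analytic R_analytic S_analytic.
have GD : analytic_on D (invG E) by rewrite /invG; analytic_on_tac.
have HD : analytic_on D (invH E) by rewrite /invH; analytic_on_tac.
have FD := analytic_onD (analytic_onM AD GD) (analytic_onM BD HD).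
have AB z : X z -> invA E z * invG E z + invB E z * invH E z = 0 /\
    (invA E z != 0 \/ invB E z != 0).
  move=> Oz; have [U [u [v [Uz UD trans maps]]]] := Oeq z Oz.
  exact: (equivalent_invAB (sub_analytic_on UD P_analytic)
    (sub_analytic_on UD Q_analytic) (sub_analytic_on UD R_analytic)
    (sub_analytic_on UD S_analytic) trans maps Uz).
have AB0 : ~ vanishes_on D (invA E) \/ ~ vanishes_on D (invB E).
  have [z Dz] := D_nonempty.
  have [w [Ow Dw]] := Ocl z Dz _ (open_near D_open Dz).
  have [_ [Aw|Bw]] := AB w Ow; [left=> A0|right=> B0].
    by move: Aw; rewrite (A0 w Dw) eqxx.
  by move: Bw; rewrite (B0 w Dw) eqxx.
have den_nonzero := c_admissible AB0.
have denD := chart_den_analytic c P_analytic Q_analytic R_analytic S_analytic.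
have Wo : open (chart_dom E c D) by exact: nonzero_open.
have WD : chart_dom E c D `<=` D by move=> z [].
have [z1 Wz1] : exists z, chart_dom E c D z.
  apply: contrapT => noz; apply: den_nonzero => z Dz.
  by apply: contrapT => /eqP dz; apply: noz; exists z.
have inv z : X z -> chart_dom E c D z ->
    [/\ invOmega E c z = 0, invN E c z = 0, invW E c z = 0 & Defs.invV E c z = 0] /\
    (~ vanishes_on (chart_dom E c D) (invTheta E c) /\ invL1 E c z != 0).
  move=> Oz Wz; have [U [u [v [Uz UD trans maps]]]] := Oeq z Oz.
  pose V := U `&` chart_dom E c D.
  have VU : V `<=` U by move=> w [].
  have VW : V `<=` chart_dom E c D by move=> w [].
  have Vz : V z by split.
  have Vo : open V by apply: openI => //; have [] := trans.
  have transV := restrict_point_transformation Vo VU trans.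
  have mapsV : maps_ode V u v E painleve1 by move=> w /VU; exact: maps.
  have VD : V `<=` D by move=> w /VU/UD.
  have PV := sub_analytic_on VD P_analytic.
  have QV := sub_analytic_on VD Q_analytic.
  have RV := sub_analytic_on VD R_analytic.
  have SV := sub_analytic_on VD S_analytic.
  have denV w : V w -> chart_den E c w != 0 by move=> /VW[].
  have [vanish [_ L10]] := equivalent_invariants PV QV RV SV transV mapsV denV Vz.
  split; [exact: vanish|split; [|exact: L10]] => T0.
  apply: (equivalent_Theta_neq0 PV QV RV SV transV mapsV denV Vz) => w /VW.
  exact: T0.
have [z [Oz Wz]] := Ocl z1 (WD z1 Wz1) _ (open_near Wo Wz1).
have dense f : mero_on D (chart_den E c) f ->
    (forall w, X w -> chart_dom E c D w -> f w = 0) -> vanishes_on (chart_dom E c D) f.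
  move=> fm; exact: (vanishes_dense Wo WD Ocl (mero_analytic_on D_open denD fm)).
split.
- move=> w Dw.
  have FE := vanishes_dense D_open (fun _ => id) Ocl FD (fun y Oy _ => (AB y Oy).1) Dw.
  have := F_def Dw; rewrite FE => /eqP.
  by rewrite mulf_eq0 pnatr_eq0 expf_eq0 /= => /eqP.
- exact: AB0.
- apply: (dense _ (invOmega_mero c D_open P_analytic Q_analytic R_analytic S_analytic)).
  by move=> w Ow Ww; have [[]] := inv w Ow Ww.
- apply: (dense _ (invN_mero c D_open P_analytic Q_analytic R_analytic S_analytic)).
  by move=> w Ow Ww; have [[]] := inv w Ow Ww.
- apply: (dense _ (invW_mero c D_open P_analytic Q_analytic R_analytic S_analytic)).
  by move=> w Ow Ww; have [[]] := inv w Ow Ww.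
- apply: (dense _ (invV_mero c D_open P_analytic Q_analytic R_analytic S_analytic)).
  by move=> w Ow Ww; have [[]] := inv w Ow Ww.
- by have [_ []] := inv z Oz Wz.
- by move=> L10; have [_ [_ /eqP]] := inv z Oz Wz; apply; exact: L10 z Wz.
Qed.

End FromEquivalentOdes.

(** * From the conditions to the explicit change of variables *)

Section GradientAlgebra.
Context {F : fieldType}.
Variables (a b t1 t2 p q L Lx Ly L1 : F).
Hypothesis normal : a * t1 + b * t2 = -1.

(** A gradient is determined by its components along (t1, t2) and (b, - a), which
    are independent when a t1 + b t2 = -1.  For L the first component is given by
    the definition of L1; for L1 both are, by W = 0 and V = 0. *)
Lemma gradient_transversal : b * (Lx - 4 * p * L) = a * (Ly - 4 * q * L) ->
  L1 = Lx * t1 + Ly * t2 - 4 * L * (p * t1 + q * t2) ->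
  Lx = 4 * p * L - L1 * a /\ Ly = 4 * q * L - L1 * b.
Proof.
move=> e ->; split.
  apply: (by_combination2 (k := Lx - 4 * p * L) (k' := - t2) normal e); ring.
by apply: (by_combination2 (k := Ly - 4 * q * L) (k' := t1) normal e); ring.
Qed.

Lemma gradient_zero : Lx * t1 + Ly * t2 - 5 * L * (p * t1 + q * t2) = 0 ->
  Lx * b - Ly * a - 5 * L * (b * p - a * q) = 0 ->
  Lx = 5 * p * L /\ Ly = 5 * q * L.
Proof.
move=> e1 e2.
have X0 : (a * t1 + b * t2) * (Lx - 5 * p * L) = 0.
  apply: (by_combination2 (k := a) (k' := t2) e1 e2); ring.
have Y0 : (a * t1 + b * t2) * (Ly - 5 * q * L) = 0.
  apply: (by_combination2 (k := b) (k' := - t1) e1 e2); ring.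
by move: X0 Y0; rewrite normal !mulN1r => /eqP + /eqP;
  rewrite !oppr_eq0 !subr_eq0 => /eqP -> /eqP ->.
Qed.

End GradientAlgebra.

Section ExplicitRoots.
Context {F : fieldType}.
(* t stands for 12, and t / d^2 for the constant k with 12 k^5 = 1. *)
Variables (t d l s L L1 T : F).
Hypotheses (d5 : d ^+ 5 = t ^+ 3) (d0 : d != 0) (t0 : t != 0)
  (l5 : l ^+ 5 = L1) (s2 : s ^+ 2 = L) (l0 : l != 0) (s0 : s != 0).

Let d10 : d ^+ 10 = t ^+ 6. Proof. by rewrite (exprM d 5 2) d5 -exprM. Qed.

(** Branches of the three roots in the explicit formulas, all expressed by d, a
    fifth root l of L1 and a square root s of L: of 12 I1, of I2 and of I1. *)
Lemma explicit_roots :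
  [/\ (d ^+ 2 * l ^+ 4 / (t * L)) ^+ 5 = t * (L1 ^+ 4 / L ^+ 5),
      (T / s) ^+ 2 = T ^+ 2 / L & (l ^+ 2 / s) ^+ 10 = L1 ^+ 4 / L ^+ 5].
Proof.
rewrite -l5 -s2; split.
- apply: (by_combination1 (k := l ^+ 20 / (t ^+ 5 * s ^+ 10)) d10).
  by field; rewrite s0 t0.
- by field.
- by field.
Qed.

Lemma explicit_scale : t * (t / d ^+ 2) ^+ 5 = 1.
Proof.
apply: (by_combination1 (k := - (d ^+ 10)^-1) d10); field.
exact: d0.
Qed.

Lemma explicit_u : 1 / (d ^+ 2 * l ^+ 4 / (t * L)) = t / d ^+ 2 * L / l ^+ 4.
Proof. by rewrite -s2; field; rewrite l0 d0 s0 t0. Qed.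

Lemma explicit_v : - 1 * (T / s / (d * (l ^+ 2 / s))) =
  - (t / d ^+ 2) ^+ 3 * T / l ^+ 2.
Proof.
apply: (by_combination1 (k := - (T / (d ^+ 6 * l ^+ 2))) d5).
by field; rewrite l0 d0 s0.
Qed.

(** The logarithmic derivative of a fifth root is a fifth of that of L1. *)
Lemma fifth_root_derivative (lx L1x p : F) : (5 : F) != 0 ->
  5 * l ^+ 5.-1 * lx = L1x -> L1x = 5 * p * L1 -> lx = p * l.
Proof.
move=> n5 e1 e2; have e := etrans e1 e2.
by apply: (by_combination1 (k := (5 * l ^+ 4)^-1) e); rewrite -l5 /=; field; rewrite n5 l0.
Qed.

End ExplicitRoots.

Section FromConditions.
Context {K : realType}.
Local Notation C := K[i].
Variables (D : set (C * C)) (D_open : open D) (D_connected : connected D).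
Variables (E : cubic_ode K).
Hypotheses (P_analytic : analytic_on D (coefP E))
  (Q_analytic : analytic_on D (coefQ E)) (R_analytic : analytic_on D (coefR E))
  (S_analytic : analytic_on D (coefS E)).
Variables (F : C * C -> C) (c : chart).
Hypothesis F_def : forall z, D z ->
  3 * F z ^+ 5 = invA E z * invG E z + invB E z * invH E z.
Hypothesis den_nonzero : ~ vanishes_on D (chart_den E c).
Hypothesis conditions : painleve1_conditions E c D F.

Let U := chart_dom E c D.
Let den_analytic : analytic_on D (chart_den E c).
Proof. exact: chart_den_analytic. Qed.
Let U_open : open U. Proof. exact: nonzero_open D_open den_analytic. Qed.
Let UD : U `<=` D. Proof. by move=> z []. Qed.

Let on_U f : mero_on D (chart_den E c) f -> analytic_on U f.
Proof. exact: mero_analytic_on. Qed.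

Let PU := sub_analytic_on UD P_analytic.
Let QU := sub_analytic_on UD Q_analytic.
Let RU := sub_analytic_on UD R_analytic.
Let SU := sub_analytic_on UD S_analytic.
Let AU : analytic_on U (invA E). Proof. exact: invA_analytic. Qed.
Let BU : analytic_on U (invB E). Proof. exact: invB_analytic. Qed.
Let phi1U := on_U (phi1_mero c D_open P_analytic Q_analytic R_analytic S_analytic).
Let phi2U := on_U (phi2_mero c D_open P_analytic Q_analytic R_analytic S_analytic).
Let ThetaU := on_U (invTheta_mero c D_open P_analytic Q_analytic R_analytic S_analytic).
Let theta1U := on_U (theta1_mero c D_open P_analytic Q_analytic R_analytic S_analytic).
Let theta2U := on_U (theta2_mero c D_open P_analytic Q_analytic R_analytic S_analytic).
Let L_mero := invL_mero c D_open P_analytic Q_analytic R_analytic S_analytic.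
Let L1_mero := invL1_mero c D_open P_analytic Q_analytic R_analytic S_analytic.
Let LU := on_U L_mero.
Let L1U := on_U L1_mero.

Let den0 z : U z -> chart_den E c z != 0. Proof. by case. Qed.
Let F0 z : U z -> invA E z * invG E z + invB E z * invH E z = 0.
Proof.
move=> [Dz _]; rewrite -(F_def Dz) (cond_F conditions Dz) expr0n /=.
exact: mulr0.
Qed.

Let cov := covector_parallel den0 F0 (cond_N conditions).
Let schouten := schouten_hold U_open PU QU RU SU phi1U phi2U den0 F0
  (cond_N conditions) (cond_Omega conditions).
Let normal := theta_normal U_open PU QU RU SU phi1U phi2U ThetaU den0 F0
  (cond_N conditions) (cond_Omega conditions).
Let theta := theta_derivatives U_open AU BU phi1U phi2U ThetaU
  cov schouten theta1U theta2U (fun z _ => erefl) (fun z _ => erefl) normal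
  (fun z _ => erefl : invL E c z = _).

Let gradient_L z : U z ->
  Dx (invL E c) z = 4 * phi1 E c z * invL E c z - invL1 E c z * invA E z /\
  Dy (invL E c) z = 4 * phi2 E c z * invL E c z - invL1 E c z * invB E z.
Proof.
move=> Uz; apply: (gradient_transversal (normal Uz) _ (erefl (invL1 E c z))).
exact: (L_transversal U_open PU QU RU SU AU BU phi1U phi2U ThetaU cov schouten
  theta1U theta2U LU (fun z _ => erefl) (fun z _ => erefl) normal
  (fun z _ => erefl) Uz).
Qed.

Let gradient_L1 z : U z ->
  Dx (invL1 E c) z = 5 * phi1 E c z * invL1 E c z /\
  Dy (invL1 E c) z = 5 * phi2 E c z * invL1 E c z.
Proof.
move=> Uz; exact: (gradient_zero (normal Uz) (cond_W conditions Uz)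
  (cond_V conditions Uz)).
Qed.

(** The fifth root l of L1 satisfies d l = l phi because d L1 = 5 L1 phi, and the
    explicit formulas are u = k L / l^4 and v = - k^3 Theta / l^2. *)
Lemma explicit_reduction z : U z -> invL E c z != 0 -> invL1 E c z != 0 ->
  explicit_reduction_at E c D z.
Proof.
move=> Uz L0 L10.
have [V1 [l [V1o V1z V1U lV lE]]] := analytic_root_on (n := 5) isT U_open L1U Uz L10.
have ULo := nonzero_open U_open LU.
have ULU : [set z | U z /\ invL E c z != 0] `<=` U by move=> w [].
have [V2 [s [V2o V2z V2U sV sE]]] := analytic_root_on (n := 2) isT ULo
  (sub_analytic_on ULU LU) (conj Uz L0) L0.
have n12 : (12 : C) != 0 by rewrite pnatr_eq0.
pose d : C := 5.-root (12 ^+ 3).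
have d5 : d ^+ 5 = 12 ^+ 3 by rewrite rootCK.
have d0 : d != 0.
  apply: contra_eq_neq d5 => ->; rewrite expr0n /= eq_sym; exact: expf_neq0.
pose W := V1 `&` V2.
have Wo : open W by exact: openI.
have Wz : W z by split.
have WU : W `<=` U by move=> w [/V1U].
have lW : analytic_on W l by apply: sub_analytic_on lV => w [].
have sW : analytic_on W s by apply: sub_analytic_on sV => w [].
have lW5 w : W w -> l w ^+ 5 = invL1 E c w by case=> /lE[].
have lW0 w : W w -> l w != 0 by case=> /lE[].
have sW2 w : W w -> s w ^+ 2 = invL E c w by case=> _ /sE[].
have sW0 w : W w -> s w != 0 by case=> _ /sE[].
have LW0 w : W w -> invL E c w != 0 by case=> _ /V2U[].
pose al w := d ^+ 2 * l w ^+ 4 / (12 * invL E c w).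
pose be w := invTheta E c w / s w.
pose ga w := l w ^+ 2 / s w.
pose u w := 1 / al w.
pose v w := - 1 * (be w / (d * ga w)).
pose k := 12 / d ^+ 2.
have uE w : W w -> u w = k * invL E c w / l w ^+ 4.
  by move=> Ww; exact: explicit_u d0 n12 (sW2 w Ww) (lW0 w Ww) (sW0 w Ww).
have vE w : W w -> v w = - k ^+ 3 * invTheta E c w / l w ^+ 2.
  by move=> Ww; exact: explicit_v d5 d0 (lW0 w Ww) (sW0 w Ww).
have AW := sub_analytic_on WU AU; have BW := sub_analytic_on WU BU.
have LW := sub_analytic_on WU LU; have TW := sub_analytic_on WU ThetaU.
have t1W := sub_analytic_on WU theta1U; have t2W := sub_analytic_on WU theta2U.
have l4 w : W w -> l w ^+ 4 != 0 by move=> Ww; rewrite expf_neq0 // lW0.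
have l2 w : W w -> l w ^+ 2 != 0 by move=> Ww; rewrite expf_neq0 // lW0.
have uW : analytic_on W u.
  by apply: (eq_analytic_on Wo (fun w Ww => esym (uE w Ww))); analytic_on_tac.
have vW : analytic_on W v.
  by apply: (eq_analytic_on Wo (fun w Ww => esym (vE w Ww))); analytic_on_tac.
have L1W := sub_analytic_on WU L1U.
have n5 : (5 : C) != 0 by rewrite pnatr_eq0.
have lder w : W w -> Dx l w = phi1 E c w * l w /\ Dy l w = phi2 E c w * l w.
  move=> Ww; differentiate lW5 Ww lx ly; have [L1x L1y] := gradient_L1 (WU w Ww).
  have root := fifth_root_derivative (lW5 w Ww) (lW0 w Ww) n5.
  by split; [exact: (root _ _ _ lx L1x)|exact: (root _ _ _ ly L1y)].
have Tx w : W w -> Dx (invTheta E c) w =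
    2 * phi1 E c w * invTheta E c w - theta2 E c w.
  by move=> _; rewrite /theta2 opprD opprK addrCA subrr addr0.
have Ty w : W w -> Dy (invTheta E c) w =
    2 * phi2 E c w * invTheta E c w + theta1 E c w.
  by move=> _; rewrite /theta1 addrC subrK.
have Lx w : W w -> Dx (invL E c) w =
    4 * phi1 E c w * invL E c w - l w ^+ 5 * invA E w.
  by move=> Ww; rewrite (lW5 w Ww); have [] := gradient_L (WU w Ww).
have Ly w : W w -> Dy (invL E c) w =
    4 * phi2 E c w * invL E c w - l w ^+ 5 * invB E w.
  by move=> Ww; rewrite (lW5 w Ww); have [] := gradient_L (WU w Ww).
have covW : parallel_covector E W (invA E) (invB E) (phi1 E c) (phi2 E c).
  by move=> w /WU; exact: cov.
have thetaW : theta_equations E W (invA E) (invB E) (phi1 E c) (phi2 E c)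
    (invTheta E c) (theta1 E c) (theta2 E c) (invL E c).
  by move=> w /WU; exact: theta.
have normalW w : W w -> invA E w * theta1 E c w + invB E w * theta2 E c w = -1.
  by move=> /WU; exact: normal.
have k5 : 12 * k ^+ 5 = 1 by exact: explicit_scale d5 d0.
have k0 : k != 0 by rewrite mulf_neq0 // invr_eq0 expf_neq0.
have lx w (Ww : W w) := (lder w Ww).1.
have ly w (Ww : W w) := (lder w Ww).2.
have jac w : W w -> Defs.jacobian u v w != 0.
  move=> Ww; rewrite (reduction_jacobian Wo TW LW lW lW0 normalW Tx Ty Lx Ly
    lx ly uE vE uW vW Ww).
  by rewrite mulf_neq0 ?oppr_eq0 ?invr_eq0 ?expf_neq0 // lW0.
have pull w : W w -> pullback_equations E u v w.
  move=> Ww; exact: (reduction_pullback Wo AW BW TW t1W t2W LW lW lW0 k5 covW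
    thetaW Tx Ty Lx Ly lx ly uE vE uW vW Ww).
have [r [r0 inj]] := analytic_local_injective (uW z Wz) (vW z Wz) (jac z Wz).
pose V := W `&` [set w : C * C | `|w.1 - z.1| < r /\ `|w.2 - z.2| < r].
have VW : V `<=` W by move=> w [].
(* With these branches of the roots the sign is - 1. *)
exists V, al, be, ga, d, (-1); split; [|split; [|split; [|split; [|split]]]].
- split.
  + by split=> //=; rewrite !subrr normr0.
  + by move=> w /VW/WU.
  + by move=> w /VW; exact: LW0.
- have L12 w : W w -> 12 * invL E c w != 0.
    by move=> Ww; exact: (mulf_neq0 n12 (LW0 w Ww)).
  have alW : analytic_on W al by rewrite /al; analytic_on_tac.
  have beW : analytic_on W be by rewrite /be; analytic_on_tac.
  have gaW : analytic_on W ga by rewrite /ga; analytic_on_tac.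
  split; [exact: sub_analytic_on VW alW|exact: sub_analytic_on VW beW|].
  exact: sub_analytic_on VW gaW.
- move=> w /VW Ww; exact: (explicit_roots (invTheta E c w) d5 n12 (lW5 w Ww) (sW2 w Ww) (sW0 w Ww)).
- exact: d5.
- by right.
- move=> u' v'; split; last first.
    by move=> w Vw; exact: (pullback_maps_ode jac pull (VW w Vw)).
  split.
  + by apply: openI => //; exact: open_polydisc.
  + exact: sub_analytic_on VW uW.
  + exact: sub_analytic_on VW vW.
  + by move=> w /VW; exact: jac.
  + by move=> w w' [_ [w1 w2]] [_ [w1' w2']]; exact: inj.
Qed.

(** L1 is made of L and its derivatives. *)
Let invL_not_zero : ~ vanishes_on U (invL E c).
Proof.
move=> L0; apply: (cond_L1 conditions) => z Uz.
have Lx := etrans (eq_on_Dx (g := fun=> 0) U_open L0 Uz) (DxC 0 z).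
have Ly := etrans (eq_on_Dy (g := fun=> 0) U_open L0 Uz) (DyC 0 z).
have zero (x y l s t w : C) : x = 0 -> y = 0 -> l = 0 ->
  x * s + y * t - 4 * l * w = 0 by move=> -> -> ->; ring.
exact: (zero _ _ _ _ _ _ Lx Ly (L0 z Uz)).
Qed.

(** The zeros of the denominator and of the numerators of L and L1 are avoided on
    a dense open set, by the identity theorem for their product. *)
Lemma generic_explicit_reduction : generically D (explicit_reduction_at E c D).
Proof.
have [g [gD g0 gE]] := mero_numerator L_mero invL_not_zero.
have [h [hD h0 hE]] := mero_numerator L1_mero (cond_L1 conditions).
have ghD := analytic_onM gD hD.
have fD := analytic_onM den_analytic ghD.
have f0 := not_vanishesM D_open D_connected den_analytic ghD den_nonzero
  (not_vanishesM D_open D_connected gD hD g0 h0).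
exists [set z | D z /\ chart_den E c z * (g z * h z) != 0]; split.
- exact: nonzero_open.
- by move=> z [].
- exact: nonzero_dense.
- move=> z [Dz]; rewrite !mulf_eq0 !negb_or => /andP[dz /andP[gz hz]].
  have Uz : U z by split.
  exact: (explicit_reduction Uz (gE z Uz gz) (hE z Uz hz)).
Qed.

End FromConditions.

Theorem theorem1 (K : realType) (D : set (K[i] * K[i]))
  (D_open : open D) (D_connected : connected D) (D_nonempty : D !=set0)
  (E : cubic_ode K)
  (P_analytic : analytic_on D (coefP E))
  (Q_analytic : analytic_on D (coefQ E))
  (R_analytic : analytic_on D (coefR E))
  (S_analytic : analytic_on D (coefS E))
  (F : K[i] * K[i] -> K[i])
  (F_def : forall z, D z ->
     3 * F z ^+ 5 = invA E z * invG E z + invB E z * invH E z)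
  (c : chart)
  (c_admissible : ~ vanishes_on D (invA E) \/ ~ vanishes_on D (invB E) ->
     ~ vanishes_on D (chart_den E c)) :
  (equivalent_odes D E painleve1 <-> painleve1_conditions E c D F) /\
  (painleve1_conditions E c D F ->
     generically D (explicit_reduction_at E c D)).
Proof.
have reduction (cond : painleve1_conditions E c D F) :
    generically D (explicit_reduction_at E c D).
  exact: (generic_explicit_reduction D_open D_connected P_analytic Q_analytic
    R_analytic S_analytic F_def (c_admissible (cond_AB cond)) cond).
split; last exact: reduction.
split.
  exact: (equivalent_conditions D_open D_nonempty P_analytic Q_analytic
    R_analytic S_analytic F_def c_admissible).
move=> /reduction[X [Xo OD Ocl red]]; exists X; split=> // z /red.
move=> [U [a [b [g [d [s [[Uz UW _] [_ [_ [_ [_ [trans maps]]]]]]]]]]]].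
exists U, (fun w => 1 / a w), (fun w => s * (b w / (d * g w))).
by split=> // w /UW[].
Qed.
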